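(* Let $0<\beta<1$ be given and let $c$ be a positive number less than $\sqrt{\min(1/2,\,1-\beta)}$. If $T$ is sufficiently large, then there exists a $t$ with $T^{\beta}\le t\le T$ such that \[ \left|\zeta\Big(\frac12+it\Big)\right| \ge \exp\left(c\sqrt{\frac{\log T\,\log\log\log T}{\log\log T}}\right). \]
   Context: $\zeta$ denotes the Riemann zeta function. *)

(* Defs.v *)
(* Stdlib reals with Coquelicot's complex numbers. *)
From Stdlib Require Export Reals.
From Coquelicot Require Export Coquelicot.
Open Scope R_scope.

Definition Cexp (z : C) : C := (exp (Re z) * cos (Im z), exp (Re z) * sin (Im z)).

Definition analytic_at (f : C -> C) (z : C) : Prop :=
  exists (a : nat -> C) (r : R), 0 < r /\
    forall w : C, Cmod (w - z)%C < r ->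
      is_pseries (K := C_AbsRing) (V := C_NormedModule) a (w - z)%C (f w).

(* The term of index n is (n+1)^(-s), with the real logarithm of n+1. *)
Definition dirichlet_term (s : C) (n : nat) : C :=
  Cexp (- s * RtoC (ln (INR (S n))))%C.

(* C \ {1} is connected, so by the identity theorem these two conditions
   determine zeta everywhere except at 1, where its value is arbitrary. *)
Definition is_riemann_zeta (zeta : C -> C) : Prop :=
  (forall s : C, s <> RtoC 1 -> analytic_at zeta s) /\
  (forall s : C, 1 < Re s ->
     is_series (K := C_AbsRing) (V := C_NormedModule) (dirichlet_term s) (zeta s)).

(* Main.v *)
(** Suppose [|zeta(1/2+it)| <= V] for [Y <= t <= T], where [Y = T^beta]. Let
    [R(t) = sum_j r_j e^(-itj/T)] with [r_j >= 0] and integrate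
    [Re zeta(1/2+it) |R(t)|^2] against a nonnegative combination [K] of three
    tents which vanishes outside [[Y,T]]. The Fourier transform of a tent is a
    Fejer kernel, which is nonnegative and concentrated near [0]. As the
    frequencies [j/T] are separated, the integral is [O(V T) sum r_j^2]. On the
    other hand, [zeta(s)] is the limit of
    [sum_(k <= n) k^(-s) - (n+1)^(1-s)/(1-s)]; the part [k > T] and the pole
    term contribute only [O(sqrt T log T)] for each pair of frequencies, the two
    smaller tents [O(Y)], and the terms [k <= T] are all nonnegative. Grouping a
    finite set of integers [m] according to [floor (T log m)], one gets an upper
    bound for [sum_(k <= T) k^(-1/2) sum_m f(m) f(km)] in terms of [V] and of
    [sum f^2].

    For [f] take the multiplicative function on products of distinct primes
    [p] with [1 <= log(p/X) <= delta loglog T], [X = log T loglog T], given by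
    [f(p) = sqrt(B/p) / log(p/X)], [B = kappa X / logloglog T], restricted to
    those [m] with [f(m)^2 >= e^(-W)]. The restriction keeps
    [(sum f)^2 <= e^W prod (1+f(p)^2) sum f^2] below a power of [T], and by
    Rankin's trick neither it nor the condition [k <= T] loses more than a
    constant factor, so that the sum is at least
    [(1/2) prod (1 + f(p) p^(-1/2) / (1+f(p)^2)) sum f^2]. Mertens' first theorem
    evaluates the product. *)

From HB Require Import structures.
Require Import Defs.
From Stdlib Require Import Reals Lra Lia Classical.
From Coquelicot Require Import Coquelicot.
From mathcomp Require Import all_boot.
Open Scope R_scope.

HB.instance Definition _ := Monoid.isComLaw.Build R 0 Rplus
  (fun x y z => esym (Rplus_assoc x y z)) Rplus_comm Rplus_0_l.
HB.instance Definition _ := Monoid.isComLaw.Build R 1 Rmult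
  (fun x y z => esym (Rmult_assoc x y z)) Rmult_comm Rmult_1_l.
HB.instance Definition _ := Monoid.isMulLaw.Build R 0 Rmult Rmult_0_l Rmult_0_r.
HB.instance Definition _ := Monoid.isAddLaw.Build R Rmult Rplus
  (fun x y z => Rmult_plus_distr_r x y z) (fun x y z => Rmult_plus_distr_l x y z).

Notation "\rsum_ ( i <- r | P ) F" := (\big[Rplus/0]_(i <- r | P%B) F)
  (at level 36, F at level 36, i, r at level 50) : R_scope.
Notation "\rsum_ ( i <- r ) F" := (\big[Rplus/0]_(i <- r) F)
  (at level 36, F at level 36, i, r at level 50) : R_scope.
Notation "\rsum_ ( m <= i < n | P ) F" := (\big[Rplus/0]_(m <= i < n | P%B) F)
  (at level 36, F at level 36, i, m, n at level 50) : R_scope.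
Notation "\rsum_ ( m <= i < n ) F" := (\big[Rplus/0]_(m <= i < n) F)
  (at level 36, F at level 36, i, m, n at level 50) : R_scope.
Notation "\rsum_ ( i : T ) F" := (\big[Rplus/0]_(i : T) F)
  (at level 36, F at level 36, i at level 50) : R_scope.
Notation "\rsum_ ( i : T | P ) F" := (\big[Rplus/0]_(i : T | P%B) F)
  (at level 36, F at level 36, i at level 50) : R_scope.
Notation "\rprod_ ( i : T ) F" := (\big[Rmult/1]_(i : T) F)
  (at level 36, F at level 36, i at level 50) : R_scope.
Notation "\rprod_ ( i <- r ) F" := (\big[Rmult/1]_(i <- r) F)
  (at level 36, F at level 36, i, r at level 50) : R_scope.

Lemma rsum_le (I : Type) (r : seq I) (P : pred I) (F G : I -> R) :
  (forall i, P i -> F i <= G i) ->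
  \rsum_(i <- r | P i) F i <= \rsum_(i <- r | P i) G i.
Proof.
move=> H; apply: (big_ind2 (fun x y => x <= y)) => //; first lra.
by move=> *; lra.
Qed.

Lemma rsum_ge0 (I : Type) (r : seq I) (P : pred I) (F : I -> R) :
  (forall i, P i -> 0 <= F i) -> 0 <= \rsum_(i <- r | P i) F i.
Proof. by move=> H; apply: (big_ind (fun x => 0 <= x)) => // *; lra. Qed.

Lemma rsum_abs (I : Type) (r : seq I) (P : pred I) (F : I -> R) :
  Rabs (\rsum_(i <- r | P i) F i) <= \rsum_(i <- r | P i) Rabs (F i).
Proof.
apply: (big_ind2 (fun x y => Rabs x <= y)) => [|x1 x2 y1 y2 H1 H2|i _].
- rewrite Rabs_R0; lra.
- have := Rabs_triang x1 y1; lra.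
- lra.
Qed.

Lemma rsum_opp (I : Type) (r : seq I) (P : pred I) (F : I -> R) :
  \rsum_(i <- r | P i) - F i = - \rsum_(i <- r | P i) F i.
Proof. by apply: (big_ind2 (fun x y => x = - y)) => [|*|*]; lra. Qed.

Lemma rsum_minus (I : Type) (r : seq I) (P : pred I) (F G : I -> R) :
  \rsum_(i <- r | P i) (F i - G i) =
  \rsum_(i <- r | P i) F i - \rsum_(i <- r | P i) G i.
Proof. by rewrite /Rminus big_split /= rsum_opp. Qed.

Lemma rsum_scal (I : Type) (r : seq I) (P : pred I) (c : R) (F : I -> R) :
  \rsum_(i <- r | P i) (c * F i) = c * \rsum_(i <- r | P i) F i.
Proof. by rewrite big_distrr. Qed.

Lemma rsum_telescope (g : nat -> R) (m n : nat) : (m <= n)%N ->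
  \rsum_(m <= k < n) (g k.+1 - g k) = g n - g m.
Proof.
move=> /subnKC <-; elim: (n - m)%N => [|j IH].
  by rewrite addn0 big_geq //; lra.
by rewrite addnS big_nat_recr ?leq_addr //= IH; lra.
Qed.

Lemma rsum_nat_le (m n : nat) (F G : nat -> R) :
  (forall k, (m <= k)%N -> (k < n)%N -> F k <= G k) ->
  \rsum_(m <= k < n) F k <= \rsum_(m <= k < n) G k.
Proof.
move=> H; rewrite big_nat_cond [X in _ <= X]big_nat_cond.
by apply: rsum_le => k; rewrite andbT => /andP [H1 H2]; apply: H.
Qed.

Definition fejer (v : R) : R :=
  if Req_EM_T v 0 then 1 / 2 else (1 - cos v) / v ^ 2.

(** * The Fejer kernel *)

Lemma sqr_le1 (v : R) : v ^ 2 <= 1 -> -1 <= v <= 1.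
Proof. by move=> H; split; nra. Qed.

Lemma cos_taylor (v : R) : -1 <= v <= 1 ->
  1 - v ^ 2 / 2 <= cos v <= 1 - v ^ 2 / 2 + v ^ 4 / 24.
Proof.
move=> Hv.
have := pre_cos_bound v 0.
rewrite /cos_approx /cos_term /=.
move=> H; have := H ltac:(lra) ltac:(lra); move=> {H} [H1 H2].
split; [apply: Rle_trans H1 | apply: Rle_trans H2 _]; apply: Req_le; field.
Qed.

Lemma sin_taylor (v : R) : 0 <= v <= 1 -> v - v ^ 3 / 6 <= sin v <= v.
Proof.
move=> Hv; split.
  have := pre_sin_bound v 0 ltac:(lra) ltac:(lra).
  rewrite /sin_approx /sin_term /= => -[H1 _].
  apply: Rle_trans H1; apply: Req_le; field.
case: (Req_dec v 0) => [->|Hv0]; first by rewrite sin_0; lra.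
by have := sin_lt_x v ltac:(lra); lra.
Qed.

Lemma sin_sqr_le (x : R) : sin x ^ 2 <= x ^ 2.
Proof.
have key y : 0 <= y -> sin y ^ 2 <= y ^ 2.
  move=> Hy; have := SIN_bound y => ?.
  case: (Rle_dec y 1) => ?; last nra.
  have [s1 s2] := sin_taylor y ltac:(lra).
  have : 0 <= y - y ^ 3 / 6 by nra.
  by move=> ?; apply: pow_incr; lra.
case: (Rle_dec 0 x) => Hx; first exact: key.
have := key (- x) ltac:(lra); rewrite sin_neg; nra.
Qed.

Lemma fejer_opp v : fejer (- v) = fejer v.
Proof.
rewrite /fejer; case: Req_EM_T => /= H1; case: Req_EM_T => /= H2; try lra.
by rewrite cos_neg; field.
Qed.

Lemma fejer_ge0 v : 0 <= fejer v.
Proof.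
rewrite /fejer; case: Req_EM_T => /= H; first lra.
apply: Rmult_le_pos; first by have := COS_bound v; lra.
by apply/Rlt_le/Rinv_0_lt_compat; nra.
Qed.

Lemma fejer_near0 v : -1 <= v <= 1 -> 1 / 2 - v ^ 2 / 24 <= fejer v <= 1 / 2.
Proof.
move=> Hv; rewrite /fejer; case: Req_EM_T => /= H; first by rewrite H; lra.
have [H1 H2] := cos_taylor v Hv.
have Hp : 0 < v ^ 2 by nra.
by split; [apply/Rle_div_r | apply/Rle_div_l] => //; nra.
Qed.

Lemma fejer_ge_quarter v : -1 <= v <= 1 -> 1 / 4 <= fejer v.
Proof. by move=> Hv; have := fejer_near0 v Hv; nra. Qed.

Lemma fejer_le v : fejer v <= 4 / (1 + v ^ 2).
Proof.
have Hq : 0 < 1 + v ^ 2 by nra.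
apply/Rle_div_r => //.
case: (Rle_dec (v ^ 2) 1) => Hv.
  have := fejer_near0 v (sqr_le1 v Hv); have := fejer_ge0 v; nra.
rewrite /fejer; case: Req_EM_T => /= H; first nra.
have -> : (1 - cos v) / v ^ 2 * (1 + v ^ 2) = (1 - cos v) * (1 + / v ^ 2).
  by field.
have : / v ^ 2 <= 1 by rewrite -Rinv_1; apply: Rinv_le_contravar; lra.
have : 0 < / v ^ 2 by apply: Rinv_0_lt_compat; nra.
have := COS_bound v; nra.
Qed.

Lemma fejer_le_half v : fejer v <= 1 / 2.
Proof.
case: (Rle_dec (v ^ 2) 1) => Hv; first by have := fejer_near0 v (sqr_le1 v Hv); lra.
rewrite /fejer; case: Req_EM_T => /= H; first lra.
have -> : cos v = 1 - 2 * sin (v / 2) ^ 2.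
  rewrite {1}(_ : v = 2 * (v / 2)); last field.
  rewrite cos_2a_sin; ring.
have Hs := sin_sqr_le (v / 2).
apply: (Rmult_le_reg_r (v ^ 2)); first nra.
have -> : (1 - (1 - 2 * sin (v / 2) ^ 2)) / v ^ 2 * v ^ 2 = 2 * sin (v / 2) ^ 2.
  by field.
lra.
Qed.

Lemma fejer_is_derive v : v <> 0 ->
  is_derive fejer v (sin v / v ^ 2 - 2 * (1 - cos v) / v ^ 3).
Proof.
move=> Hv.
apply: (is_derive_ext_loc (fun v => (1 - cos v) / v ^ 2)).
  have Hp : 0 < Rabs v by apply: Rabs_pos_lt.
  exists (mkposreal _ Hp) => y Hy.
  rewrite /fejer; case: Req_EM_T => /= // Hy0.
  move: Hy; rewrite /ball /= /AbsRing_ball /= /abs /minus /plus /opp /=.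
  by rewrite Hy0 Rplus_0_l Rabs_Ropp; lra.
by auto_derive => //; [nra | field].
Qed.

Lemma fejer_continuity : continuity fejer.
Proof.
move=> v; case: (Req_dec v 0) => [->|Hv]; last first.
  apply/continuity_pt_filterlim; apply: ex_derive_continuous.
  by eexists; apply: fejer_is_derive.
move=> e He; exists (Rmin 1 e); split; first by apply: Rmin_pos; lra.
move=> x [_ /=]; rewrite /Rdist Rminus_0_r => Hx.
have H1 := Rmin_l 1 e; have H2 := Rmin_r 1 e.
have [Hx1 Hx2] : -1 <= x <= 1.
  by move: Hx; rewrite /Rabs; case: Rcase_abs; lra.
have [H3 H4] := fejer_near0 x ltac:(lra).
have -> : fejer 0 = 1 / 2 by rewrite /fejer; case: Req_EM_T => /= *; lra.
rewrite Rabs_left1; last lra.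
have : x ^ 2 <= Rabs x.
  rewrite /Rabs; case: Rcase_abs; nra.
nra.
Qed.

Lemma fejer_derive_bound v : 0 < v ->
  Rabs (sin v / v ^ 2 - 2 * (1 - cos v) / v ^ 3) <= 10 / (1 + v ^ 2).
Proof.
move=> Hv.
case: (Rle_dec v 1) => Hv1.
  have [s1 s2] := sin_taylor v ltac:(lra).
  have [c1 c2] := cos_taylor v ltac:(lra).
  have -> : sin v / v ^ 2 - 2 * (1 - cos v) / v ^ 3
     = (v * sin v - 2 * (1 - cos v)) / v ^ 3 by field; lra.
  have H3 : 0 < v ^ 3 by apply: pow_lt.
  have Ha : Rabs ((v * sin v - 2 * (1 - cos v)) / v ^ 3) <= 1.
    by apply: Rabs_le; split; [apply/Rle_div_r | apply/Rle_div_l] => //; nra.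
  apply: Rle_trans Ha _.
  by apply/Rle_div_r; nra.
have Hs := SIN_bound v; have Hc := COS_bound v.
have -> : sin v / v ^ 2 - 2 * (1 - cos v) / v ^ 3
     = (sin v - 2 * (1 - cos v) / v) / v ^ 2 by field; lra.
have Hi : 0 < / v <= 1.
  split; first by apply: Rinv_0_lt_compat.
  by rewrite -Rinv_1; apply: Rinv_le_contravar; lra.
have Ha : Rabs (sin v - 2 * (1 - cos v) / v) <= 5.
  by rewrite /Rdiv; apply: Rabs_le; nra.
rewrite Rabs_div; last nra.
rewrite (Rabs_pos_eq (v ^ 2)); last nra.
apply: (Rmult_le_reg_r ((1 + v ^ 2) * v ^ 2)); first nra.
have -> : Rabs (sin v - 2 * (1 - cos v) / v) / v ^ 2 * ((1 + v ^ 2) * v ^ 2) =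
  Rabs (sin v - 2 * (1 - cos v) / v) * (1 + v ^ 2) by field; lra.
have -> : 10 / (1 + v ^ 2) * ((1 + v ^ 2) * v ^ 2) = 10 * v ^ 2 by field; nra.
have := Rabs_pos (sin v - 2 * (1 - cos v) / v); nra.
Qed.

Lemma fejer_atan_pos v1 v2 : 0 <= v1 <= v2 ->
  Rabs (fejer v2 - fejer v1) <= 10 * (atan v2 - atan v1).
Proof.
move=> [H0 [H12|<-]]; last by rewrite !Rminus_diag Rabs_R0; lra.
have D v : 0 < v -> is_derive (fun v => 10 * atan v) v (10 / (1 + v ^ 2)).
  by move=> Hv; auto_derive => //; field; nra.
have Ca v : continuity_pt (fun v => 10 * atan v) v.
  apply: continuity_pt_scal; apply/continuity_pt_filterlim.
  by apply: ex_derive_continuous; auto_derive.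
have key (s : R) : s = 1 \/ s = -1 ->
  0 <= (10 * atan v2 + s * fejer v2) - (10 * atan v1 + s * fejer v1).
  move=> Hs.
  have [||x [Hx ->]] := MVT_gen (fun v => 10 * atan v + s * fejer v) v1 v2
    (fun v => 10 / (1 + v ^ 2) + s * (sin v / v ^ 2 - 2 * (1 - cos v) / v ^ 3)).
  - rewrite Rmin_left ?Rmax_right; try lra.
    move=> x Hx.
    apply: (is_derive_plus (V := R_NormedModule)); first by apply: D; lra.
    by apply: is_derive_scal; apply: fejer_is_derive; lra.
  - move=> x _; apply: continuity_pt_plus => //.
    by apply: continuity_pt_scal; apply: fejer_continuity.
  - rewrite Rmin_left ?Rmax_right in Hx; try lra.
    apply: Rmult_le_pos; last lra.
    case: (Req_dec x 0) => [->|Hx0].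
      by rewrite cos_0 sin_0; case: Hs => ->; rewrite /Rdiv !Rminus_diag; lra.
    have := fejer_derive_bound x ltac:(lra).
    move/Rabs_le_between; case: Hs => ->; lra.
have := key 1 ltac:(lra); have := key (-1) ltac:(lra).
by move=> *; apply: Rabs_le; lra.
Qed.

Lemma fejer_atan v1 v2 : v1 <= v2 ->
  Rabs (fejer v2 - fejer v1) <= 10 * (atan v2 - atan v1).
Proof.
move=> H12.
case: (Rle_dec 0 v1) => H1; first exact: fejer_atan_pos.
case: (Rle_dec 0 v2) => H2.
  have A := fejer_atan_pos 0 v2 ltac:(lra).
  have B := fejer_atan_pos 0 (- v1) ltac:(lra).
  move: A B; rewrite fejer_opp atan_opp atan_0 => A B.
  have -> : fejer v2 - fejer v1 = (fejer v2 - fejer 0) - (fejer v1 - fejer 0) by ring.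
  apply: Rle_trans (Rabs_triang _ _) _; rewrite Rabs_Ropp; lra.
have := fejer_atan_pos (- v2) (- v1) ltac:(lra).
by rewrite !fejer_opp !atan_opp Rabs_minus_sym; lra.
Qed.

Lemma inv_sq_atan v : / (1 + v ^ 2) <= 3 * (atan (v + 1) - atan v).
Proof.
have [||x [Hx ->]] := MVT_gen atan v (v + 1) (fun v => / (1 + v ^ 2)).
- by move=> x _; auto_derive => //; field; nra.
- by move=> x _; apply/continuity_pt_filterlim; apply: ex_derive_continuous; auto_derive.
rewrite Rmin_left ?Rmax_right in Hx; try lra.
have Hp : 0 < 1 + v ^ 2 by nra.
have Hq : 0 < 1 + x ^ 2 by nra.
apply: (Rmult_le_reg_r ((1 + v ^ 2) * (1 + x ^ 2))); first nra.
have -> : / (1 + v ^ 2) * ((1 + v ^ 2) * (1 + x ^ 2)) = 1 + x ^ 2 by field; lra.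
have -> : 3 * (/ (1 + x ^ 2) * (v + 1 - v)) * ((1 + v ^ 2) * (1 + x ^ 2)) =
  3 * (1 + v ^ 2) by field; lra.
have : (x - v) ^ 2 <= 1 by nra.
nra.
Qed.

Lemma atan_mono x y : x <= y -> atan x <= atan y.
Proof. by case=> [H|->]; [apply/Rlt_le/atan_increasing | lra]. Qed.

Lemma atan_range x y : atan x - atan y <= 4.
Proof. have := atan_bound x; have := atan_bound y; have := PI_4; lra. Qed.

(* [1/(1+v^2)] is at most three times the increment of [atan] over [[v,v+1]], so
   sums over points with gaps at least [1] telescope. *)
Lemma fejer_separated_sum (v : nat -> R) (m n : nat) :
  (forall k, (m <= k)%N -> (k.+1 < n)%N -> v k + 1 <= v k.+1) ->
  \rsum_(m <= k < n) fejer (v k) <= 48.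
Proof.
move=> Hv.
case: (leqP n m) => [Hnm|Hmn]; first by rewrite big_geq //; lra.
pose g k := if (k < n)%N then atan (v k) else atan (v n.-1 + 1).
apply: (@Rle_trans _ (12 * (g n - g m))); last first.
  by rewrite /g ltnn Hmn; have := atan_range (v n.-1 + 1) (v m); lra.
rewrite -rsum_telescope ?big_distrr /=; last exact: ltnW.
apply: rsum_nat_le => k Hmk Hkn.
apply: Rle_trans (fejer_le _) _.
have := inv_sq_atan (v k).
suff : atan (v k + 1) <= g k.+1 by rewrite /g Hkn /Rdiv; lra.
rewrite /g; case: (ltnP k.+1 n) => H; first by apply: atan_mono; apply: Hv.
have -> : k = n.-1 by apply/eqP; rewrite -eqSS prednK ?(leq_trans _ Hmn) // eqn_leq Hkn H.
lra.
Qed.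

Lemma fejer_cos_integral (A w : R) : 0 < A ->
  is_RInt (fun t => cos (t * w) * (1 - t / A)) 0 A (A * fejer (A * w)).
Proof.
move=> HA; rewrite /fejer; case: Req_EM_T => /= Hw.
  have -> : w = 0 by nra.
  apply: (is_RInt_ext (fun t => 1 - t / A)).
    by move=> x _; rewrite Rmult_0_r cos_0 Rmult_1_l.
  have -> : A * (1 / 2) = minus (A - A ^ 2 / (2 * A)) (0 - 0 ^ 2 / (2 * A)).
    by rewrite /minus /plus /opp /=; field; lra.
  apply: (is_RInt_derive (fun t => t - t ^ 2 / (2 * A))).
    by move=> x _; auto_derive => //; field; lra.
  move=> x _; apply: ex_derive_continuous; auto_derive; lra.
have Hw0 : w <> 0 by move=> H; apply: Hw; rewrite H; ring.
pose P t := (1 - t / A) * sin (t * w) / w - cos (t * w) / (A * w ^ 2).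
have -> : A * ((1 - cos (A * w)) / (A * w) ^ 2) = minus (P A) (P 0).
  rewrite /P /minus /plus /opp /= Rmult_0_l cos_0 sin_0.
  by field; lra.
apply: is_RInt_derive.
  by move=> x _; rewrite /P; auto_derive; [|field; lra].
move=> x _; apply: ex_derive_continuous; auto_derive; lra.
Qed.

(** * Series and real-analytic functions *)

Definition rseries (a : nat -> R) (l : R) :=
  is_lim_seq (fun n => \rsum_(0 <= k < n) a k) l.

Lemma sum_n_big (a : nat -> R) n : sum_n a n = \rsum_(0 <= k < n.+1) a k.
Proof.
elim: n => [|n IH]; first by rewrite sum_O big_nat1.
by rewrite sum_Sn IH [in RHS]big_nat_recr.
Qed.

Lemma rseriesP (a : nat -> R) l : rseries a l <-> is_series a l.
Proof.
split=> H.
- apply: (filterlim_ext (fun n => \rsum_(0 <= k < n.+1) a k)).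
    by move=> n; rewrite sum_n_big.
  exact: (proj1 (is_lim_seq_incr_1 _ l) H).
- apply/is_lim_seq_incr_1.
  by apply: filterlim_ext H => n; rewrite sum_n_big.
Qed.

Lemma rseries_ext (a b : nat -> R) l : (forall n, a n = b n) -> rseries a l -> rseries b l.
Proof.
move=> H; apply: is_lim_seq_ext => n.
by apply: eq_bigr => i _.
Qed.

Lemma rseries_unique (a : nat -> R) l1 l2 : rseries a l1 -> rseries a l2 -> l1 = l2.
Proof.
move=> /is_lim_seq_unique H1 /is_lim_seq_unique H2.
by move: H1; rewrite H2 => -[].
Qed.

Lemma rseries_plus (a b : nat -> R) la lb : rseries a la -> rseries b lb ->
  rseries (fun n => a n + b n) (la + lb).
Proof.
move=> Ha Hb; apply: is_lim_seq_ext (is_lim_seq_plus' _ _ _ _ Ha Hb) => n /=.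
by rewrite big_split.
Qed.

Lemma rseries_scal (c : R) (a : nat -> R) l : rseries a l ->
  rseries (fun n => c * a n) (c * l).
Proof.
move=> Ha; apply: is_lim_seq_ext (is_lim_seq_scal_l _ c _ Ha) => n /=.
by rewrite big_distrr.
Qed.

Lemma rseries_scal_r (c : R) (a : nat -> R) l : rseries a l ->
  rseries (fun n => a n * c) (l * c).
Proof.
by move=> Ha; rewrite Rmult_comm; apply: rseries_ext (rseries_scal c _ _ Ha) => n; rewrite Rmult_comm.
Qed.

Lemma rseries_minus (a b : nat -> R) la lb : rseries a la -> rseries b lb ->
  rseries (fun n => a n - b n) (la - lb).
Proof.
move=> Ha Hb; apply: is_lim_seq_ext (is_lim_seq_minus' _ _ _ _ Ha Hb) => n /=.
by rewrite rsum_minus.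
Qed.

Lemma rseries_term0 (a : nat -> R) l : rseries a l -> is_lim_seq a 0.
Proof. by move/rseriesP => H; apply: ex_series_lim_0; exists l. Qed.

Lemma rsum_split (a : nat -> R) (m n : nat) : (m <= n)%N ->
  \rsum_(0 <= k < n) a k = \rsum_(0 <= k < m) a k + \rsum_(m <= k < n) a k.
Proof. by move=> H; rewrite -big_cat_nat. Qed.

Lemma rseries_pos_le (s : nat -> R) l n : (forall k, 0 <= s k) -> rseries s l ->
  \rsum_(0 <= k < n) s k <= l.
Proof.
move=> H0 H; apply: (is_lim_seq_incr_compare _ _ H) => m.
by rewrite big_nat_recr //=; have := H0 m; lra.
Qed.

Lemma rseries_tail (a s : nat -> R) l ls n : (forall k, Rabs (a k) <= s k) ->
  rseries a l -> rseries s ls ->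
  Rabs (l - \rsum_(0 <= k < n) a k) <= ls - \rsum_(0 <= k < n) s k.
Proof.
move=> H Ha Hs.
pose u m := Rabs (\rsum_(0 <= k < m) a k - \rsum_(0 <= k < n) a k).
pose v m := \rsum_(0 <= k < m) s k - \rsum_(0 <= k < n) s k.
have Hu : is_lim_seq u (Rabs (l - \rsum_(0 <= k < n) a k)).
  apply: (is_lim_seq_abs _ (Rbar.Finite _)); apply: is_lim_seq_minus' => //.
  exact: is_lim_seq_const.
have Hv : is_lim_seq v (ls - \rsum_(0 <= k < n) s k).
  by apply: is_lim_seq_minus' => //; exact: is_lim_seq_const.
apply: (is_lim_seq_le_loc u v _ _ _ Hu Hv).
exists n => m /leP Hm.
rewrite /u /v !(rsum_split _ _ _ Hm) ![_ + _ - _]Rplus_comm -!Rplus_assoc.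
rewrite !Rplus_opp_l !Rplus_0_l.
by apply: Rle_trans (rsum_abs _ _ _ _) _; apply: rsum_le => k _.
Qed.

Lemma rseries_dominated (a s : nat -> R) (M : R) : (forall k, Rabs (a k) <= s k) ->
  (forall n, \rsum_(0 <= k < n) s k <= M) -> exists l, rseries a l.
Proof.
move=> H HM.
have [ls Hls] : exists l, rseries s l.
  have [|n|l Hl] := ex_finite_lim_seq_incr (fun n => \rsum_(0 <= k < n) s k) M.
  - by move=> n; rewrite big_nat_recr //=; have := H n; have := Rabs_pos (a n); lra.
  - exact: HM.
  - by exists l.
have [l Hl] : ex_series a.
  apply: (@ex_series_le _ R_CompleteNormedModule _ s) => //.
  by exists ls; apply/rseriesP.
by exists l; apply/rseriesP.
Qed.

Lemma rsum_lim (g : nat -> nat -> R) (v : nat -> R) (n : nat) :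
  (forall k, is_lim_seq (fun J => g J k) (v k)) ->
  is_lim_seq (fun J => \rsum_(0 <= k < n) g J k) (\rsum_(0 <= k < n) v k).
Proof.
move=> H; elim: n => [|n IH].
  rewrite big_geq //; apply: is_lim_seq_ext (is_lim_seq_const 0) => J.
  by rewrite big_geq.
rewrite big_nat_recr //=.
apply: is_lim_seq_ext (is_lim_seq_plus' _ _ _ _ IH (H n)) => J.
by rewrite [in RHS]big_nat_recr.
Qed.

Lemma tannery (g : nat -> nat -> R) (v s L : nat -> R) (l ls : R) :
  (forall J k, Rabs (g J k) <= s k) -> rseries s ls ->
  (forall k, is_lim_seq (fun J => g J k) (v k)) ->
  (forall J, rseries (g J) (L J)) -> rseries v l ->
  is_lim_seq L l.
Proof.
move=> Hg Hs Hgv HL Hl.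
have Hv k : Rabs (v k) <= s k.
  have H1 := is_lim_seq_abs _ (Rbar.Finite _) (Hgv k).
  exact: (is_lim_seq_le _ _ _ _ (Hg^~ k) H1 (is_lim_seq_const (s k))).
apply/is_lim_seq_spec => -[eps Heps] /=.
have Heps3 : 0 < eps / 3 by lra.
have [K HK] := proj2 (is_lim_seq_spec _ _) Hs (mkposreal _ Heps3).
have {HK} := HK K (le_n _) => /= HK.
have [J0 HJ0] := proj2 (is_lim_seq_spec _ _) (rsum_lim g v K Hgv) (mkposreal _ Heps3).
exists J0 => J /HJ0 /= HJ.
have H1 := rseries_tail _ _ _ _ K (Hg J) (HL J) Hs.
have H2 := rseries_tail _ _ _ _ K Hv Hl Hs.
move: HK H1 H2 HJ => /Rabs_lt_between HK /Rabs_le_between H1 /Rabs_le_between H2 /Rabs_lt_between HJ.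
apply: Rabs_def1; lra.
Qed.

Lemma double_rseries (u : nat -> nat -> R) (s v w : nat -> R) (l ls : R) :
  (forall k J, \rsum_(0 <= j < J) Rabs (u k j) <= s k) -> rseries s ls ->
  (forall k, rseries (u k) (v k)) -> rseries v l ->
  (forall j, rseries (u^~ j) (w j)) -> rseries w l.
Proof.
move=> Hs Hls Hv Hl Hw.
apply: (tannery (fun J k => \rsum_(0 <= j < J) u k j) v s) Hls _ _ Hl => //.
  by move=> J k; apply: Rle_trans (rsum_abs _ _ _ _) _.
move=> J; elim: J => [|J IH].
  rewrite big_geq //; apply: is_lim_seq_ext (is_lim_seq_const 0) => n.
  by rewrite big1 // => i _; rewrite big_geq.
rewrite big_nat_recr //=.
apply: rseries_ext (rseries_plus _ _ _ _ IH (Hw J)) => k.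
by rewrite [in RHS]big_nat_recr.
Qed.

Definition real_analytic (f : R -> R) (x0 : R) :=
  exists (a : nat -> R) (r : R), 0 < r /\
    forall w, Rabs w < r -> rseries (fun j => a j * w ^ j) (f (x0 + w)).

Lemma pseries_bounded_tail (a : nat -> R) (r : R) : 0 < r ->
  (exists l, rseries (fun j => a j * r ^ j) l) ->
  exists M, 0 <= M /\ forall w l, 0 <= w <= r / 2 ->
    rseries (fun j => a j * w ^ j) l -> Rabs (l - a 0%N) <= M * w.
Proof.
move=> Hr [l0 /rseries_term0 H0].
have [M HM] : exists M, forall n, Rabs (a n * r ^ n) <= M.
  have [K HK] := proj2 (is_lim_seq_spec _ _) H0 (mkposreal 1 Rlt_0_1).
  have {}HK n : (K <= n)%N -> Rabs (a n * r ^ n) <= 1.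
    by move/leP/HK => /=; rewrite Rminus_0_r; lra.
  exists (1 + \rsum_(0 <= n < K) Rabs (a n * r ^ n)) => n.
  have Hpos : 0 <= \rsum_(0 <= n < K) Rabs (a n * r ^ n).
    by apply: rsum_ge0 => *; apply: Rabs_pos.
  case: (leqP K n) => Hn; first by have := HK n Hn; lra.
  rewrite (rsum_split _ _ _ (ltnW Hn)).
  rewrite [X in _ + (_ + X)]big_ltn //=.
  have H1 : 0 <= \rsum_(0 <= n < n) Rabs (a n * r ^ n).
    by apply: rsum_ge0 => *; apply: Rabs_pos.
  have H2 : 0 <= \rsum_(n.+1 <= n < K) Rabs (a n * r ^ n).
    by apply: rsum_ge0 => *; apply: Rabs_pos.
  lra.
have HM0 : 0 <= M by have := HM 0%N; have := Rabs_pos (a 0%N * r ^ 0); lra.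
exists (2 * M / r); split.
  by apply: Rmult_le_pos; [lra | apply/Rlt_le/Rinv_0_lt_compat].
move=> w l Hw Hl.
pose q := w / r.
have Hq : 0 <= q <= 1 / 2.
  split; first by apply: Rmult_le_pos; [lra | apply/Rlt_le/Rinv_0_lt_compat].
  by apply/Rle_div_l; lra.
have Hterm n : Rabs (a n * w ^ n) <= M * q ^ n.
  have -> : a n * w ^ n = (a n * r ^ n) * q ^ n.
    by rewrite /q Rpow_mult_distr pow_inv; field; apply: pow_nonzero; lra.
  rewrite Rabs_mult (Rabs_pos_eq (q ^ n)); last by apply: pow_le; lra.
  by apply: Rmult_le_compat_r; [apply: pow_le; lra | apply: HM].
have Hgeo : rseries (fun n => M * q ^ n) (M * / (1 - q)).
  apply: rseries_scal; apply/rseriesP; apply: is_series_geom.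
  by rewrite Rabs_pos_eq; lra.
have := rseries_tail _ _ _ _ 1 Hterm Hl Hgeo.
rewrite !big_nat1 !pow_O !Rmult_1_r => H.
apply: Rle_trans H _.
have -> : M * / (1 - q) - M = M * (q * / (1 - q)) by field; lra.
have -> : 2 * M / r * w = M * (q * 2) by rewrite /q; field; lra.
apply: Rmult_le_compat_l => //; apply: Rmult_le_compat_l; first lra.
rewrite -[2]Rinv_inv; apply: Rinv_le_contravar; lra.
Qed.

Lemma pseries_zero_coef (n : nat) : forall (a : nat -> R) (r : R), 0 < r ->
  (forall w, 0 < w <= r -> rseries (fun j => a j * w ^ j) 0) -> a n = 0.
Proof.
have a0 (a : nat -> R) (r : R) : 0 < r ->
    (forall w, 0 < w <= r -> rseries (fun j => a j * w ^ j) 0) -> a 0%N = 0.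
  move=> Hr Ha.
  have [|M [HM H]] := pseries_bounded_tail a r Hr.
    by exists 0; apply: Ha; lra.
  apply: NNPP => Hne.
  have Hp : 0 < Rabs (a 0%N) by apply: Rabs_pos_lt.
  pose w := Rmin (r / 2) (Rabs (a 0%N) / (2 * (M + 1))).
  have Hw : 0 < w.
    by rewrite /w; apply Rmin_pos; [lra | apply: Rdiv_lt_0_compat; lra].
  have Hw1 : w <= r / 2 by apply: Rmin_l.
  have Hw2 : w <= Rabs (a 0%N) / (2 * (M + 1)) by apply: Rmin_r.
  have := H w 0 (conj (Rlt_le _ _ Hw) Hw1) (Ha w ltac:(lra)).
  rewrite /Rminus Rplus_0_l Rabs_Ropp => H1.
  move: Hw2 => /Rle_div_r; move/(_ ltac:(lra)); nra.
elim: n => [|n IH] a r Hr Ha; first exact: (a0 a r).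
apply: (IH (fun j => a j.+1) r) => // w Hw.
have Hz := a0 a r Hr Ha.
have : is_lim_seq (fun n => \rsum_(0 <= k < n.+1) (a k * w ^ k)) 0.
  exact: (proj1 (is_lim_seq_incr_1 _ (Rbar.Finite 0)) (Ha w Hw)).
move=> /(is_lim_seq_scal_l _ (/ w)) /=; rewrite Rmult_0_r.
apply: is_lim_seq_ext => m.
rewrite big_nat_recl //= Hz Rmult_0_l Rplus_0_l big_distrr /=.
by apply: eq_bigr => i _; field; lra.
Qed.

(* At the supremum of the set where [f <> 0] the power series vanishes on the right,
   hence identically. *)
Lemma real_analytic_identity (f : R -> R) :
  (forall x, 0 < x -> real_analytic f x) -> (forall x, 1 < x -> f x = 0) ->
  forall x, 0 < x -> f x = 0.
Proof.
move=> Hf H1 x0 Hx0; apply: NNPP => Hne.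
pose S x := 0 < x /\ f x <> 0.
have [||m [Hub Hlub]] := completeness S.
- by exists 1 => x [_ Hx]; apply: Rnot_lt_le => /H1.
- by exists x0.
have Hm : 0 < m by have := Hub x0 (conj Hx0 Hne); lra.
have Hz x : m < x -> f x = 0.
  move=> Hx; apply: NNPP => H.
  have Sx : S x by split=> //; lra.
  by have := Hub x Sx; lra.
have [a [r [Hr Ha]]] := Hf m Hm.
have Hc n : a n = 0.
  apply: (pseries_zero_coef n a (r / 2)); first lra.
  move=> w Hw; rewrite -(Hz (m + w)); last lra.
  by apply: Ha; rewrite Rabs_pos_eq; lra.
suff Hb : is_upper_bound S (m - r / 2) by have := Hlub _ Hb; lra.
move=> x [Hx Hfx]; apply: Rnot_lt_le => Hxm; apply: Hfx.
case: (Rlt_dec m x) => Hmx; first exact: Hz.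
have -> : x = m + (x - m) by ring.
have Hs := Ha (x - m) ltac:(apply: Rabs_def1; lra).
apply: (rseries_unique _ _ _ Hs).
apply: is_lim_seq_ext (is_lim_seq_const 0) => n.
by rewrite big1 // => i _; rewrite Hc Rmult_0_l.
Qed.

Lemma real_analytic_plus f g x0 : real_analytic f x0 -> real_analytic g x0 ->
  real_analytic (fun x => f x + g x) x0.
Proof.
move=> [a [r [Hr Ha]]] [b [s [Hs Hb]]]; exists (fun n => a n + b n), (Rmin r s).
split; first exact: Rmin_pos.
move=> w Hw; have H1 := Rmin_l r s; have H2 := Rmin_r r s.
apply: rseries_ext (rseries_plus _ _ _ _ (Ha w _) (Hb w _)) => [n||]; lra.
Qed.

Lemma real_analytic_scal c f x0 : real_analytic f x0 ->
  real_analytic (fun x => c * f x) x0.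
Proof.
move=> [a [r [Hr Ha]]]; exists (fun n => c * a n), r; split=> // w Hw.
by apply: rseries_ext (rseries_scal c _ _ (Ha w Hw)) => n; ring.
Qed.

Lemma real_analytic_const c x0 : real_analytic (fun _ => c) x0.
Proof.
exists (fun n => if n is 0%N then c else 0), 1; split=> [|w _]; first lra.
apply/is_lim_seq_incr_1; apply: is_lim_seq_ext (is_lim_seq_const c) => n.
rewrite big_nat_recl //= big1 => [|i _]; ring.
Qed.

Lemma rseries_shift (a : nat -> R) (w l : R) : rseries (fun j => a j * w ^ j) l ->
  rseries (fun j => PS_incr_1 a j * w ^ j) (w * l).
Proof.
move=> H; apply/is_lim_seq_incr_1.
apply: is_lim_seq_ext (rseries_scal w _ _ H) => n.
rewrite big_nat_recl //= [zero]/(0) Rmult_0_l Rplus_0_l.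
by apply: eq_bigr => i _; ring.
Qed.

Lemma real_analytic_mulx f x0 : real_analytic f x0 ->
  real_analytic (fun x => x * f x) x0.
Proof.
move=> [a [r [Hr Ha]]]; exists (fun n => x0 * a n + PS_incr_1 a n), r; split=> // w Hw.
have H1 := rseries_scal x0 _ _ (Ha w Hw).
have H2 := rseries_shift _ _ _ (Ha w Hw).
rewrite Rmult_plus_distr_r.
by apply: rseries_ext (rseries_plus _ _ _ _ H1 H2) => n; ring.
Qed.

(** * Approximation of zeta on the critical line *)

Lemma fst_sum_n (b : nat -> C) n : fst (sum_n (G := C_AbelianMonoid) b n) =
  \rsum_(0 <= k < n.+1) fst (b k).
Proof.
elim: n => [|n IH]; first by rewrite sum_O big_nat1.
by rewrite big_nat_recr // -IH sum_Sn.
Qed.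

Lemma snd_sum_n (b : nat -> C) n : snd (sum_n (G := C_AbelianMonoid) b n) =
  \rsum_(0 <= k < n.+1) snd (b k).
Proof.
elim: n => [|n IH]; first by rewrite sum_O big_nat1.
by rewrite big_nat_recr // -IH sum_Sn.
Qed.

Lemma is_series_C (b : nat -> C) (l : C) :
  is_series (K := C_AbsRing) (V := C_NormedModule) b l ->
  rseries (fun k => fst (b k)) (fst l) /\ rseries (fun k => snd (b k)) (snd l).
Proof.
case: l => x y H; split; apply/is_lim_seq_incr_1.
- apply: (filterlim_ext (fun n => fst (sum_n (G := C_AbelianMonoid) b n))).
    exact: fst_sum_n.
  by apply: filterlim_comp H _; apply: continuous_fst.
- apply: (filterlim_ext (fun n => snd (sum_n (G := C_AbelianMonoid) b n))).
    exact: snd_sum_n.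
  by apply: filterlim_comp H _; apply: continuous_snd.
Qed.

Lemma pow_n_RtoC (x : R) k : pow_n (K := C_AbsRing) (RtoC x) k = RtoC (x ^ k).
Proof.
elim: k => [|k IH] //=.
rewrite IH /mult /= /Cmult /RtoC /=; congr pair; ring.
Qed.

Lemma analytic_at_real (f : C -> C) (s0 t : R) : analytic_at f (s0, t) ->
  real_analytic (fun x => fst (f (x, t))) s0 /\ real_analytic (fun x => snd (f (x, t))) s0.
Proof.
move=> [a [r [Hr Ha]]].
have key w : Rabs w < r ->
   rseries (fun k => fst (a k) * w ^ k) (fst (f (s0 + w, t))) /\
   rseries (fun k => snd (a k) * w ^ k) (snd (f (s0 + w, t))).
  move=> Hw.
  have E : Cminus (s0 + w, t) (s0, t) = RtoC w.
    by rewrite /Cminus /Cplus /Copp /RtoC /=; congr pair; ring.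
  have := Ha (s0 + w, t); rewrite E Cmod_R => /(_ Hw) /is_series_C [H1 H2].
  split; [apply: rseries_ext H1 | apply: rseries_ext H2] => n;
    rewrite pow_n_RtoC /scal /= /mult /= /Cmult /RtoC /=; ring.
by split; [exists (fun k => fst (a k)), r | exists (fun k => snd (a k)), r];
  split=> // w /key [].
Qed.

(* With phases [phi = 0] and [phi = PI/2], the real and the imaginary part of
   [x^(1-s)], of its derivative [(1-s) x^(-s)] in [x], and of [s - 1] times the
   Euler-Maclaurin term of [zeta], where [s = sg + i t]. *)
Definition hterm (t phi sg x : R) := exp ((1 - sg) * ln x) * cos (t * ln x + phi).
Definition hterm' (t phi sg x : R) :=
  exp (- sg * ln x) * ((1 - sg) * cos (t * ln x + phi) - t * sin (t * ln x + phi)).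
Definition dterm (t phi sg : R) (n : nat) :=
  hterm t phi sg (INR n.+2) - hterm t phi sg (INR n.+1) - hterm' t phi sg (INR n.+1).

Definition ecoef (x : R) (j : nat) := (- ln x) ^ j / INR (Factorial.fact j).
Definition hcoef (t phi sg x : R) (j : nat) :=
  exp ((1 - sg) * ln x) * cos (t * ln x + phi) * ecoef x j.
Definition hcoef' (t phi sg x : R) (j : nat) :=
  exp (- sg * ln x) * (((1 - sg) * cos (t * ln x + phi) - t * sin (t * ln x + phi)) * ecoef x j
    - cos (t * ln x + phi) * PS_incr_1 (ecoef x) j).
Definition hcoef'' (t phi sg x : R) (j : nat) :=
  exp (- sg * ln x) * / x *
   (- sg * (((1 - sg) * cos (t * ln x + phi) - t * sin (t * ln x + phi)) * ecoef x j
             - cos (t * ln x + phi) * PS_incr_1 (ecoef x) j)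
    + (- (1 - sg) * t * sin (t * ln x + phi) - t ^ 2 * cos (t * ln x + phi)) * ecoef x j
    - ((1 - sg) * cos (t * ln x + phi) - t * sin (t * ln x + phi)) * PS_incr_1 (ecoef x) j
    + t * sin (t * ln x + phi) * PS_incr_1 (ecoef x) j
    + cos (t * ln x + phi) * PS_incr_1 (PS_incr_1 (ecoef x)) j).

Lemma INRS_gt0 n : 0 < INR n.+1.
Proof. by apply: lt_0_INR; lia. Qed.

Lemma ecoef_derive (x : R) j : 0 < x ->
  is_derive (fun x => ecoef x j) x (- / x * PS_incr_1 (ecoef x) j).
Proof.
move=> Hx; case: j => [|j].
  apply: (is_derive_ext (fun _ => 1)).
    by move=> u; rewrite /ecoef /=; field.
  by rewrite /= [zero]/(0) Rmult_0_r; apply: is_derive_const.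
change (PS_incr_1 (ecoef x) j.+1) with (ecoef x j).
rewrite /ecoef fact_simpl mult_INR.
have Hj := INRS_gt0 j; have Hf := INR_fact_neq_0 j.
move: (INR (Factorial.fact j)) Hf => F Hf.
auto_derive => //; rewrite ?[Nat.pred _]/=;
  change (match j with 0%N => 1 | _.+1 => INR j + 1 end) with (INR j.+1).
by field; repeat split; lra.
Qed.

Lemma ecoef_incr_derive (x : R) j : 0 < x ->
  is_derive (fun x => PS_incr_1 (ecoef x) j) x (- / x * PS_incr_1 (PS_incr_1 (ecoef x)) j).
Proof.
move=> Hx; case: j => [|j]; last exact: ecoef_derive.
by rewrite /= [zero]/(0) Rmult_0_r; apply: is_derive_const.
Qed.

Lemma hterm_mul_derive t phi sg (E : R -> R) E1 x : 0 < x ->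
  is_derive E x (- / x * E1) ->
  is_derive (fun x => exp ((1 - sg) * ln x) * cos (t * ln x + phi) * E x) x
   (exp (- sg * ln x) * (((1 - sg) * cos (t * ln x + phi) - t * sin (t * ln x + phi)) * E x
    - cos (t * ln x + phi) * E1)).
Proof.
move=> Hx H0.
have -> : exp (- sg * ln x) = exp ((1 - sg) * ln x) * / x.
  by rewrite -{3}(exp_ln x Hx) -exp_Ropp -exp_plus; congr exp; ring.
auto_derive; first by do ?split => //; eexists; exact: H0.
by rewrite (is_derive_unique (fun x => E x) _ _ H0); field; lra.
Qed.

Lemma hterm'_mul_derive t phi sg (E E1 : R -> R) E2 x : 0 < x ->
  is_derive E x (- / x * E1 x) -> is_derive E1 x (- / x * E2) ->
  is_derive (fun x => exp (- sg * ln x) * (((1 - sg) * cos (t * ln x + phi)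
    - t * sin (t * ln x + phi)) * E x - cos (t * ln x + phi) * E1 x)) x
  (exp (- sg * ln x) * / x *
   (- sg * (((1 - sg) * cos (t * ln x + phi) - t * sin (t * ln x + phi)) * E x
             - cos (t * ln x + phi) * E1 x)
    + (- (1 - sg) * t * sin (t * ln x + phi) - t ^ 2 * cos (t * ln x + phi)) * E x
    - ((1 - sg) * cos (t * ln x + phi) - t * sin (t * ln x + phi)) * E1 x
    + t * sin (t * ln x + phi) * E1 x
    + cos (t * ln x + phi) * E2)).
Proof.
move=> Hx H0 H1.
auto_derive; first by do ?split => //; eexists; first [exact: H0 | exact: H1].
rewrite (is_derive_unique (fun x => E x) _ _ H0) (is_derive_unique (fun x => E1 x) _ _ H1).
by field; lra.
Qed.

Lemma hcoef_derive t phi sg x j : 0 < x ->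
  is_derive (fun x => hcoef t phi sg x j) x (hcoef' t phi sg x j).
Proof.
move=> Hx; exact: (hterm_mul_derive t phi sg (fun x => ecoef x j) _ x Hx (ecoef_derive x j Hx)).
Qed.

Lemma hcoef'_derive t phi sg x j : 0 < x ->
  is_derive (fun x => hcoef' t phi sg x j) x (hcoef'' t phi sg x j).
Proof.
move=> Hx; exact: (hterm'_mul_derive t phi sg (fun x => ecoef x j)
  (fun x => PS_incr_1 (ecoef x) j) _ x Hx (ecoef_derive x j Hx) (ecoef_incr_derive x j Hx)).
Qed.

Lemma cos_sin_comb (a b th M : R) : Rabs a <= M -> Rabs b <= M ->
  Rabs (a * cos th + b * sin th) <= 2 * M.
Proof.
move=> Ha Hb.
apply: Rle_trans (Rabs_triang _ _) _; rewrite !Rabs_mult.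
have Hc : Rabs (cos th) <= 1 by apply: Rabs_le; have := COS_bound th; lra.
have Hs : Rabs (sin th) <= 1 by apply: Rabs_le; have := SIN_bound th; lra.
have := Rabs_pos (cos th); have := Rabs_pos (sin th).
have := Rabs_pos a; have := Rabs_pos b; nra.
Qed.

Lemma Rabs_comb3 (a b c x y z M : R) : Rabs a <= M -> Rabs b <= M -> Rabs c <= M ->
  Rabs (a * x + b * y + c * z) <= M * (Rabs x + Rabs y + Rabs z).
Proof.
move=> Ha Hb Hc.
apply: Rle_trans (Rabs_triang _ _) _.
apply: Rle_trans (Rplus_le_compat_r _ _ _ (Rabs_triang _ _)) _.
rewrite !Rabs_mult !Rmult_plus_distr_l.
by do !apply: Rplus_le_compat; apply: Rmult_le_compat_r => //; apply: Rabs_pos.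
Qed.

Lemma hcoef''_bound t phi sg x j : 0 < x -> 0 < sg ->
  Rabs (hcoef'' t phi sg x j) <= exp (- (sg + 1) * ln x) * (8 * (1 + sg + Rabs t) ^ 2) *
    (Rabs (ecoef x j) + Rabs (PS_incr_1 (ecoef x) j) + Rabs (PS_incr_1 (PS_incr_1 (ecoef x)) j)).
Proof.
move=> Hx Hsg; rewrite /hcoef''.
have -> : exp (- (sg + 1) * ln x) = exp (- sg * ln x) * / x.
  by rewrite -{3}(exp_ln x Hx) -exp_Ropp -exp_plus; congr exp; ring.
rewrite Rabs_mult (Rabs_pos_eq (exp _ * _)); last first.
  by apply: Rmult_le_pos; [apply/Rlt_le/exp_pos | apply/Rlt_le/Rinv_0_lt_compat].
rewrite [X in _ <= X]Rmult_assoc; apply: Rmult_le_compat_l.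
  by apply: Rmult_le_pos; [apply/Rlt_le/exp_pos | apply/Rlt_le/Rinv_0_lt_compat].
move: (t * ln x + phi) => th.
move: (ecoef x j) (PS_incr_1 (ecoef x) j) (PS_incr_1 (PS_incr_1 (ecoef x)) j) => E0 E1 E2.
set M := 8 * _.
have Ht := Rabs_pos t.
have Ht2 : Rabs t ^ 2 = t ^ 2 by rewrite RPow_abs Rabs_pos_eq //; apply: pow2_ge_0.
have HtM : Rabs t <= 1 + sg + Rabs t by lra.
have Hl : - Rabs t <= t <= Rabs t by split; [have := Rle_abs (- t); rewrite Rabs_Ropp;
  lra | exact: Rle_abs].
move: (Rabs t) Ht Ht2 HtM Hl @M => u Hu Hu2 _ Hl M.
set lhs := (X in Rabs X).
have -> : lhs = ((- sg * (1 - sg) - t ^ 2) * cos th + (sg * t - (1 - sg) * t) * sin th) * E0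
  + ((sg - (1 - sg)) * cos th + (2 * t) * sin th) * E1 + (1 * cos th + 0 * sin th) * E2.
  by rewrite /lhs; ring.
apply: Rabs_comb3.
- have -> : M = 2 * (4 * (1 + sg + u) ^ 2) by rewrite /M; ring.
  by apply: cos_sin_comb; apply: Rabs_le; split; nra.
- have -> : M = 2 * (4 * (1 + sg + u) ^ 2) by rewrite /M; ring.
  by apply: cos_sin_comb; apply: Rabs_le; split; nra.
- have -> : M = 2 * (4 * (1 + sg + u) ^ 2) by rewrite /M; ring.
  by apply: cos_sin_comb; apply: Rabs_le; split; nra.
Qed.

Lemma INRS_ge1 n : 1 <= INR n.+1.
Proof. by rewrite S_INR; have := pos_INR n; lra. Qed.

Lemma ln_ge0 x : 1 <= x -> 0 <= ln x.
Proof. by move=> [H|<-]; [rewrite -ln_1; apply/Rlt_le/ln_increasing; lra | rewrite ln_1; lra]. Qed.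

Lemma ln_le_compat x y : 0 < x -> x <= y -> ln x <= ln y.
Proof. by move=> Hx [H|->]; [apply/Rlt_le/ln_increasing; lra | lra]. Qed.

Lemma exp_le_compat x y : x <= y -> exp x <= exp y.
Proof. by move=> [H|->]; [apply/Rlt_le/exp_increasing | lra]. Qed.

Lemma rseries_exp y : rseries (fun j => y ^ j / INR (Factorial.fact j)) (exp y).
Proof.
apply/rseriesP; have /is_pseries_R := is_exp_Reals y.
by apply: is_series_ext => n; rewrite /Rdiv Rmult_comm.
Qed.

Lemma Rabs_ecoef x j : 1 <= x -> Rabs (ecoef x j) = ln x ^ j / INR (Factorial.fact j).
Proof.
move=> Hx; rewrite /ecoef Rabs_div; last exact: INR_fact_neq_0.
rewrite -RPow_abs Rabs_Ropp (Rabs_pos_eq (ln x)); last exact: ln_ge0.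
by rewrite Rabs_pos_eq //; apply: pos_INR.
Qed.

Lemma ecoef_mono x y j : 1 <= x <= y -> Rabs (ecoef x j) <= Rabs (ecoef y j).
Proof.
move=> [Hx Hxy]; rewrite !Rabs_ecoef //; last lra.
apply: Rmult_le_compat_r; first by apply/Rlt_le/Rinv_0_lt_compat/INR_fact_lt_0.
by apply: pow_incr; split; [exact: ln_ge0 | apply: ln_le_compat; lra].
Qed.

Lemma ecoef_sum x rho J : 1 <= x -> 0 <= rho ->
  \rsum_(0 <= j < J) (Rabs (ecoef x j) * rho ^ j) <= exp (rho * ln x).
Proof.
move=> Hx Hr.
apply: Rle_trans (rseries_pos_le _ _ J _ (rseries_exp (rho * ln x))); last first.
  move=> k; apply: Rmult_le_pos; last by apply/Rlt_le/Rinv_0_lt_compat/INR_fact_lt_0.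
  by apply: pow_le; apply: Rmult_le_pos => //; apply: ln_ge0.
apply: Req_le; apply: eq_bigr => j _.
by rewrite Rabs_ecoef // Rpow_mult_distr /Rdiv; ring.
Qed.

Lemma incr_sum (a : nat -> R) rho J : (forall j, 0 <= a j) -> 0 <= rho <= 1 ->
  \rsum_(0 <= j < J) (PS_incr_1 a j * rho ^ j) <= \rsum_(0 <= j < J) (a j * rho ^ j).
Proof.
move=> Ha Hr; case: J => [|J]; first by rewrite !big_geq //; lra.
rewrite big_nat_recl // big_nat_recr //= [zero]/(0) Rmult_0_l Rplus_0_l.
have H : 0 <= a J * rho ^ J by apply: Rmult_le_pos => //; apply: pow_le; lra.
suff : \rsum_(0 <= i < J) (a i * (rho * rho ^ i)) <= \rsum_(0 <= i < J) (a i * rho ^ i) by lra.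
apply: rsum_le => i _; apply: Rmult_le_compat_l => //.
have : 0 <= rho ^ i by apply: pow_le; lra.
nra.
Qed.

Lemma Rabs_incr (a : nat -> R) j : Rabs (PS_incr_1 a j) = PS_incr_1 (fun j => Rabs (a j)) j.
Proof. by case: j => [|j] //=; rewrite [zero]/(0) Rabs_R0. Qed.

Lemma incr_mono (a b : nat -> R) j : (forall j, a j <= b j) -> PS_incr_1 a j <= PS_incr_1 b j.
Proof. by case: j => [|j] /= H; [lra | apply: H]. Qed.

Lemma incr_ge0 (a : nat -> R) j : (forall j, 0 <= a j) -> 0 <= PS_incr_1 a j.
Proof. by case: j => [|j] /= H; [rewrite [zero]/(0); lra | apply: H]. Qed.

Lemma incr_ext (a b : nat -> R) j : (forall j, a j = b j) -> PS_incr_1 a j = PS_incr_1 b j.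
Proof. by case: j => [|j] /= H; [|apply: H]. Qed.

Definition dcoef (t phi sg : R) (n j : nat) :=
  hcoef t phi sg (INR n.+2) j - hcoef t phi sg (INR n.+1) j - hcoef' t phi sg (INR n.+1) j.

Lemma ex_derive_continuity (f : R -> R) x l : is_derive f x l -> continuity_pt f x.
Proof.
by move=> H; apply/continuity_pt_filterlim; apply: ex_derive_continuous; exists l.
Qed.

Lemma dcoef_bound t phi sg n j : 0 < sg ->
  Rabs (dcoef t phi sg n j) <= exp (- (sg + 1) * ln (INR n.+1)) * (8 * (1 + sg + Rabs t) ^ 2) *
    (Rabs (ecoef (INR n.+2) j) + Rabs (PS_incr_1 (ecoef (INR n.+2)) j)
     + Rabs (PS_incr_1 (PS_incr_1 (ecoef (INR n.+2))) j)).
Proof.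
move=> Hsg; rewrite /dcoef (S_INR n.+1).
have Ha := INRS_ge1 n; move: (INR n.+1) Ha => a Ha.
have [||x [Hx ->]] := MVT_gen (fun x => hcoef t phi sg x j) a (a + 1) (fun x => hcoef' t phi sg x j).
- by rewrite Rmin_left ?Rmax_right; try lra; move=> x Hx; apply: hcoef_derive; lra.
- rewrite Rmin_left ?Rmax_right; try lra; move=> x Hx.
  by apply: ex_derive_continuity; apply: hcoef_derive; lra.
rewrite Rmin_left ?Rmax_right in Hx; try lra.
have -> : a + 1 - a = 1 by ring.
rewrite Rmult_1_r.
have [||y [Hy ->]] := MVT_gen (fun x => hcoef' t phi sg x j) a x (fun x => hcoef'' t phi sg x j).
- by rewrite Rmin_left ?Rmax_right; try lra; move=> y Hy; apply: hcoef'_derive; lra.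
- rewrite Rmin_left ?Rmax_right; try lra; move=> y Hy.
  by apply: ex_derive_continuity; apply: hcoef'_derive; lra.
rewrite Rmin_left ?Rmax_right in Hy; try lra.
rewrite Rabs_mult (Rabs_pos_eq (x - a)); last lra.
have Hy0 : 0 < y by lra.
apply: (@Rle_trans _ (Rabs (hcoef'' t phi sg y j))).
  by have := Rabs_pos (hcoef'' t phi sg y j); nra.
apply: Rle_trans (hcoef''_bound t phi sg y j Hy0 Hsg) _.
apply: Rmult_le_compat.
- apply: Rmult_le_pos; [apply/Rlt_le/exp_pos|]; have := pow2_ge_0 (1 + sg + Rabs t); lra.
- by do !apply: Rplus_le_le_0_compat; apply: Rabs_pos.
- apply: Rmult_le_compat_r; first by have := pow2_ge_0 (1 + sg + Rabs t); lra.
  apply: exp_le_compat.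
  by have := ln_le_compat a y ltac:(lra) ltac:(lra); nra.
- have E k : Rabs (ecoef y k) <= Rabs (ecoef (a + 1) k) by apply: ecoef_mono; lra.
  do !apply: Rplus_le_compat => //.
    by rewrite !Rabs_incr; apply: incr_mono.
  rewrite !Rabs_incr; apply: incr_mono => i; rewrite !Rabs_incr.
  exact: incr_mono.
Qed.

Definition dmajor (T sg : R) (n : nat) :=
  exp (- (1 + sg / 2) * ln (INR n.+1)) * (48 * (1 + sg + T) ^ 2).

Lemma dcoef_sum t T phi sg rho n J : 0 < sg -> Rabs t <= T -> 0 <= rho -> rho <= 1 -> rho <= sg / 2 ->
  \rsum_(0 <= j < J) (Rabs (dcoef t phi sg n j) * rho ^ j) <= dmajor T sg n.
Proof.
move=> Hsg HT Hr0 Hr1 Hr2.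
set b := INR n.+2; set a := INR n.+1.
have Ha : 1 <= a by apply: INRS_ge1.
have Hb : 1 <= b by apply: INRS_ge1.
have Hab : b = a + 1 by rewrite /b S_INR.
set c := exp (- (sg + 1) * ln a) * (8 * (1 + sg + Rabs t) ^ 2).
have Hc : 0 <= c.
  apply: Rmult_le_pos; [apply/Rlt_le/exp_pos|]; have := pow2_ge_0 (1 + sg + Rabs t); lra.
pose e j := Rabs (ecoef b j).
have He j : 0 <= e j by apply: Rabs_pos.
have He1 j : 0 <= PS_incr_1 e j by apply: incr_ge0.
apply: (@Rle_trans _ (c * (\rsum_(0 <= j < J) (e j * rho ^ j) + \rsum_(0 <=
  j < J) (PS_incr_1 e j * rho ^ j)
   + \rsum_(0 <= j < J) (PS_incr_1 (PS_incr_1 e) j * rho ^ j)))).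
  rewrite -!big_split big_distrr /=; apply: rsum_le => j _.
  have Hrj : 0 <= rho ^ j by apply: pow_le.
  have := Rmult_le_compat_r _ _ _ Hrj (dcoef_bound t phi sg n j Hsg).
  rewrite -/a -/b -/c !Rabs_incr.
  rewrite (incr_ext (fun j0 => Rabs (PS_incr_1 (ecoef b) j0)) (PS_incr_1 e)); last by move=> i;
    rewrite Rabs_incr.
  rewrite -/e -/(e j); lra.
have H0 := ecoef_sum b rho J Hb Hr0.
have H1 := incr_sum e rho J He (conj Hr0 Hr1).
have H2 := incr_sum (PS_incr_1 e) rho J He1 (conj Hr0 Hr1).
apply: (@Rle_trans _ (c * (3 * exp (rho * ln b)))).
  by apply: Rmult_le_compat_l => //; rewrite -/e in H0; move: H0 H1 H2; rewrite /e; lra.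
have Hlb : exp (rho * ln b) <= 2 * exp (rho * ln a).
  rewrite -{1}[2]exp_ln; last lra.
  rewrite -exp_plus; apply: exp_le_compat.
  have : ln b <= ln 2 + ln a.
    by rewrite -ln_mult; try lra; apply: ln_le_compat; lra.
  have := ln_ge0 2 ltac:(lra); nra.
have Hla : exp (- (sg + 1) * ln a) * exp (rho * ln a) <= exp (- (1 + sg / 2) * ln a).
  rewrite -exp_plus; apply: exp_le_compat.
  have := ln_ge0 a Ha; nra.
have HtT : (1 + sg + Rabs t) ^ 2 <= (1 + sg + T) ^ 2.
  by apply: pow_incr; have := Rabs_pos t; lra.
rewrite /dmajor -/a /c.
have P1 := exp_pos (- (sg + 1) * ln a); have P2 := exp_pos (rho * ln a).
have P3 := pow2_ge_0 (1 + sg + Rabs t).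
apply: (@Rle_trans _ ((exp (- (sg + 1) * ln a) * exp (rho * ln a)) * (48 * (1 + sg + Rabs t) ^ 2))).
  have -> : exp (- (sg + 1) * ln a) * exp (rho * ln a) * (48 * (1 + sg + Rabs t) ^ 2) =
     exp (- (sg + 1) * ln a) * (8 * (1 + sg + Rabs t) ^ 2) * (3 * (2 * exp (rho * ln a))) by ring.
  by apply: Rmult_le_compat_l => //; lra.
apply: Rmult_le_compat => //; try lra.
by apply: Rmult_le_pos; lra.
Qed.

Lemma power_sum_bound (eps : R) n : 0 < eps ->
  \rsum_(0 <= k < n) exp (- (1 + eps) * ln (INR k.+1)) <= 1 + / eps.
Proof.
move=> He.
have Hie : 0 < / eps by apply: Rinv_0_lt_compat.
case: n => [|n]; first by rewrite big_geq //; lra.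
rewrite big_nat_recl // {1}[INR 1]/1 ln_1 Rmult_0_r exp_0.
apply: Rplus_le_compat_l.
pose g k := - exp (- eps * ln (INR k.+1)) * / eps.
apply: (@Rle_trans _ (\rsum_(0 <= k < n) (g k.+1 - g k))); last first.
  rewrite rsum_telescope // /g [INR 1]/1 ln_1 Rmult_0_r exp_0.
  by have := exp_pos (- eps * ln (INR n.+1)); nra.
apply: rsum_le => k _; rewrite /g (S_INR k.+1).
have Ha := INRS_ge1 k; move: (INR k.+1) Ha => a Ha.
pose f x := - exp (- eps * ln x) * / eps.
have D x : 0 < x -> is_derive f x (exp (- (1 + eps) * ln x)).
  move=> Hx; rewrite /f; auto_derive => //.
  have -> : - (1 + eps) * ln x = - eps * ln x + - ln x by ring.
  by rewrite exp_plus exp_Ropp exp_ln //; field; lra.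
have [||x [Hx]] := MVT_gen f a (a + 1) (fun x => exp (- (1 + eps) * ln x)).
- by rewrite Rmin_left ?Rmax_right; try lra; move=> x Hx; apply: D; lra.
- rewrite Rmin_left ?Rmax_right; try lra; move=> x Hx.
  by apply: ex_derive_continuity; apply: D; lra.
rewrite Rmin_left ?Rmax_right in Hx; try lra.
rewrite -/(f a) -/(f (a + 1)) => ->.
have -> : a + 1 - a = 1 by ring.
rewrite Rmult_1_r; apply: exp_le_compat.
by have := ln_le_compat x (a + 1) ltac:(lra) ltac:(lra); nra.
Qed.

Lemma dmajor_series T sg : 0 < sg -> exists l, rseries (dmajor T sg) l.
Proof.
move=> Hsg.
have [||l Hl] := rseries_dominated (fun n => exp (- (1 + sg / 2) * ln (INR n.+1)))
  (fun n => exp (- (1 + sg / 2) * ln (INR n.+1))) (1 + / (sg / 2)).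
- by move=> k; rewrite Rabs_pos_eq; [lra | apply/Rlt_le/exp_pos].
- by move=> n; apply: power_sum_bound; lra.
by eexists; apply: rseries_scal_r Hl.
Qed.

Local Arguments INR : simpl never.

Lemma rseries_ecoef x w : rseries (fun j => ecoef x j * w ^ j) (exp (- w * ln x)).
Proof.
apply: rseries_ext (rseries_exp (- w * ln x)) => j.
rewrite /ecoef (_ : - w * ln x = (- ln x) * w); last ring.
by rewrite Rpow_mult_distr; rewrite /Rdiv; ring.
Qed.

Lemma rseries_dcoef t phi sg w n :
  rseries (fun j => dcoef t phi sg n j * w ^ j) (dterm t phi (sg + w) n).
Proof.
have H0 x : rseries (fun j => hcoef t phi sg x j * w ^ j) (hterm t phi (sg + w) x).
  have -> : hterm t phi (sg + w) x =
    exp ((1 - sg) * ln x) * cos (t * ln x + phi) * exp (- w * ln x).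
    rewrite /hterm (_ : (1 - (sg + w)) * ln x = (1 - sg) * ln x + - w * ln x); last ring.
    by rewrite exp_plus; ring.
  by apply: rseries_ext (rseries_scal _ _ _ (rseries_ecoef x w)) => j; rewrite /hcoef; ring.
have H1 x : rseries (fun j => hcoef' t phi sg x j * w ^ j) (hterm' t phi (sg + w) x).
  set A := (1 - sg) * cos (t * ln x + phi) - t * sin (t * ln x + phi).
  set B := cos (t * ln x + phi).
  have -> : hterm' t phi (sg + w) x =
    exp (- sg * ln x) * (A * exp (- w * ln x) - B * (w * exp (- w * ln x))).
    rewrite /hterm' (_ : - (sg + w) * ln x = - sg * ln x + - w * ln x); last ring.
    by rewrite exp_plus /A /B; ring.
  apply: rseries_ext (rseries_scal _ _ _ (rseries_minus _ _ _ _
    (rseries_scal A _ _ (rseries_ecoef x w))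
    (rseries_scal B _ _ (rseries_shift _ _ _ (rseries_ecoef x w))))) => j.
  by rewrite /hcoef' -/A -/B; ring.
apply: rseries_ext (rseries_minus _ _ _ _ (rseries_minus _ _ _ _ (H0 _) (H0 _)) (H1 _)) => j.
by rewrite /dcoef; ring.
Qed.

Lemma dterm_bound t T phi sg n : 0 < sg -> Rabs t <= T ->
  Rabs (dterm t phi sg n) <= dmajor T sg n.
Proof.
move=> Hsg HT.
have E : dterm t phi sg n = dcoef t phi sg n 0.
  have := rseries_dcoef t phi sg 0 n; rewrite Rplus_0_r => H.
  apply: (rseries_unique _ _ _ H).
  apply/is_lim_seq_incr_1; apply: is_lim_seq_ext (is_lim_seq_const (dcoef t phi sg n 0)) => m.
  by rewrite big_nat_recl // big1 => [|i _]; rewrite /=; ring.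
have := dcoef_sum t T phi sg 0 n 1 Hsg HT ltac:(lra) ltac:(lra) ltac:(lra).
by rewrite big_nat1 pow_O Rmult_1_r E.
Qed.

Definition zsum (t phi sg : R) : R := Series (dterm t phi sg).

Lemma rseries_zsum t phi sg : 0 < sg -> rseries (dterm t phi sg) (zsum t phi sg).
Proof.
move=> Hsg; have [l Hl] := dmajor_series (Rabs t) sg Hsg.
have Hp n : 0 <= dmajor (Rabs t) sg n.
  by apply: Rle_trans (Rabs_pos _) (dterm_bound t _ 0 sg n Hsg (Rle_refl _)).
have [||l' Hl'] := rseries_dominated (dterm t phi sg) (dmajor (Rabs t) sg) l.
- by move=> n; apply: dterm_bound => //; lra.
- by move=> n; apply: rseries_pos_le.
by apply/rseriesP; apply: Series_correct; exists l'; apply/rseriesP.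
Qed.

Lemma zsum_analytic t phi sg : 0 < sg -> real_analytic (zsum t phi) sg.
Proof.
move=> Hsg.
pose rho := Rmin 1 (sg / 2).
have Hr0 : 0 < rho by rewrite /rho; apply Rmin_pos; lra.
have Hr1 : rho <= 1 by apply: Rmin_l.
have Hr2 : rho <= sg / 2 by apply: Rmin_r.
have [l Hl] := dmajor_series (Rabs t) sg Hsg.
have Hp n : 0 <= dmajor (Rabs t) sg n.
  by apply: Rle_trans (Rabs_pos _) (dterm_bound t _ 0 sg n Hsg (Rle_refl _)).
have Hc j : exists a, rseries (fun n => dcoef t phi sg n j) a.
  have Hrj : 0 < rho ^ j by apply: pow_lt.
  apply: (rseries_dominated _ (fun n => dmajor (Rabs t) sg n * / rho ^ j) (l * / rho ^ j)).
    move=> n; apply/Rle_div_r => //.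
    have := dcoef_sum t (Rabs t) phi sg rho n j.+1 Hsg (Rle_refl _) ltac:(lra) Hr1 Hr2.
    rewrite big_nat_recr //= => H.
    have : 0 <= \rsum_(0 <= i < j) (Rabs (dcoef t phi sg n i) * rho ^ i).
      by apply: rsum_ge0 => i _; apply: Rmult_le_pos; [apply: Rabs_pos | apply: pow_le; lra].
    lra.
  move=> n; rewrite -big_distrl /=; apply: Rmult_le_compat_r.
    by apply/Rlt_le/Rinv_0_lt_compat.
  exact: rseries_pos_le.
pose a j := Series (fun n => dcoef t phi sg n j).
have Ha j : rseries (fun n => dcoef t phi sg n j) (a j).
  have [b /rseriesP Hb] := Hc j.
  by apply/rseriesP; apply: Series_correct; exists b.
exists a, rho; split=> // w Hw.
apply: (double_rseries (fun n j => dcoef t phi sg n j * w ^ j) (dmajor (Rabs t) sg)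
   (fun n => dterm t phi (sg + w) n)) Hl _ _ _.
- move=> n J; apply: Rle_trans (dcoef_sum t (Rabs t) phi sg rho n J Hsg (Rle_refl _) ltac:(lra) Hr1 Hr2).
  apply: rsum_le => j _; rewrite Rabs_mult; apply: Rmult_le_compat_l; first exact: Rabs_pos.
  by rewrite -RPow_abs; apply: pow_incr; split; [apply: Rabs_pos | lra].
- by move=> n; apply: rseries_dcoef.
- by apply: rseries_zsum; move: Hw => /Rabs_lt_between; lra.
- by move=> j; apply: rseries_scal_r.
Qed.

Lemma hterm_lim t phi sg : 1 < sg -> is_lim_seq (fun n => hterm t phi sg (INR n.+1)) 0.
Proof.
move=> Hsg.
have H : is_lim_seq (fun n => exp ((1 - sg) * ln (INR n.+1))) 0.
  have L1 : is_lim_seq (fun n => INR n.+1) p_infty.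
    by apply/(is_lim_seq_incr_1 INR); exact: is_lim_seq_INR.
  have L2 : is_lim_seq (fun n => ln (INR n.+1)) p_infty.
    apply: filterlim_comp L1 _; exact: is_lim_ln_p.
  have L3 : is_lim_seq (fun n => (1 - sg) * ln (INR n.+1)) m_infty.
    have := is_lim_seq_scal_l _ (1 - sg) _ L2.
    rewrite /Rbar_mult /=; case: Rle_dec => H //=; first by exfalso; lra.
  apply: filterlim_comp L3 _; exact: is_lim_exp_m.
apply/is_lim_seq_abs_0.
apply: (is_lim_seq_le_le (fun _ => 0)) (is_lim_seq_const 0) H => n.
rewrite /hterm Rabs_mult (Rabs_pos_eq (exp _)); last by apply/Rlt_le/exp_pos.
have := exp_pos ((1 - sg) * ln (INR n.+1)).
have : Rabs (cos (t * ln (INR n.+1) + phi)) <= 1.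
  by apply: Rabs_le; have := COS_bound (t * ln (INR n.+1) + phi); lra.
have := Rabs_pos (cos (t * ln (INR n.+1) + phi)); nra.
Qed.

Lemma dterm_sum t phi sg n : \rsum_(0 <= k < n) dterm t phi sg k =
  hterm t phi sg (INR n.+1) - cos phi - \rsum_(0 <= k < n) hterm' t phi sg (INR k.+1).
Proof.
rewrite /dterm rsum_minus (rsum_telescope (fun k => hterm t phi sg (INR k.+1))) //.
by rewrite /hterm [INR 1]/1 ln_1 !Rmult_0_r exp_0 Rplus_0_l; ring.
Qed.

Lemma cos_plus_PI2 x : cos (x + PI / 2) = - sin x.
Proof. by rewrite cos_plus cos_PI2 sin_PI2; ring. Qed.

Lemma sin_plus_PI2 x : sin (x + PI / 2) = cos x.
Proof. by rewrite sin_plus cos_PI2 sin_PI2; ring. Qed.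

Lemma hterm'_0 t sg x : hterm' t 0 sg x =
  exp (- sg * ln x) * ((1 - sg) * cos (t * ln x) - t * sin (t * ln x)).
Proof. by rewrite /hterm' Rplus_0_r. Qed.

Lemma hterm'_PI2 t sg x : hterm' t (PI / 2) sg x =
  exp (- sg * ln x) * (- (1 - sg) * sin (t * ln x) - t * cos (t * ln x)).
Proof. by rewrite /hterm' cos_plus_PI2 sin_plus_PI2; ring. Qed.

Lemma dirichlet_series (zeta : C -> C) (sg t : R) : is_riemann_zeta zeta -> 1 < sg ->
  rseries (fun n => exp (- sg * ln (INR n.+1)) * cos (t * ln (INR n.+1))) (fst (zeta (sg, t))) /\
  rseries (fun n => - (exp (- sg * ln (INR n.+1)) * sin (t * ln (INR n.+1)))) (snd (zeta (sg, t))).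
Proof.
move=> [_ Hz] Hsg.
have [H1 H2] := is_series_C _ _ (Hz (sg, t) Hsg).
have E n : Cmult (Copp (sg, t)) (RtoC (ln (INR n.+1))) =
  (- sg * ln (INR n.+1), - (t * ln (INR n.+1))).
  by rewrite /Cmult /Copp /RtoC /=; congr pair; ring.
split; [apply: rseries_ext H1 | apply: rseries_ext H2] => n;
  rewrite /dirichlet_term E /Cexp /= ?cos_neg // sin_neg; ring.
Qed.

Lemma zeta_real_identity (zeta : C -> C) (t : R) : is_riemann_zeta zeta -> 0 < t ->
  forall sg, 0 < sg ->
  (sg - 1) * fst (zeta (sg, t)) - t * snd (zeta (sg, t)) = 1 + zsum t 0 sg /\
  (sg - 1) * snd (zeta (sg, t)) + t * fst (zeta (sg, t)) = zsum t (PI / 2) sg.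
Proof.
move=> Hz Ht.
have An sg : real_analytic (fun x => fst (zeta (x, t))) sg /\
             real_analytic (fun x => snd (zeta (x, t))) sg.
  apply: analytic_at_real; apply: (proj1 Hz) => -[_ H]; lra.
pose f x := x * fst (zeta (x, t)) + (-1 * fst (zeta (x, t)) +
  (- t * snd (zeta (x, t)) + (-1 + -1 * zsum t 0 x))).
pose g x := x * snd (zeta (x, t)) + (-1 * snd (zeta (x, t)) +
  (t * fst (zeta (x, t)) + (-1 * zsum t (PI / 2) x))).
have Hf : forall x, 0 < x -> f x = 0.
  apply: real_analytic_identity => x Hx.
    have [A1 A2] := An x.
    do 2?[apply: real_analytic_plus]; first exact: real_analytic_mulx.
      exact: real_analytic_scal.
    apply: real_analytic_plus; first exact: real_analytic_scal.
    apply: real_analytic_plus; first exact: real_analytic_const.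
    by apply: real_analytic_scal; apply: zsum_analytic.
  have [D1 D2] := dirichlet_series zeta x t Hz Hx.
  suff : zsum t 0 x = - 1 - ((1 - x) * fst (zeta (x, t)) + t * snd (zeta (x, t))).
    by rewrite /f => ->; ring.
  apply: (rseries_unique (dterm t 0 x)); first by apply: rseries_zsum; lra.
  have S := rseries_plus _ _ _ _ (rseries_scal (1 - x) _ _ D1) (rseries_scal t _ _ D2).
  have := is_lim_seq_minus' _ _ _ _ (is_lim_seq_minus' _ _ _ _ (hterm_lim t 0 x Hx)
    (is_lim_seq_const 1)) S.
  rewrite (_ : 0 - 1 = -1); last ring.
  apply: is_lim_seq_ext => n; rewrite dterm_sum cos_0; congr (_ - _).
  by apply: eq_bigr => k _; rewrite hterm'_0; ring.
have Hg : forall x, 0 < x -> g x = 0.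
  apply: real_analytic_identity => x Hx.
    have [A1 A2] := An x.
    do 2?[apply: real_analytic_plus]; first exact: real_analytic_mulx.
      exact: real_analytic_scal.
    apply: real_analytic_plus; first exact: real_analytic_scal.
    by apply: real_analytic_scal; apply: zsum_analytic.
  have [D1 D2] := dirichlet_series zeta x t Hz Hx.
  suff : zsum t (PI / 2) x = - ((1 - x) * snd (zeta (x, t)) - t * fst (zeta (x, t))).
    by rewrite /g => ->; ring.
  apply: (rseries_unique (dterm t (PI / 2) x)); first by apply: rseries_zsum; lra.
  have S := rseries_minus _ _ _ _ (rseries_scal (1 - x) _ _ D2) (rseries_scal t _ _ D1).
  have := is_lim_seq_minus' _ _ _ _ (hterm_lim t (PI / 2) x Hx) S.
  rewrite Rminus_0_l; apply: is_lim_seq_ext => n; rewrite dterm_sum cos_PI2 Rminus_0_r; congr (_ - _).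
  by apply: eq_bigr => k _; rewrite hterm'_PI2; ring.
move=> sg Hsg; have := Hf sg Hsg; have := Hg sg Hsg; rewrite /f /g; split; lra.
Qed.

(* [Re (x^(1-s) e^(itu) / (1-s))] for [s = 1/2 + it]. *)
Definition pole_term (u t x : R) :=
  sqrt x * (cos (t * (ln x - u)) / 2 + t * sin (t * (ln x - u))) / (1 / 4 + t ^ 2).

(* [Re (e^(itu) (sum_(k <= n) k^(-s) - (n+1)^(1-s) / (1-s)))] for [s = 1/2 + it]. *)
Definition zeta_partial (u : R) (n : nat) (t : R) :=
  \rsum_(1 <= k < n.+1) (/ sqrt (INR k) * cos (t * (ln (INR k) - u)))
  - pole_term u t (INR n.+1).

Lemma sqrt_exp_ln x : 0 < x -> exp (1 / 2 * ln x) = sqrt x.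
Proof.
move=> Hx; rewrite -Rpower_sqrt // /Rpower; congr exp; lra.
Qed.

Lemma zeta_partial_eq t n : zeta_partial 0 n t =
  (- (1 + \rsum_(0 <= k < n) dterm t 0 (1 / 2) k) / 2
    + t * \rsum_(0 <= k < n) dterm t (PI / 2) (1 / 2) k) / (1 / 4 + t ^ 2).
Proof.
have Hp : 0 < 1 / 4 + t ^ 2 by nra.
rewrite !dterm_sum cos_0 cos_PI2 /hterm cos_plus_PI2 Rplus_0_r.
rewrite (_ : 1 - 1 / 2 = 1 / 2); last lra.
rewrite sqrt_exp_ln; last exact: INRS_gt0.
apply: (Rmult_eq_reg_r (1 / 4 + t ^ 2)); last lra.
rewrite /zeta_partial /pole_term Rminus_0_r Rmult_minus_distr_r.
rewrite big_add1 /= big_distrl /=.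
have -> : \rsum_(0 <= i < n) (/ sqrt (INR i.+1) * cos (t * (ln (INR i.+1) - 0)) * (1 / 4 + t ^ 2)) =
  (\rsum_(0 <= k < n) hterm' t 0 (1 / 2) (INR k.+1)) / 2
    - t * \rsum_(0 <= k < n) hterm' t (PI / 2) (1 / 2) (INR k.+1).
  rewrite /Rdiv big_distrl big_distrr -rsum_minus /=; apply: eq_bigr => k _.
  rewrite hterm'_0 hterm'_PI2 Rminus_0_r.
  rewrite (_ : - (1 * / 2) * ln (INR k.+1) = - (1 / 2 * ln (INR k.+1))); last lra.
  rewrite exp_Ropp sqrt_exp_ln; last exact: INRS_gt0.
  move: (t * ln _) => th; field.
  by apply/Rgt_not_eq/sqrt_lt_R0/INRS_gt0.
by rewrite Rminus_0_r; field; nra.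
Qed.

Lemma zeta_approx (zeta : C -> C) (T eps : R) : is_riemann_zeta zeta -> 0 < eps ->
  exists n0, forall n, (n0 <= n)%N -> forall t, 0 < t <= T ->
  Rabs (fst (zeta (1 / 2, t)) - zeta_partial 0 n t) <= eps.
Proof.
move=> Hz Heps.
have [l Hl] := dmajor_series T (1 / 2) ltac:(lra).
have Heps3 : 0 < eps / 3 by lra.
have [n0 Hn0] := proj2 (is_lim_seq_spec _ _) Hl (mkposreal _ Heps3).
exists n0 => n /leP /Hn0 /= /Rabs_lt_between Hn t [Ht HtT].
have Hb phi k : Rabs (dterm t phi (1 / 2) k) <= dmajor T (1 / 2) k.
  by apply: dterm_bound; rewrite ?Rabs_pos_eq; lra.
have H0 := rseries_tail _ _ _ _ n (Hb 0) (rseries_zsum t 0 (1 / 2) ltac:(lra)) Hl.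
have H1 := rseries_tail _ _ _ _ n (Hb (PI / 2)) (rseries_zsum t (PI / 2) (1 / 2) ltac:(lra)) Hl.
have [E0 E1] := zeta_real_identity zeta t Hz Ht (1 / 2) ltac:(lra).
rewrite zeta_partial_eq; move: H0 H1 E0 E1 Hn {Hb}.
move: (zsum _ 0 _) (zsum _ (PI / 2) _) => P Q.
move: (\rsum_(0 <= k < n) _) (\rsum_(0 <= k < n) dterm t (PI / 2) (1 / 2) k) (\rsum_(0 <=
  k < n) dmajor T (1 / 2) k).
move=> Pn Qn Sn /Rabs_le_between H0 /Rabs_le_between H1 E0 E1 Hn.
have Hp : 0 < 1 / 4 + t ^ 2 by nra.
have -> : fst (zeta (1 / 2, t)) = (- (1 + P) / 2 + t * Q) / (1 / 4 + t ^ 2).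
  apply: (Rmult_eq_reg_r (1 / 4 + t ^ 2)); last lra.
  by rewrite -E0 -E1; field; nra.
have -> : (- (1 + P) / 2 + t * Q) / (1 / 4 + t ^ 2) - (- (1 + Pn) / 2 + t * Qn) / (1 / 4 + t ^ 2)
  = (- (P - Pn) / 2 + t * (Q - Qn)) / (1 / 4 + t ^ 2) by field; nra.
rewrite Rabs_div; last lra.
rewrite (Rabs_pos_eq (1 / 4 + t ^ 2)); last lra.
apply/Rle_div_l => //; apply: Rabs_le; move: H0 H1; set p := P - Pn; set q := Q - Qn => H0 H1.
have Hq1 : t * q <= t * (eps / 3) by apply: Rmult_le_compat_l; lra.
have Hq2 : t * - q <= t * (eps / 3) by apply: Rmult_le_compat_l; lra.
have : 0 <= eps * (t ^ 2 - t / 3 + 1 / 12).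
  apply: Rmult_le_pos; first lra.
  by have := pow2_ge_0 (t - 1 / 6); nra.
lra.
Qed.

(** * Integrals of zeta against a tent *)

Definition main_term (A u x : R) := / sqrt x * (A * fejer (A * (ln x - u))).
Definition pole_integral (A u x : R) := RInt (fun t => pole_term u t x * (1 - t / A)) 0 A.

Lemma quarter_sqr_gt0 t : 0 < 1 / 4 + t ^ 2.
Proof. by have := pow2_ge_0 t; lra. Qed.

Lemma pole_term_derive u t x : 0 < x ->
  is_derive (pole_term u t) x (/ sqrt x * cos (t * (ln x - u))).
Proof.
move=> Hx; have Hp := quarter_sqr_gt0 t; have Hs := sqrt_lt_R0 x Hx.
rewrite /pole_term; auto_derive; first by repeat split; lra.
have E : x = sqrt x * sqrt x by rewrite sqrt_sqrt; lra.
move: (t * (ln x + - u)) => th.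
have -> : / x = / (sqrt x * sqrt x) by rewrite -E.
by field; split; lra.
Qed.

Lemma pole_weight_continuous A u x t : 0 < x -> 0 < A ->
  continuous (fun t => pole_term u t x * (1 - t / A)) t.
Proof.
move=> Hx HA; apply: ex_derive_continuous; rewrite /pole_term; auto_derive.
by have := quarter_sqr_gt0 t; repeat split; lra.
Qed.

Lemma pole_weight_is_RInt A u x : 0 < x -> 0 < A ->
  is_RInt (fun t => pole_term u t x * (1 - t / A)) 0 A (pole_integral A u x).
Proof.
move=> Hx HA; apply: (RInt_correct (V := R_CompleteNormedModule)).
by apply: ex_RInt_continuous => t _; apply: pole_weight_continuous.
Qed.

Lemma pole_integral_derive A u x : 0 < A -> 0 < x ->
  is_derive (pole_integral A u) x (main_term A u x).
Proof.
move=> HA Hx.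
have D y t : 0 < y -> is_derive (fun y => pole_term u t y * (1 - t / A)) y
    (/ sqrt y * cos (t * (ln y - u)) * (1 - t / A)).
  move=> Hy; have H := pole_term_derive u t y Hy.
  apply: (is_derive_ext (fun y => (1 - t / A) * pole_term u t y)) => [z|]; first by rewrite Rmult_comm.
  by rewrite Rmult_comm; apply: is_derive_scal.
have Loc : locally x (fun y => 0 < y).
  by apply: (open_gt 0); exact: Hx.
have E : main_term A u x = RInt (fun t => Derive (fun y => pole_term u t y * (1 - t / A)) x) 0 A.
  symmetry; apply: is_RInt_unique.
  apply: (is_RInt_ext (fun t => scal (/ sqrt x) (cos (t * (ln x - u)) * (1 - t / A)))).
    move=> t _; rewrite (is_derive_unique _ _ _ (D x t Hx)) /scal /= /mult /=; ring.
  by apply: is_RInt_scal; apply: fejer_cos_integral.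
rewrite E.
apply: (is_derive_RInt_param (fun y t => pole_term u t y * (1 - t / A)) 0 A x).
- apply: filter_imp Loc => y Hy t _; eexists; exact: D.
- move=> t _.
  apply: (continuity_2d_pt_ext_loc (fun y t => / sqrt y * cos (t * (ln y - u)) * (1 - t / A))).
    have [d Hd] := Loc; exists d => y s Hy _.
    by rewrite (is_derive_unique _ _ _ (D y s (Hd y Hy))).
  have C1 : continuity_2d_pt (fun y _ => / sqrt y) x t.
    apply: (continuity_1d_2d_pt_comp (fun y => / sqrt y) (fun y _ => y));
      last exact: continuity_2d_pt_id1.
    apply/continuity_pt_filterlim; apply: ex_derive_continuous; auto_derive.
    by have := sqrt_lt_R0 x Hx; repeat split; lra.
  have C2 : continuity_2d_pt (fun y _ => ln y - u) x t.
    apply: (continuity_1d_2d_pt_comp (fun y => ln y - u) (fun y _ => y));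
      last exact: continuity_2d_pt_id1.
    by apply: (ex_derive_continuity _ _ (/ x)); auto_derive => //; field; lra.
  have C3 : continuity_2d_pt (fun _ t => 1 - t / A) x t.
    apply: (continuity_1d_2d_pt_comp (fun t => 1 - t / A) (fun _ t => t));
      last exact: continuity_2d_pt_id2.
    by apply: (ex_derive_continuity _ _ (- / A)); auto_derive => //; field; lra.
  apply: continuity_2d_pt_mult => //; apply: continuity_2d_pt_mult => //.
  apply: (continuity_1d_2d_pt_comp cos (fun y t => t * (ln y - u))).
    exact: continuity_cos.
  by apply: continuity_2d_pt_mult => //; apply: continuity_2d_pt_id2.
- apply: filter_imp Loc => y Hy.
  by apply: ex_RInt_continuous => t _; apply: pole_weight_continuous.
Qed.

Lemma pole_term_bound u t x : 0 <= t -> 0 < x -> Rabs (pole_term u t x) <= sqrt x * (4 / (1 + t)).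
Proof.
move=> Ht Hx; rewrite /pole_term.
have Hp := quarter_sqr_gt0 t; have Hs := sqrt_lt_R0 x Hx.
move: (t * (ln x - u)) => th.
rewrite Rabs_div; last lra.
rewrite Rabs_mult (Rabs_pos_eq (sqrt x)); last lra.
rewrite (Rabs_pos_eq (1 / 4 + t ^ 2)); last lra.
rewrite /Rdiv Rmult_assoc; apply: Rmult_le_compat_l; first lra.
apply/Rle_div_l => //.
have -> : 4 * / (1 + t) * (1 / 4 + t ^ 2) = (1 + 4 * t ^ 2) / (1 + t) by field; lra.
apply/Rle_div_r; first lra.
have : Rabs (cos th * / 2 + t * sin th) <= 1 / 2 + t.
  have := COS_bound th; have := SIN_bound th => *; apply: Rabs_le; split; nra.
have := pow2_ge_0 (2 * t - 1 / 2); nra.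
Qed.

Lemma pole_integral_bound A u x : 0 < A -> 0 < x ->
  Rabs (pole_integral A u x) <= 4 * sqrt x * ln (1 + A).
Proof.
move=> HA Hx.
have HI : is_RInt (fun t => sqrt x * (4 / (1 + t))) 0 A (4 * sqrt x * ln (1 + A)).
  have -> : 4 * sqrt x * ln (1 + A) = minus (4 * sqrt x * ln (1 + A)) (4 * sqrt x * ln (1 + 0)).
    by rewrite /minus /plus /opp /= Rplus_0_r ln_1; ring.
  apply: (is_RInt_derive (fun t => 4 * sqrt x * ln (1 + t))).
    rewrite Rmin_left ?Rmax_right; try lra.
    by move=> t Ht; auto_derive; [lra | field; lra].
  rewrite Rmin_left ?Rmax_right; try lra.
  by move=> t Ht; apply: ex_derive_continuous; auto_derive; lra.
apply: (norm_RInt_le _ _ 0 A _ _ _ _ (pole_weight_is_RInt A u x Hx HA) HI); first lra.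
move=> t Ht; rewrite /norm /= /abs /= Rabs_mult.
have H1 := pole_term_bound u t x ltac:(lra) Hx.
have H2 : 0 <= 1 - t / A <= 1.
  have : 0 <= t / A by apply: Rmult_le_pos; [lra | apply/Rlt_le/Rinv_0_lt_compat].
  have : t / A <= 1 by apply/Rle_div_l; lra.
  lra.
rewrite (Rabs_pos_eq (1 - t / A)); last lra.
have := Rabs_pos (pole_term u t x); nra.
Qed.

Lemma zeta_partial_split u N n t : (N <= n)%N ->
  zeta_partial u n t =
    \rsum_(1 <= k < N.+1) (/ sqrt (INR k) * cos (t * (ln (INR k) - u)))
    - pole_term u t (INR N.+1)
    + \rsum_(N.+1 <= k < n.+1) (/ sqrt (INR k) * cos (t * (ln (INR k) - u))
       - (pole_term u t (INR k.+1) - pole_term u t (INR k))).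
Proof.
move=> H; rewrite /zeta_partial rsum_minus (rsum_telescope (fun k => pole_term u t (INR k))) //.
rewrite (big_cat_nat (n := N.+1)) //=; ring.
Qed.

Lemma rsum_is_RInt (I : eqType) (r : seq I) (f : I -> R -> R) (v : I -> R) (a b : R) :
  (forall i, i \in r -> is_RInt (f i) a b (v i)) ->
  is_RInt (fun t => \rsum_(i <- r) f i t) a b (\rsum_(i <- r) v i).
Proof.
elim: r => [|i r IH] H.
  rewrite big_nil; apply: (is_RInt_ext (fun _ => 0)) => [t _|]; first by rewrite big_nil.
  by have := is_RInt_const (V := R_NormedModule) a b 0; rewrite /scal /= /mult /= Rmult_0_r.
rewrite big_cons; apply: (is_RInt_ext (fun t => plus (f i t) (\rsum_(i <- r) f i t))) => [t _|].
  by rewrite big_cons.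
apply: is_RInt_plus; first by apply: H; rewrite mem_head.
by apply: IH => j Hj; apply: H; rewrite in_cons Hj orbT.
Qed.

Lemma main_term_is_RInt A u x : 0 < A ->
  is_RInt (fun t => / sqrt x * cos (t * (ln x - u)) * (1 - t / A)) 0 A (main_term A u x).
Proof.
move=> HA.
apply: (is_RInt_ext (fun t => scal (/ sqrt x) (cos (t * (ln x - u)) * (1 - t / A)))).
  by move=> t _; rewrite /scal /= /mult /=; ring.
by apply: is_RInt_scal; apply: fejer_cos_integral.
Qed.

Definition zeta_integral (A u : R) (n : nat) :=
  RInt (fun t => zeta_partial u n t * (1 - t / A)) 0 A.

Lemma zeta_integral_is_RInt A u N n : 0 < A -> (N <= n)%N ->
  is_RInt (fun t => zeta_partial u n t * (1 - t / A)) 0 A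
   (\rsum_(1 <= k < N.+1) main_term A u (INR k) - pole_integral A u (INR N.+1)
    + \rsum_(N.+1 <= k < n.+1) (main_term A u (INR k)
       - (pole_integral A u (INR k.+1) - pole_integral A u (INR k)))).
Proof.
move=> HA Hn.
apply: (is_RInt_ext (fun t => plus (minus
   (\rsum_(1 <= k < N.+1) (/ sqrt (INR k) * cos (t * (ln (INR k) - u)) * (1 - t / A)))
   (pole_term u t (INR N.+1) * (1 - t / A)))
   (\rsum_(N.+1 <= k < n.+1) (/ sqrt (INR k) * cos (t * (ln (INR k) - u)) * (1 - t / A)
     - (pole_term u t (INR k.+1) * (1 - t / A) - pole_term u t (INR k) * (1 - t / A)))))).
  move=> t _; rewrite (zeta_partial_split u N n t Hn) /minus /plus /opp /=.
  rewrite Rmult_plus_distr_r Rmult_minus_distr_r !big_distrl /=; congr (_ + _).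
  by apply: eq_bigr => k _; ring.
apply: is_RInt_plus; first apply: is_RInt_minus.
- by apply: rsum_is_RInt => k _; apply: main_term_is_RInt.
- by apply: pole_weight_is_RInt => //; apply: INRS_gt0.
- apply: rsum_is_RInt => k; rewrite mem_index_iota => /andP [Hk _].
  apply: (is_RInt_minus (V := R_NormedModule)); first exact: main_term_is_RInt.
  apply: (is_RInt_minus (V := R_NormedModule)); apply: pole_weight_is_RInt => //; first exact: INRS_gt0.
  by case: k Hk => // k _; apply: INRS_gt0.
Qed.

Lemma main_term_ge0 A u x : 0 < A -> 0 < x -> 0 <= main_term A u x.
Proof.
move=> HA Hx; apply: Rmult_le_pos; first by apply/Rlt_le/Rinv_0_lt_compat/sqrt_lt_R0.
by apply: Rmult_le_pos; [lra | apply: fejer_ge0].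
Qed.

Lemma inv_sqrt_le x y : 0 < x -> x <= y -> / sqrt y <= / sqrt x.
Proof.
move=> Hx Hxy; apply: Rinv_le_contravar; first exact: sqrt_lt_R0.
by apply: sqrt_le_1; lra.
Qed.

Lemma main_term_variation A u a x b : 0 < A -> 0 < a -> a <= x <= b ->
  Rabs (main_term A u a - main_term A u x) <=
   / sqrt a * (10 * A * (atan (A * (ln b - u)) - atan (A * (ln a - u)))) + A / 2 * (/ sqrt a - / sqrt b).
Proof.
move=> HA Ha [Hax Hxb]; rewrite /main_term.
have L1 := ln_le_compat a x Ha Hax; have L2 := ln_le_compat x b ltac:(lra) Hxb.
have V1 : A * (ln a - u) <= A * (ln x - u) by apply: Rmult_le_compat_l; lra.
have V2 : A * (ln x - u) <= A * (ln b - u) by apply: Rmult_le_compat_l; lra.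
have S1 := inv_sqrt_le a x Ha Hax; have S2 := inv_sqrt_le x b ltac:(lra) Hxb.
have F := fejer_atan _ _ V1; have M := atan_mono _ _ V2.
have B1 := fejer_le_half (A * (ln x - u)); have B0 := fejer_ge0 (A * (ln x - u)).
have P : 0 < / sqrt a by apply/Rinv_0_lt_compat/sqrt_lt_R0.
move: F M B1 B0 S1 S2 P.
move: (A * (ln a - u)) (A * (ln x - u)) (A * (ln b - u)) (/ sqrt a) (/ sqrt x) (/ sqrt b) =>
  va vx vb sa sx sb.
move=> F M B1 B0 S1 S2 P.
have -> : sa * (A * fejer va) - sx * (A * fejer vx) =
  sa * (A * (fejer va - fejer vx)) + (sa - sx) * (A * fejer vx) by ring.
apply: Rle_trans (Rabs_triang _ _) _; apply: Rplus_le_compat.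
  rewrite !Rabs_mult (Rabs_pos_eq sa) ?(Rabs_pos_eq A); try lra.
  apply: Rmult_le_compat_l; first lra.
  by rewrite Rabs_minus_sym [10 * A]Rmult_comm Rmult_assoc; apply: Rmult_le_compat_l; lra.
rewrite Rabs_pos_eq; last by apply: Rmult_le_pos; [lra | nra].
have : A * fejer vx <= A / 2 by nra.
have : 0 <= A * fejer vx by nra.
nra.
Qed.

Lemma zeta_integral_bound A u N n : 1 <= A -> INR N <= A < INR N.+1 -> (N <= n)%N ->
  Rabs (zeta_integral A u n - \rsum_(1 <= k < N.+1) main_term A u (INR k))
    <= 8 * sqrt A * ln (1 + A) + 41 * sqrt A.
Proof.
move=> HA [HN1 HN2] Hn; have HA0 : 0 < A by lra.
rewrite /zeta_integral (is_RInt_unique _ _ _ _ (zeta_integral_is_RInt A u N n HA0 Hn)).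
set S := \rsum_(_ <= k < _) main_term _ _ _; set T := \rsum_(_ <= k < _) (_ - _).
have HsA : 0 < sqrt A by apply: sqrt_lt_R0.
have HS : 0 < INR N.+1 by apply: INRS_gt0.
have HG := pole_integral_bound A u (INR N.+1) HA0 HS.
have Hsq : sqrt (INR N.+1) <= 2 * sqrt A.
  have -> : 2 * sqrt A = sqrt (4 * A).
    by rewrite sqrt_mult; try lra; rewrite (_ : 4 = 2 * 2) ?sqrt_square; lra.
  by have := S_INR N; move=> ?; apply: sqrt_le_1; lra.
have HT : Rabs T <= 41 * sqrt A.
  apply: Rle_trans (rsum_abs _ _ _ _) _.
  pose g k := / sqrt (INR N.+1) * (10 * A * atan (A * (ln (INR k) - u))) - A / 2 * / sqrt (INR k).
  apply: (@Rle_trans _ (\rsum_(N.+1 <= k < n.+1) (g k.+1 - g k))).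
    apply: rsum_nat_le => k Hk _.
    have Hk0 : INR N.+1 <= INR k by apply: le_INR; apply/leP.
    have Hk1 : INR k.+1 = INR k + 1 by rewrite S_INR.
    have [||x [Hx ->]] := MVT_gen (pole_integral A u) (INR k) (INR k.+1) (main_term A u).
    - rewrite Rmin_left ?Rmax_right; try lra.
      by move=> x Hx; apply: pole_integral_derive; lra.
    - rewrite Rmin_left ?Rmax_right; try lra.
      move=> x Hx; apply: ex_derive_continuity; apply: pole_integral_derive; lra.
    rewrite Rmin_left ?Rmax_right in Hx; try lra.
    rewrite (_ : INR k.+1 - INR k = 1) ?Rmult_1_r; last lra.
    apply: Rle_trans (main_term_variation A u (INR k) x (INR k.+1) HA0 _ Hx) _; first lra.
    have S1 := inv_sqrt_le _ _ HS Hk0.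
    have M : A * (ln (INR k) - u) <= A * (ln (INR k.+1) - u).
      by apply: Rmult_le_compat_l; first lra; have :=
        ln_le_compat (INR k) (INR k.+1) ltac:(lra) ltac:(lra); lra.
    have {}M := atan_mono _ _ M.
    rewrite /g; move: M S1.
    move: (atan _) (atan _) (/ sqrt (INR N.+1)) (/ sqrt (INR k)) (/ sqrt (INR k.+1)) =>
      p q s0 s1 s2 M S1.
    have : 0 <= (s0 - s1) * (10 * A * (p - q)).
      by apply: Rmult_le_pos; [lra | apply: Rmult_le_pos; lra].
    lra.
  rewrite rsum_telescope; last by rewrite ltnS.
  rewrite /g.
  have H1 := atan_range (A * (ln (INR n.+1) - u)) (A * (ln (INR N.+1) - u)).
  have P1 : 0 < / sqrt (INR n.+1) by apply/Rinv_0_lt_compat/sqrt_lt_R0/INRS_gt0.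
  have P2 : 0 < / sqrt (INR N.+1) by apply/Rinv_0_lt_compat/sqrt_lt_R0.
  have P3 : / sqrt (INR N.+1) * A <= sqrt A.
    have E : / sqrt A * A = sqrt A by rewrite -{2}(sqrt_sqrt A); [field|]; lra.
    rewrite -[X in _ <= X]E; apply: Rmult_le_compat_r; first lra.
    by apply: inv_sqrt_le; lra.
  move: H1 P1 P2 P3.
  move: (atan _) (atan _) (/ sqrt (INR N.+1)) (/ sqrt (INR n.+1)) => q p s0 s1 H1 P1 P2 P3.
  have : s0 * A * (p - q) <= s0 * A * 4.
    by apply: Rmult_le_compat_l; [apply: Rmult_le_pos; lra | lra].
  have : 0 < A * s1 by apply: Rmult_lt_0_compat; lra.
  lra.
have Hln : 0 <= ln (1 + A) by apply: ln_ge0; lra.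
have -> : S - pole_integral A u (INR N.+1) + T - S = T - pole_integral A u (INR N.+1) by ring.
apply: Rle_trans (Rabs_triang _ _) _; rewrite Rabs_Ropp.
have : 4 * sqrt (INR N.+1) * ln (1 + A) <= 8 * sqrt A * ln (1 + A).
  by apply: Rmult_le_compat_r; lra.
lra.
Qed.

Lemma main_term_sum_bound A u N : 1 <= A -> INR N <= A ->
  0 <= \rsum_(1 <= k < N.+1) main_term A u (INR k) <= 48 * A.
Proof.
move=> HA HN; split.
  rewrite big_nat_cond; apply: rsum_ge0 => k; rewrite andbT => /andP [Hk _].
  by apply: main_term_ge0; [lra | case: k Hk => // k _; apply: INRS_gt0].
apply: (@Rle_trans _ (A * \rsum_(1 <= k < N.+1) fejer (A * (ln (INR k) - u)))).
  rewrite big_distrr /=; apply: rsum_nat_le => -[//|k] _ _; rewrite /main_term.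
  have : / sqrt (INR k.+1) <= 1.
    by rewrite -Rinv_1 -{1}sqrt_1; apply: inv_sqrt_le; [lra | apply: INRS_ge1].
  have : 0 <= A * fejer (A * (ln (INR k.+1) - u)).
    by apply: Rmult_le_pos; [lra | apply: fejer_ge0].
  nra.
rewrite Rmult_comm; apply: Rmult_le_compat_r; first lra.
apply: fejer_separated_sum => -[//|k] _; rewrite ltnS => Hk.
have Hk2 : INR k.+2 <= A by apply: Rle_trans HN; apply: le_INR; apply/leP.
have Hgap : / INR k.+2 <= ln (INR k.+2) - ln (INR k.+1).
  have P1 := INRS_ge1 k.
  have E : INR k.+2 = INR k.+1 + 1 by rewrite S_INR.
  have -> : ln (INR k.+2) - ln (INR k.+1) = - ln (INR k.+1 / INR k.+2).
    by rewrite ln_div; lra.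
  have H : ln (INR k.+1 / INR k.+2) <= INR k.+1 / INR k.+2 - 1.
    have := exp_ineq1_le (ln (INR k.+1 / INR k.+2)).
    by rewrite exp_ln; [lra | apply: Rdiv_lt_0_compat; lra].
  have : INR k.+1 / INR k.+2 - 1 = - / INR k.+2 by rewrite E; field; lra.
  lra.
have : A * / INR k.+2 <= A * (ln (INR k.+2) - ln (INR k.+1)) by apply: Rmult_le_compat_l; lra.
have : 1 <= A * / INR k.+2.
  by apply/Rle_div_r; [apply: INRS_gt0 | lra].
lra.
Qed.

Lemma ln_le_sqrt A : 0 <= A -> ln (1 + A) <= 2 * sqrt A.
Proof.
move=> HA.
have Hs := sqrt_pos A.
have H : ln (1 + sqrt A) <= sqrt A.
  by have := exp_ineq1_le (ln (1 + sqrt A)); rewrite exp_ln; lra.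
apply: Rle_trans (_ : ln ((1 + sqrt A) * (1 + sqrt A)) <= _).
  apply: ln_le_compat; first lra.
  have := sqrt_sqrt A HA; nra.
rewrite ln_mult; lra.
Qed.

Lemma zeta_integral_abs A u N n : 1 <= A -> INR N <= A < INR N.+1 -> (N <= n)%N ->
  Rabs (zeta_integral A u n) <= 105 * A.
Proof.
move=> HA HN Hn.
have /Rabs_le_between H1 := zeta_integral_bound A u N n HA HN Hn.
have [H2 H3] := main_term_sum_bound A u N HA (proj1 HN).
have H4 := ln_le_sqrt A ltac:(lra).
have H5 := sqrt_sqrt A ltac:(lra).
have H6 : 1 <= sqrt A by rewrite -sqrt_1; apply: sqrt_le_1; lra.
have H7 : sqrt A * ln (1 + A) <= sqrt A * (2 * sqrt A) by apply: Rmult_le_compat_l; lra.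
apply: Rabs_le; nra.
Qed.

(** * Resonance *)

Definition triangle (A t : R) := Rmax 0 (1 - t / A).

Lemma triangle_in A t : 0 < A -> t <= A -> triangle A t = 1 - t / A.
Proof.
move=> HA Ht; rewrite /triangle Rmax_right //.
have : t / A <= 1 by apply/Rle_div_l; lra.
lra.
Qed.

Lemma triangle_out A t : 0 < A -> A <= t -> triangle A t = 0.
Proof.
move=> HA Ht; rewrite /triangle Rmax_left //.
have : 1 <= t / A by apply/Rle_div_r; lra.
lra.
Qed.

Lemma triangle_ge0 A t : 0 <= triangle A t.
Proof. exact: Rmax_l. Qed.

Lemma is_RInt_triangle (f : R -> R) A T l : 0 < A <= T ->
  is_RInt (fun t => f t * (1 - t / A)) 0 A l ->
  is_RInt (fun t => f t * triangle A t) 0 T l.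
Proof.
move=> [HA HT] H; rewrite -(Rplus_0_r l).
apply: (is_RInt_Chasles (V := R_NormedModule) _ 0 A T).
  apply: is_RInt_ext H => t; rewrite Rmin_left ?Rmax_right; try lra.
  by move=> Ht; rewrite triangle_in; lra.
apply: (is_RInt_ext (fun _ => 0)).
  rewrite Rmin_left ?Rmax_right; try lra.
  by move=> t Ht; rewrite triangle_out; lra.
by have := is_RInt_const (V := R_NormedModule) A T 0; rewrite /scal /= /mult /= Rmult_0_r.
Qed.

(* A nonnegative combination of three tents supported on [[Y,T]]: it
   vanishes identically near [0] because the three tents are affine there. *)
Definition kernel (Y T t : R) :=
  triangle T t - (2 - 2 * Y / T) * triangle (2 * Y) t + (1 - 2 * Y / T) * triangle Y t.

Lemma kernel_bounds Y T t : 0 < Y -> 2 * Y <= T -> 0 <= t <= T ->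
  0 <= kernel Y T t <= triangle T t.
Proof.
move=> HY HT Ht.
have Hq : 0 <= 2 * Y / T <= 1.
  split; last by apply/Rle_div_l; lra.
  by apply: Rmult_le_pos; [lra | apply/Rlt_le/Rinv_0_lt_compat; lra].
have E2 : 2 * Y / T = 2 * (Y / T) by rewrite /Rdiv; ring.
have Et : t / T = t / Y * (Y / T) by field; lra.
have E3 : t / (2 * Y) = t / Y / 2 by field; lra.
have T0 := triangle_ge0 T t.
rewrite /kernel; case: (Rle_dec t Y) => H1.
  have -> : triangle T t - (2 - 2 * Y / T) * triangle (2 * Y) t + (1 - 2 * Y / T) * triangle Y t = 0.
    by rewrite !triangle_in; try lra; rewrite Et E2 E3; field; lra.
  lra.
rewrite (triangle_out Y); try lra.
case: (Rle_dec t (2 * Y)) => H2; last by rewrite (triangle_out (2 * Y)); lra.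
have T2 := triangle_ge0 (2 * Y) t.
split; last nra.
rewrite !triangle_in; try lra.
rewrite Et E2 E3.
have H3 : 1 <= t / Y by apply/Rle_div_r; lra.
have H4 : t / Y <= 2 by apply/Rle_div_l; lra.
move: (t / Y) (Y / T) Hq H3 H4 E2 => p q Hq H3 H4 E2.
have : 1 - p * q - (2 - 2 * q) * (1 - p / 2) + (1 - 2 * q) * 0 = (p - 1) * (1 - 2 * q) by field.
have : 0 <= (p - 1) * (1 - 2 * q) by apply: Rmult_le_pos; lra.
lra.
Qed.

Lemma kernel_eq0 Y T t : 0 < Y -> 2 * Y <= T -> t <= Y -> kernel Y T t = 0.
Proof.
move=> HY HT Ht; rewrite /kernel !triangle_in; try lra.
by field; lra.
Qed.

Definition dsum (J : nat) (r : nat -> R) (g : nat -> nat -> R) :=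
  \rsum_(0 <= i < J) \rsum_(0 <= j < J) (r i * r j * g i j).

Lemma dsum_le J r g h : (forall i, 0 <= r i) -> (forall i j, g i j <= h i j) ->
  dsum J r g <= dsum J r h.
Proof.
move=> Hr H; apply: rsum_le => i _; apply: rsum_le => j _.
by apply: Rmult_le_compat_l => //; apply: Rmult_le_pos.
Qed.

Lemma dsum_ext J r g h : (forall i j, g i j = h i j) -> dsum J r g = dsum J r h.
Proof. by move=> H; apply: eq_bigr => i _; apply: eq_bigr => j _; rewrite H. Qed.

Lemma dsum_plus J r g h : dsum J r (fun i j => g i j + h i j) = dsum J r g + dsum J r h.
Proof.
rewrite /dsum -big_split; apply: eq_bigr => i _; rewrite -big_split; apply: eq_bigr => j _ /=.
by ring.
Qed.

Lemma dsum_scal J r g c : dsum J r (fun i j => c * g i j) = c * dsum J r g.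
Proof.
rewrite /dsum big_distrr; apply: eq_bigr => i _; rewrite big_distrr; apply: eq_bigr => j _ /=.
by ring.
Qed.

Lemma dsum_swap J r g : dsum J r (fun i j => g j i) = dsum J r g.
Proof.
rewrite /dsum exchange_big; apply: eq_bigr => i _; apply: eq_bigr => j _ /=.
by ring.
Qed.

Lemma dsum_const J r c : dsum J r (fun _ _ => c) = c * (\rsum_(0 <= i < J) r i) ^ 2.
Proof.
transitivity (\rsum_(0 <= i < J) (r i * c * \rsum_(0 <= i < J) r i)).
  by apply: eq_bigr => i _; rewrite big_distrr; apply: eq_bigr => j _ /=; ring.
by rewrite -big_distrl -big_distrl /=; ring.
Qed.

Lemma zeta_partial_sym u n t :
  zeta_partial u n t + zeta_partial (- u) n t = 2 * cos (t * u) * zeta_partial 0 n t.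
Proof.
have Ec x : cos (t * (ln x - u)) + cos (t * (ln x - - u)) = 2 * cos (t * u) * cos (t * (ln x - 0)).
  rewrite (_ : t * (ln x - u) = t * ln x - t * u); last ring.
  rewrite (_ : t * (ln x - - u) = t * ln x + t * u); last ring.
  by rewrite Rminus_0_r cos_minus cos_plus; ring.
have Es x : sin (t * (ln x - u)) + sin (t * (ln x - - u)) = 2 * cos (t * u) * sin (t * (ln x - 0)).
  rewrite (_ : t * (ln x - u) = t * ln x - t * u); last ring.
  rewrite (_ : t * (ln x - - u) = t * ln x + t * u); last ring.
  by rewrite Rminus_0_r sin_minus sin_plus; ring.
rewrite /zeta_partial /pole_term; set S1 := \rsum_(_ <= k < _) _; set S2 := \rsum_(_ <= k < _) _;
  set S3 := \rsum_(_ <= k < _) _.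
have -> : 2 * cos (t * u) * (S3 - sqrt (INR n.+1) * (cos (t * (ln (INR n.+1) - 0)) / 2 + t * sin
  (t * (ln (INR n.+1) - 0))) / (1 / 4 + t ^ 2)) =
   2 * cos (t * u) * S3 - sqrt (INR n.+1) * ((2 * cos (t * u) * cos (t * (ln (INR n.+1) - 0))) /
     2 + t * (2 * cos (t * u) * sin (t * (ln (INR n.+1) - 0)))) / (1 / 4 + t ^ 2).
  by field; have := quarter_sqr_gt0 t; nra.
rewrite -Ec -Es.
have -> : 2 * cos (t * u) * S3 = S1 + S2.
  rewrite /S1 /S2 /S3 -big_split big_distrr /=; apply: eq_bigr => k _.
  by rewrite -Rmult_plus_distr_l Ec; ring.
by field; have := quarter_sqr_gt0 t; nra.
Qed.

Definition resonator_sq (T : R) (J : nat) (r : nat -> R) (t : R) :=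
  dsum J r (fun i j => cos (t * ((INR i - INR j) / T))).

Lemma resonator_sq_ge0 T J r t : 0 <= resonator_sq T J r t.
Proof.
have -> : resonator_sq T J r t = (\rsum_(0 <= i < J) (r i * cos (t * (INR i / T)))) ^ 2
   + (\rsum_(0 <= i < J) (r i * sin (t * (INR i / T)))) ^ 2.
  rewrite /= !Rmult_1_r !big_distrl /= -big_split /=; apply: eq_bigr => i _.
  rewrite !big_distrr -big_split /=; apply: eq_bigr => j _.
  rewrite (_ : t * ((INR i - INR j) / T) = t * (INR i / T) - t * (INR j / T));
    last by rewrite /Rdiv; ring.
  by rewrite cos_minus; ring.
by have := pow2_ge_0 (\rsum_(0 <= i < J) (r i * cos (t * (INR i / T))));
  have := pow2_ge_0 (\rsum_(0 <= i < J) (r i * sin (t * (INR i / T)))); lra.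
Qed.

(* [Re (zeta e^(itu))] summed over [u] and [- u] only involves [Re zeta]. *)
Lemma resonator_zeta T J r n t :
  dsum J r (fun i j => zeta_partial ((INR i - INR j) / T) n t) =
  resonator_sq T J r t * zeta_partial 0 n t.
Proof.
set S := dsum J r _.
have E : S + S = 2 * (resonator_sq T J r t * zeta_partial 0 n t).
  rewrite {2}/S -dsum_swap -dsum_plus /resonator_sq [_ * zeta_partial _ _ _]Rmult_comm -!dsum_scal.
  apply: dsum_ext => i j.
  rewrite (_ : (INR j - INR i) / T = - ((INR i - INR j) / T)); last by rewrite /Rdiv; ring.
  by rewrite zeta_partial_sym; ring.
lra.
Qed.

Lemma fejer_schur J r : (forall i, 0 <= r i) ->
  dsum J r (fun i j => fejer (INR i - INR j)) <= 48 * \rsum_(0 <= i < J) (r i ^ 2).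
Proof.
move=> Hr.
have Hs i : \rsum_(0 <= j < J) fejer (INR i - INR j) <= 48.
  rewrite (eq_bigr (fun j => fejer (INR j - INR i))).
    by apply: fejer_separated_sum => k _ _; rewrite S_INR; lra.
  by move=> j _; rewrite -fejer_opp; congr fejer; ring.
apply: (@Rle_trans _ (\rsum_(0 <= i < J) \rsum_(0 <= j < J) (r i ^ 2 / 2 * fejer (INR i - INR j)
   + r j ^ 2 / 2 * fejer (INR j - INR i)))).
  apply: rsum_le => i _; apply: rsum_le => j _.
  rewrite -(fejer_opp (INR j - INR i)) (_ : - (INR j - INR i) = INR i - INR j); last ring.
  have := fejer_ge0 (INR i - INR j).
  have := pow2_ge_0 (r i - r j); nra.
under eq_bigr do rewrite big_split /=.
rewrite big_split /= [X in _ + X]exchange_big -big_split /= big_distrr /=.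
apply: rsum_le => i _; rewrite -big_distrr /=.
have := Hs i; have := pow2_ge_0 (r i); nra.
Qed.

Lemma scaled_bound a c z M : 0 <= a <= c -> - M <= z <= M -> - (c * M) <= a * z <= c * M.
Proof.
move=> Ha Hz; have H1 : a * z <= a * M by apply: Rmult_le_compat_l; lra.
have H2 : a * - M <= a * z by apply: Rmult_le_compat_l; lra.
have H3 : a * M <= c * M by apply: Rmult_le_compat_r; lra.
lra.
Qed.

Lemma nat_floor x : 0 <= x -> exists N, INR N <= x < INR N.+1.
Proof. by move=> Hx; have [N HN] := nfloor_ex x Hx; exists N; rewrite S_INR. Qed.

Lemma dsum_is_RInt J r (g : nat -> nat -> R -> R) v a b :
  (forall i j, is_RInt (g i j) a b (v i j)) ->
  is_RInt (fun t => dsum J r (fun i j => g i j t)) a b (dsum J r v).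
Proof.
move=> H; apply: rsum_is_RInt => i _; apply: rsum_is_RInt => j _.
exact: (is_RInt_scal (V := R_NormedModule)).
Qed.

Lemma lattice_resonance (zeta : C -> C) (T Y V : R) (J N : nat) (r : nat -> R) :
  is_riemann_zeta zeta -> 1 <= Y -> 2 * Y <= T -> 0 <= V ->
  (forall t, Y <= t <= T -> fst (zeta (1 / 2, t)) <= V) ->
  (forall i, 0 <= r i) -> INR N <= T < INR N.+1 ->
  \rsum_(1 <= k < N.+1) dsum J r (fun i j => main_term T ((INR i - INR j) / T) (INR k)) <=
  48 * T * (V + 1) * \rsum_(0 <= i < J) (r i ^ 2)
   + (8 * sqrt T * ln (1 + T) + 41 * sqrt T + 525 * Y) * (\rsum_(0 <= i < J) r i) ^ 2.
Proof.
move=> Hz HY HT HV Hzeta Hr HN.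
have [n1 Hn1] := zeta_approx zeta T 1 Hz ltac:(lra).
have [N1 HN1] := nat_floor Y ltac:(lra).
have [N2 HN2] := nat_floor (2 * Y) ltac:(lra).
pose n := (n1 + N + N1 + N2)%N.
have L0 : (n1 <= n)%N by rewrite /n -!addnA leq_addr.
have LN : (N <= n)%N by rewrite /n [(n1 + N)%N]addnC -!addnA leq_addr.
have LN1 : (N1 <= n)%N by rewrite /n [(_ + N1)%N]addnC -!addnA leq_addr.
have LN2 : (N2 <= n)%N by rewrite /n leq_addl.
pose u i j := (INR i - INR j) / T.
pose a := 2 - 2 * Y / T; pose b := 1 - 2 * Y / T.
have Hq : 0 <= 2 * Y / T <= 1.
  split; last by apply/Rle_div_l; lra.
  by apply: Rmult_le_pos; [lra | apply/Rlt_le/Rinv_0_lt_compat; lra].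
have Tri A M v : 1 <= A <= T -> INR M <= A < INR M.+1 -> (M <= n)%N ->
    is_RInt (fun t => zeta_partial v n t * triangle A t) 0 T (zeta_integral A v n).
  move=> HA HM Hn; apply: is_RInt_triangle; first lra.
  have H := zeta_integral_is_RInt A v M n ltac:(lra) Hn.
  by rewrite /zeta_integral (is_RInt_unique _ _ _ _ H).
pose KI i j := zeta_integral T (u i j) n - a * zeta_integral (2 * Y) (u i j) n + b *
  zeta_integral Y (u i j) n.
have HK : is_RInt (fun t => resonator_sq T J r t * zeta_partial 0 n t * kernel Y T t) 0 T (dsum J r KI).
  apply: (is_RInt_ext (fun t => dsum J r (fun i j => zeta_partial (u i j) n t * kernel Y T t))).
    move=> t _; rewrite -resonator_zeta [RHS]Rmult_comm -dsum_scal; apply: dsum_ext => i j;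
      rewrite /u; ring.
  apply: dsum_is_RInt => i j.
  have I1 := Tri T N (u i j) ltac:(lra) HN LN.
  have I2 := Tri (2 * Y) N2 (u i j) ltac:(lra) HN2 LN2.
  have I3 := Tri Y N1 (u i j) ltac:(lra) HN1 LN1.
  apply: (is_RInt_ext (fun t => plus (minus (zeta_partial (u i j) n t * triangle T t)
      (scal a (zeta_partial (u i j) n t * triangle (2 * Y) t)))
      (scal b (zeta_partial (u i j) n t * triangle Y t)))).
    move=> t _; rewrite /kernel /plus /minus /plus /opp /scal /= /mult /= /a /b; ring.
  apply: (is_RInt_plus (V := R_NormedModule)); last exact: (is_RInt_scal (V := R_NormedModule)).
  apply: (is_RInt_minus (V := R_NormedModule)) => //; exact: (is_RInt_scal (V := R_NormedModule)).
have HR : is_RInt (fun t => (V + 1) * (resonator_sq T J r t * triangle T t)) 0 T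
    ((V + 1) * dsum J r (fun i j => T * fejer (INR i - INR j))).
  apply: (is_RInt_scal (V := R_NormedModule)).
  apply: is_RInt_triangle; first lra.
  apply: (is_RInt_ext (fun t => dsum J r (fun i j => cos (t * u i j) * (1 - t / T)))).
    move=> t _; rewrite /resonator_sq [RHS]Rmult_comm -dsum_scal; apply: dsum_ext => i j;
      rewrite /u; ring.
  apply: dsum_is_RInt => i j.
  rewrite (_ : INR i - INR j = T * u i j); last by rewrite /u; field; lra.
  by apply: fejer_cos_integral; lra.
have Hle : dsum J r KI <= (V + 1) * dsum J r (fun i j => T * fejer (INR i - INR j)).
  apply: (is_RInt_le _ _ 0 T _ _ _ HK HR); first lra.
  move=> t Ht; have R0 := resonator_sq_ge0 T J r t.
  have [K0 K1] := kernel_bounds Y T t ltac:(lra) HT ltac:(lra).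
  case: (Rle_dec t Y) => HtY.
    rewrite kernel_eq0 //; try lra.
    have := triangle_ge0 T t => ?; rewrite Rmult_0_r.
    by apply: Rmult_le_pos; [lra | apply: Rmult_le_pos].
  have Z1 : zeta_partial 0 n t <= V + 1.
    have /Rabs_le_between := Hn1 n L0 t ltac:(lra).
    by have := Hzeta t ltac:(lra); lra.
  move: R0 K0 K1 Z1; move: (resonator_sq _ _ _ _) (zeta_partial _ _ _) (kernel _ _ _) (triangle _ _).
  move=> R Z K L R0 K0 K1 Z1.
  have H1 : R * K * Z <= R * K * (V + 1) by apply: Rmult_le_compat_l => //; apply: Rmult_le_pos.
  have H2 : R * K <= R * L by apply: Rmult_le_compat_l.
  have H3 : (V + 1) * (R * K) <= (V + 1) * (R * L) by apply: Rmult_le_compat_l; lra.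
  lra.
pose Er := 8 * sqrt T * ln (1 + T) + 41 * sqrt T + 525 * Y.
have Hlow : dsum J r (fun i j => \rsum_(1 <= k < N.+1) main_term T (u i j) (INR k) - Er) <= dsum J r KI.
  apply: dsum_le => // i j; rewrite /KI /Er.
  have /Rabs_le_between B1 := zeta_integral_bound T (u i j) N n ltac:(lra) HN LN.
  have /Rabs_le_between B2 := zeta_integral_abs (2 * Y) (u i j) N2 n ltac:(lra) HN2 LN2.
  have /Rabs_le_between B3 := zeta_integral_abs Y (u i j) N1 n ltac:(lra) HN1 LN1.
  have Ha : 0 <= a <= 2 by rewrite /a; lra.
  have Hb : 0 <= b <= 1 by rewrite /b; lra.
  have [_ M1] := scaled_bound _ _ _ _ Ha B2.
  have [M2 _] := scaled_bound _ _ _ _ Hb B3.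
  lra.
have Hsch := fejer_schur J r Hr.
rewrite dsum_plus in Hlow.
rewrite (dsum_const J r (- Er)) in Hlow.
have -> : \rsum_(1 <= k < N.+1) dsum J r (fun i j => main_term T (u i j) (INR k)) =
  dsum J r (fun i j => \rsum_(1 <= k < N.+1) main_term T (u i j) (INR k)).
  rewrite /dsum exchange_big; apply: eq_bigr => i _ /=.
  rewrite exchange_big; apply: eq_bigr => j _ /=.
  by rewrite big_distrr.
rewrite dsum_scal in Hle.
have H4 : (V + 1) * (T * dsum J r (fun i j => fejer (INR i - INR j))) <=
   (V + 1) * (T * (48 * \rsum_(0 <= i < J) (r i ^ 2))).
  by apply: Rmult_le_compat_l; [lra | apply: Rmult_le_compat_l; lra].
rewrite -/Er; lra.
Qed.

Lemma cauchy_schwarz (I : Type) (s : seq I) (P : pred I) (x y : I -> R) :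
  (\rsum_(i <- s | P i) (x i * y i)) ^ 2 <=
  \rsum_(i <- s | P i) (x i ^ 2) * \rsum_(i <- s | P i) (y i ^ 2).
Proof.
elim: s => [|i s IH]; first by rewrite !big_nil; lra.
rewrite !big_cons; case: (P i) => //.
have HA : 0 <= \rsum_(j <- s | P j) (x j ^ 2) by apply: rsum_ge0 => j _; apply: pow2_ge_0.
have HB : 0 <= \rsum_(j <- s | P j) (y j ^ 2) by apply: rsum_ge0 => j _; apply: pow2_ge_0.
move: (\rsum_(j <- s | P j) (x j * y j)) (\rsum_(j <- s | P j) (x j ^ 2)) (\rsum_(j <- s | P j)
  (y j ^ 2)) IH HA HB => S A B IH HA HB.
move: (x i) (y i) => a b.
suff : 2 * S * (a * b) <= a ^ 2 * B + b ^ 2 * A by nra.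
have HU : 0 <= a ^ 2 * B + b ^ 2 * A.
  by apply: Rplus_le_le_0_compat; apply: Rmult_le_pos => //; apply: pow2_ge_0.
apply: Rle_trans (Rle_abs _) _; rewrite -(Rabs_pos_eq _ HU).
apply: Rsqr_le_abs_0; rewrite /Rsqr.
have H1 : S ^ 2 * (a * b) ^ 2 <= A * B * (a * b) ^ 2.
  by apply: Rmult_le_compat_r => //; apply: pow2_ge_0.
have H2 := pow2_ge_0 (a ^ 2 * B - b ^ 2 * A).
nra.
Qed.

Lemma rsum_unique_le (E : finType) (P : pred E) (c : R) : 0 <= c ->
  (forall e1 e2, P e1 -> P e2 -> e1 = e2) -> \rsum_(e : E | P e) c <= c.
Proof.
move=> Hc HP; case: (pickP P) => [e He|H0]; last by rewrite big_pred0 //.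
rewrite (big_pred1 e); first lra.
by move=> e' /=; apply/idP/eqP => [H|-> //]; apply: HP.
Qed.

Lemma rsum_sqr_le (I : Type) (s : seq I) (P : pred I) (f : I -> R) : (forall i, 0 <= f i) ->
  \rsum_(i <- s | P i) (f i ^ 2) <= (\rsum_(i <- s | P i) f i) ^ 2.
Proof.
move=> Hf; elim: s => [|i s IH]; first by rewrite !big_nil; lra.
rewrite !big_cons; case: (P i) => //.
have H : 0 <= \rsum_(j <- s | P j) f j by apply: rsum_ge0.
have := Hf i; nra.
Qed.

Lemma matching_sum (E : finType) (P : rel E) (A B : pred E) (f : E -> R) :
  (forall e e1 e2, P e e1 -> P e e2 -> e1 = e2) ->
  (forall e e1 e2, P e1 e -> P e2 e -> e1 = e2) ->
  \rsum_(e : E | A e) \rsum_(e' : E | B e' && P e e') (f e * f e') <=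
  sqrt (\rsum_(e : E | A e) (f e ^ 2)) * sqrt (\rsum_(e : E | B e) (f e ^ 2)).
Proof.
move=> H1 H2.
have PA : 0 <= \rsum_(e : E | A e) (f e ^ 2) by apply: rsum_ge0 => j _; apply: pow2_ge_0.
have PB : 0 <= \rsum_(e : E | B e) (f e ^ 2) by apply: rsum_ge0 => j _; apply: pow2_ge_0.
rewrite -sqrt_mult // pair_big_dep /=.
have CS := cauchy_schwarz _ (index_enum (E * E)%type) (fun p => A p.1 && (B p.2 && P p.1 p.2))
   (fun p => f p.1) (fun p => f p.2).
apply: Rle_trans (Rle_abs _) _; rewrite -sqrt_Rsqr_abs; apply: sqrt_le_1_alt.
rewrite /Rsqr; move: CS; rewrite /= Rmult_1_r => CS; apply: Rle_trans CS _.
apply: Rmult_le_compat.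
- by apply: rsum_ge0 => j _; have := pow2_ge_0 (f j.1); rewrite /= Rmult_1_r.
- by apply: rsum_ge0 => j _; have := pow2_ge_0 (f j.2); rewrite /= Rmult_1_r.
- rewrite -(pair_big_dep A (fun e e' => B e' && P e e') (fun e _ => f e * (f e * 1))) /=.
  apply: rsum_le => e _; apply: rsum_unique_le.
    by have := pow2_ge_0 (f e); rewrite /= Rmult_1_r.
  by move=> e1 e2 /andP [_ P1] /andP [_ P2]; apply: H1 P1 P2.
- rewrite -(pair_big_dep A (fun e e' => B e' && P e e') (fun _ e' => f e' * (f e' * 1))) /=.
  rewrite (exchange_big_dep B) /=; last by move=> e e' _ /andP [].
  apply: rsum_le => e' _; apply: rsum_unique_le.
    by have := pow2_ge_0 (f e'); rewrite /= Rmult_1_r.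
  by move=> e1 e2 /andP [_ /andP [_ P1]] /andP [_ /andP [_ P2]]; apply: H2 P1 P2.
Qed.

Lemma resonance_bound (zeta : C -> C) (T Y V M : R) (N : nat) (E : finType) (m : E -> nat) (f : E -> R) :
  is_riemann_zeta zeta -> 1 <= Y -> 2 * Y <= T -> 0 <= V ->
  (forall t, Y <= t <= T -> fst (zeta (1 / 2, t)) <= V) ->
  INR N <= T < INR N.+1 ->
  (forall e, (0 < m e)%N) -> injective m -> (forall e, 0 <= f e) ->
  (\rsum_(e : E) f e) ^ 2 <= M * \rsum_(e : E) (f e ^ 2) ->
  \rsum_(1 <= k < N.+1) (/ sqrt (INR k) *
     \rsum_(e : E) \rsum_(e' : E | m e' == (k * m e)%N) (f e * f e')) <=
  4 * (48 * (V + 1) + (8 * sqrt T * ln (1 + T) + 41 * sqrt T + 525 * Y) / T * M)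
    * \rsum_(e : E) (f e ^ 2).
Proof.
move=> Hz HY HT HV Hzeta HN Hm Hinj Hf HM.
have HT0 : 0 < T by lra.
have Hm1 e : 1 <= INR (m e) by case: (m e) (Hm e) => // k _; apply: INRS_ge1.
have Hx e : 0 <= T * ln (INR (m e)) by apply: Rmult_le_pos; [lra | apply: ln_ge0].
pose b e := sval (nfloor_ex _ (Hx e)).
have Hb e : INR (b e) <= T * ln (INR (m e)) < INR (b e) + 1 by rewrite /b; case: (nfloor_ex _ _).
pose J := (\max_(e : E) b e).+1.
have HJ e : (b e < J)%N by rewrite ltnS; apply: leq_bigmax.
pose bo e : 'I_J := Ordinal (HJ e).
pose r j := sqrt (\rsum_(e : E | b e == j) (f e ^ 2)).
have Hr j : 0 <= r j by apply: sqrt_pos.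
have HS0 j : 0 <= \rsum_(e : E | b e == j) (f e ^ 2) by apply: rsum_ge0 => e _; apply: pow2_ge_0.
have Hpart (F : E -> R) : \rsum_(e : E) F e = \rsum_(0 <= j < J) \rsum_(e : E | b e == j) F e.
  by rewrite big_mkord (partition_big bo xpredT).
have Hr2 : \rsum_(0 <= j < J) (r j ^ 2) = \rsum_(e : E) (f e ^ 2).
  rewrite Hpart; apply: eq_bigr => j _.
  by rewrite /r /= Rmult_1_r sqrt_sqrt.
have Hr1 : (\rsum_(0 <= j < J) r j) ^ 2 <= M * \rsum_(e : E) (f e ^ 2).
  apply: Rle_trans HM; apply: pow_incr; split; first by apply: rsum_ge0.
  rewrite Hpart; apply: rsum_le => j _.
  have H : 0 <= \rsum_(e : E | b e == j) f e by apply: rsum_ge0.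
  rewrite -(sqrt_pow2 _ H); apply: sqrt_le_1_alt.
  exact: rsum_sqr_le.
have Lat := lattice_resonance zeta T Y V J N r Hz HY HT HV Hzeta Hr HN.
set Er := 8 * _ * _ + _ + _ in Lat *.
have HEr : 0 <= Er.
  rewrite /Er; have := sqrt_pos T; have := ln_ge0 (1 + T) ltac:(lra) => L1 L2.
  have : 0 <= sqrt T * ln (1 + T) by apply: Rmult_le_pos.
  lra.
have key k : (0 < k)%N ->
  \rsum_(e : E) \rsum_(e' : E | m e' == (k * m e)%N) (f e * f e') <=
  4 * dsum J r (fun i j => fejer (T * (ln (INR k) - (INR i - INR j) / T))).
  move=> Hk.
  rewrite Hpart /dsum big_distrr /=.
  have -> : \rsum_(0 <= j < J) \rsum_(e : E | b e == j) \rsum_(e' : E | m e' == (k * m e)%N) (f e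
    * f e') =
    \rsum_(0 <= j < J) \rsum_(0 <= i < J) \rsum_(e : E | b e == j) \rsum_(e' : E | (b e' == i) &&
      (m e' == (k * m e)%N)) (f e * f e').
    apply: eq_bigr => j _; rewrite [RHS]exchange_big /=; apply: eq_bigr => e _.
    rewrite big_mkord (partition_big bo xpredT) //=.
    by apply: eq_bigr => i _; apply: eq_bigl => e'; rewrite andbC.
  rewrite exchange_big /=.
  apply: rsum_le => i _; rewrite big_distrr /=; apply: rsum_le => j _.
  set F := fejer _.
  have F0 : 0 <= F by apply: fejer_ge0.
  case: (pickP (fun p : E * E => [&& b p.1 == j, b p.2 == i & m p.2 == (k * m p.1)%N])) =>
    [[e e'] /= /and3P [/eqP Hj /eqP Hi /eqP He]|H0].
    have F1 : 1 / 4 <= F.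
      apply: fejer_ge_quarter.
      have -> : T * (ln (INR k) - (INR i - INR j) / T) = T * ln (INR k) - INR i + INR j by field; lra.
      have Hk0 : 0 < INR k by apply: lt_0_INR; apply/ltP.
      have : T * ln (INR (m e')) = T * ln (INR k) + T * ln (INR (m e)).
        by rewrite He mult_INR ln_mult; [ring | | have := Hm1 e; lra].
      have := Hb e; have := Hb e'; rewrite Hi Hj => *; lra.
    apply: Rle_trans (matching_sum E (fun e e' => m e' == (k * m e)%N) _ _ f _ _) _.
    - by move=> e0 e1 e2 /eqP E1 /eqP E2; apply: Hinj; rewrite E1 E2.
    - move=> e0 e1 e2 /eqP E1 /eqP E2; apply: Hinj.
      by apply/eqP; rewrite -(eqn_pmul2l Hk) -E1 -E2.
    rewrite -/(r i) -/(r j).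
    have : 0 <= r i * r j by apply: Rmult_le_pos.
    nra.
  rewrite big1; first by do !apply: Rmult_le_pos => //; lra.
  move=> e Hj; rewrite big_pred0 // => e'.
  by have := H0 (e, e'); rewrite /= Hj.
apply: (@Rle_trans _ (4 / T * \rsum_(1 <= k < N.+1) dsum J r (fun i j =>
  main_term T ((INR i - INR j) / T) (INR k)))).
  rewrite big_distrr /=; apply: rsum_nat_le => k Hk _.
  have -> : dsum J r (fun i j => main_term T ((INR i - INR j) / T) (INR k)) =
     / sqrt (INR k) * (T * dsum J r (fun i j => fejer (T * (ln (INR k) - (INR i - INR j) / T)))).
    by rewrite -!dsum_scal.
  have -> : 4 / T * (/ sqrt (INR k) * (T * dsum J r (fun i j =>
    fejer (T * (ln (INR k) - (INR i - INR j) / T))))) =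
    / sqrt (INR k) * (4 * dsum J r (fun i j => fejer (T * (ln (INR k) - (INR i - INR j) / T)))).
    field; split; first by apply/Rgt_not_eq/sqrt_lt_R0/lt_0_INR/ltP.
    lra.
  apply: Rmult_le_compat_l; last exact: key.
  by apply/Rlt_le/Rinv_0_lt_compat/sqrt_lt_R0/lt_0_INR/ltP.
have H4 : 0 <= 4 / T by apply: Rmult_le_pos; [lra | apply/Rlt_le/Rinv_0_lt_compat].
apply: Rle_trans (Rmult_le_compat_l _ _ _ H4 Lat) _.
rewrite Hr2.
have H5 : Er * (\rsum_(0 <= i < J) r i) ^ 2 <= Er * (M * \rsum_(e : E) (f e ^ 2)).
  exact: Rmult_le_compat_l.
apply: (@Rle_trans _ (4 / T * (48 * T * (V + 1) * \rsum_(e : E) (f e ^ 2) + Er * (M * \rsum_(e :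
  E) (f e ^ 2))))).
  by apply: Rmult_le_compat_l => //; lra.
by apply: Req_le; field; lra.
Qed.

(** * Multiplicative resonators *)

Lemma sum_prod_bool (I : finType) (w : I -> bool -> R) :
  \rsum_(g : {ffun I -> bool}) \rprod_(i : I) w i (g i) = \rprod_(i : I) (w i false + w i true).
Proof.
rewrite -(bigA_distr_bigA w); apply: eq_bigr => i _.
by rewrite big_bool Rplus_comm.
Qed.

Lemma sum_prod_bool2 (I : finType) (w : I -> bool -> bool -> R) :
  \rsum_(g : {ffun I -> bool}) \rsum_(h : {ffun I -> bool}) \rprod_(i : I) w i (g i) (h i) =
  \rprod_(i : I) (w i false false + w i false true + (w i true false + w i true true)).
Proof.
rewrite -(sum_prod_bool _ (fun i b => w i b false + w i b true)).
by apply: eq_bigr => g _; rewrite (sum_prod_bool _ (fun i b => w i (g i) b)).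
Qed.

Lemma rprod_ge0 (I : finType) (F : I -> R) : (forall i, 0 <= F i) -> 0 <= \rprod_(i : I) F i.
Proof. by move=> H; apply: big_ind => //; [lra | move=> *; apply: Rmult_le_pos]. Qed.

Lemma rprod_gt0 (I : finType) (F : I -> R) : (forall i, 0 < F i) -> 0 < \rprod_(i : I) F i.
Proof. by move=> H; apply: big_ind => //; [lra | move=> *; apply: Rmult_lt_0_compat]. Qed.

Lemma rprod_le (I : finType) (F G : I -> R) : (forall i, 0 <= F i <= G i) ->
  \rprod_(i : I) F i <= \rprod_(i : I) G i.
Proof.
move=> H.
suff : 0 <= \rprod_(i : I) F i <= \rprod_(i : I) G i by case.
apply: (big_ind2 (fun x y => 0 <= x <= y)) => //; first lra.
move=> x1 x2 y1 y2 [H1 H2] [H3 H4]; split; first exact: Rmult_le_pos.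
exact: Rmult_le_compat.
Qed.

Lemma exp_rsum (I : finType) (F : I -> R) :
  exp (\rsum_(i : I) F i) = \rprod_(i : I) exp (F i).
Proof. exact: (big_morph exp exp_plus exp_0). Qed.

Lemma INR_prod (I : finType) (F : I -> nat) :
  INR (\prod_(i : I) F i) = \rprod_(i : I) INR (F i).
Proof. exact: (big_morph INR mult_INR (erefl (INR 1))). Qed.

Lemma sqrt_rprod (I : finType) (F : I -> R) : (forall i, 0 <= F i) ->
  sqrt (\rprod_(i : I) F i) = \rprod_(i : I) sqrt (F i).
Proof.
move=> H.
suff [] : 0 <= \rprod_(i : I) F i /\ sqrt (\rprod_(i : I) F i) = \rprod_(i : I) sqrt (F i) by [].
apply: (big_ind2 (fun x y => 0 <= x /\ sqrt x = y)) => //; first by rewrite sqrt_1; split; lra.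
move=> x1 x2 y1 y2 [H1 <-] [H3 <-]; split; first exact: Rmult_le_pos.
by rewrite sqrt_mult.
Qed.

Definition sqfree {I : finType} (p : I -> nat) (g : {ffun I -> bool}) : nat :=
  \prod_(i : I) (if g i then p i else 1%N).

Lemma dvd_sqfree (I : finType) (p : I -> nat) (g : {ffun I -> bool}) i :
  (forall i, prime (p i)) -> injective p -> (p i %| sqfree p g) = g i.
Proof.
move=> Hp Hinj; case Hg: (g i).
  by rewrite /sqfree (bigD1 i) //= Hg dvdn_mulr.
apply/negbTE; rewrite -prime_coprime // /sqfree.
apply: (big_ind (fun n => coprime (p i) n)) => [||j _].
- exact: coprimen1.
- by move=> x y Hx Hy; rewrite coprimeMr Hx.
case Hj: (g j); last exact: coprimen1.
rewrite prime_coprime // dvdn_prime2 //.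
by apply/eqP => /Hinj E; rewrite E Hj in Hg.
Qed.

Lemma sqfree_inj (I : finType) (p : I -> nat) :
  (forall i, prime (p i)) -> injective p -> injective (sqfree p).
Proof.
move=> Hp Hinj g h E; apply/ffunP => i.
by rewrite -(dvd_sqfree _ p g) // -(dvd_sqfree _ p h) // E.
Qed.

Lemma sqfree_gt0 (I : finType) (p : I -> nat) g : (forall i, prime (p i)) -> (0 < sqfree p g)%N.
Proof. by move=> Hp; apply: prodn_gt0 => i; case: (g i) => //; apply: prime_gt0. Qed.

Definition mweight {I : finType} (f : I -> R) (g : {ffun I -> bool}) : R :=
  \rprod_(i : I) (if g i then f i else 1).
Definition mcost {I : finType} (f : I -> R) (g : {ffun I -> bool}) : R :=
  \rsum_(i : I) (if g i then - ln (f i ^ 2) else 0).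
(* The weight vanishes outside [f(g)^2 >= exp (- W)]. This set of [g] is closed
   under divisors and has at most [exp W * prod (1 + f^2)] elements. *)
Definition resonator {I : finType} (f : I -> R) (W : R) (g : {ffun I -> bool}) : R :=
  if Rle_dec (mcost f g) W then mweight f g else 0.

Lemma mweight_sqr (I : finType) (f : I -> R) g : (forall i, 0 < f i) ->
  mweight f g ^ 2 = exp (- mcost f g).
Proof.
move=> Hf; rewrite /mcost -rsum_opp exp_rsum /mweight /= Rmult_1_r -big_split /=.
apply: eq_bigr => i _; case: (g i); last by rewrite Ropp_0 exp_0 Rmult_1_r.
by rewrite Ropp_involutive /= Rmult_1_r exp_ln //; apply: Rmult_lt_0_compat.
Qed.

Lemma mweight_gt0 (I : finType) (f : I -> R) g : (forall i, 0 < f i) -> 0 < mweight f g.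
Proof. by move=> Hf; apply: rprod_gt0 => i; case: (g i) => //; lra. Qed.

Lemma resonator_ge0 (I : finType) (f : I -> R) W g : (forall i, 0 < f i) -> 0 <= resonator f W g.
Proof.
move=> Hf; rewrite /resonator; case: Rle_dec => /= _; last lra.
by apply/Rlt_le/mweight_gt0.
Qed.

Lemma resonator_l2 (I : finType) (f : I -> R) W : (forall i, 0 < f i) ->
  \rsum_(g : {ffun I -> bool}) (resonator f W g ^ 2) <= \rprod_(i : I) (1 + f i ^ 2).
Proof.
move=> Hf; rewrite -(sum_prod_bool I (fun i b => if b then f i ^ 2 else 1)).
apply: rsum_le => g _.
have -> : \rprod_(i : I) (if g i then f i ^ 2 else 1) = mweight f g ^ 2.
  rewrite /mweight /= Rmult_1_r -big_split /=; apply: eq_bigr => i _.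
  by case: (g i); ring.
rewrite /resonator; case: Rle_dec => /= _; first lra.
have := pow2_ge_0 (mweight f g) => /=; lra.
Qed.

Lemma resonator_l1 (I : finType) (f : I -> R) W : (forall i, 0 < f i) ->
  (\rsum_(g : {ffun I -> bool}) resonator f W g) ^ 2 <=
  exp W * \rprod_(i : I) (1 + f i ^ 2) * \rsum_(g : {ffun I -> bool}) (resonator f W g ^ 2).
Proof.
move=> Hf.
have H2 := resonator_l2 I f W Hf.
have HS : 0 <= \rsum_(g : {ffun I -> bool}) (resonator f W g ^ 2).
  by apply: rsum_ge0 => g _; apply: pow2_ge_0.
have H1 : \rsum_(g : {ffun I -> bool}) resonator f W g <=
    exp (W / 2) * \rsum_(g : {ffun I -> bool}) (resonator f W g ^ 2).
  rewrite big_distrr /=; apply: rsum_le => g _.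
  rewrite /resonator; case: Rle_dec => /= HW; last lra.
  have P := mweight_gt0 I f g Hf.
  have E := mweight_sqr I f g Hf.
  suff : 1 <= exp (W / 2) * mweight f g by nra.
  have -> : mweight f g = exp (- mcost f g / 2).
    rewrite -(sqrt_pow2 (mweight f g)); last lra.
    rewrite E -(sqrt_pow2 (exp (- mcost f g / 2))); last by apply/Rlt_le/exp_pos.
    by rewrite /= Rmult_1_r -exp_plus; congr (sqrt (exp _)); field.
  by rewrite -exp_plus -exp_0; apply: exp_le_compat; lra.
have H0 : 0 <= \rsum_(g : {ffun I -> bool}) resonator f W g.
  by apply: rsum_ge0 => g _; apply: resonator_ge0.
apply: (@Rle_trans _ ((exp (W / 2) * \rsum_(g : {ffun I -> bool}) (resonator f W g ^ 2)) ^ 2)).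
  by apply: pow_incr.
have -> : exp W = exp (W / 2) * exp (W / 2) by rewrite -exp_plus; congr exp; field.
have := exp_pos (W / 2); move: HS H2; move: (\rsum_(g : _) _) (\rprod_(i : I) _) (exp (W / 2)) =>
  S P e HS HP He.
have : (e * e * S) * S <= (e * e * S) * P by apply: Rmult_le_compat_l => //;
  apply: Rmult_le_pos => //; nra.
lra.
Qed.

(* The pairs [(g, h)] with [g] dividing [h] carry a product weight. Those with
   [h] outside the support of the resonator, or with [h / g > T], are removed by
   Rankin's trick with parameters [theta] and [eta]. *)
Lemma gcd_sum_lower (I : finType) (p : I -> nat) (f : I -> R) (W theta eta T : R) (N : nat) :
  (forall i, prime (p i)) -> injective p -> (forall i, 0 < f i <= 1) -> 0 <= theta -> 0 <= eta ->
  0 < T -> INR N <= T < INR N.+1 ->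
  \rprod_(i : I) (1 + (f i ^ 2 + f i / sqrt (INR (p i))))
  - exp (- theta * W) * \rprod_(i : I) (1 + (f i ^ 2 + f i / sqrt (INR (p i))) * exp (theta * -
    ln (f i ^ 2)))
  - exp (- eta * ln T) * \rprod_(i : I) (1 + (f i ^ 2 + f i / sqrt (INR (p i)) * exp (eta * ln
    (INR (p i)))))
  <= \rsum_(1 <= k < N.+1) (/ sqrt (INR k) *
     \rsum_(g : {ffun I -> bool}) \rsum_(h : {ffun I -> bool} | sqfree p h == (k * sqfree p g)%N)
        (resonator f W g * resonator f W h)).
Proof.
move=> Hp Hinj Hf Hth Heta HT HN.
have Hf0 i : 0 < f i by case: (Hf i).
have Hp1 i : 1 <= INR (p i) by case: (p i) (prime_gt0 (Hp i)) => // n _; apply: INRS_ge1.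
pose w i (b b' : bool) := if b then (if b' then f i ^ 2 else 0) else (if b' then f i / sqrt (INR
  (p i)) else 1).
pose w1 i (b b' : bool) := w i b b' * (if b' then exp (theta * - ln (f i ^ 2)) else 1).
pose w2 i (b b' : bool) := w i b b' * (if ~~ b && b' then exp (eta * ln (INR (p i))) else 1).
have -> : \rprod_(i : I) (1 + (f i ^ 2 + f i / sqrt (INR (p i)))) =
    \rsum_(g : {ffun I -> bool}) \rsum_(h : {ffun I -> bool}) \rprod_(i : I) w i (g i) (h i).
  by rewrite sum_prod_bool2; apply: eq_bigr => i _; rewrite /w; ring.
have -> : \rprod_(i : I) (1 + (f i ^ 2 + f i / sqrt (INR (p i))) * exp (theta * - ln (f i ^ 2))) =
    \rsum_(g : {ffun I -> bool}) \rsum_(h : {ffun I -> bool}) \rprod_(i : I) w1 i (g i) (h i).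
  by rewrite sum_prod_bool2; apply: eq_bigr => i _; rewrite /w1 /w; ring.
have -> : \rprod_(i : I) (1 + (f i ^ 2 + f i / sqrt (INR (p i)) * exp (eta * ln (INR (p i))))) =
    \rsum_(g : {ffun I -> bool}) \rsum_(h : {ffun I -> bool}) \rprod_(i : I) w2 i (g i) (h i).
  by rewrite sum_prod_bool2; apply: eq_bigr => i _; rewrite /w2 /w /=; ring.
rewrite !big_distrr -!rsum_minus /=.
have -> : \rsum_(1 <= k < N.+1) (/ sqrt (INR k) *
     \rsum_(g : {ffun I -> bool}) \rsum_(h : {ffun I -> bool} | sqfree p h == (k * sqfree p g)%N)
        (resonator f W g * resonator f W h)) =
  \rsum_(g : {ffun I -> bool}) \rsum_(h : {ffun I -> bool}) \rsum_(1 <=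
    k < N.+1 | sqfree p h == (k * sqfree p g)%N)
        (/ sqrt (INR k) * (resonator f W g * resonator f W h)).
  under eq_bigr do rewrite big_distrr /=.
  rewrite exchange_big /=; apply: eq_bigr => g _.
  under eq_bigr do rewrite big_distrr /= big_mkcond /=.
  rewrite exchange_big /=; apply: eq_bigr => h _.
  by rewrite [RHS]big_mkcond.
apply: rsum_le => g _; rewrite !big_distrr -!rsum_minus /=; apply: rsum_le => h _.
have Rpos : 0 <= \rsum_(1 <= k < N.+1 | sqfree p h == (k * sqfree p g)%N)
        (/ sqrt (INR k) * (resonator f W g * resonator f W h)).
  rewrite big_nat_cond; apply: rsum_ge0 => k /andP [/andP [Hk _] _].
  apply: Rmult_le_pos; first by apply/Rlt_le/Rinv_0_lt_compat/sqrt_lt_R0/lt_0_INR/ltP.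
  by apply: Rmult_le_pos; apply: resonator_ge0.
case: (pickP (fun i => g i && ~~ h i)) => [i0 Hi0 | Hsub].
  have Z (v : I -> bool -> bool -> R) : v i0 true false = 0 -> \rprod_(i : I) v i (g i) (h i) = 0.
    move=> Hv; rewrite (bigD1 i0) //=; move: Hi0 => /andP [-> /negbTE ->].
    by rewrite Hv Rmult_0_l.
  rewrite !Z; [lra| by rewrite /w2 /w /=; ring | by rewrite /w1 /w /=; ring | by []].
have {}Hsub i : g i -> h i by move=> Hg; have := Hsub i; rewrite Hg /= => /negbFE.
pose k0 := (\prod_(i : I) (if ~~ g i && h i then p i else 1%N))%N.
have Hk0 : sqfree p h = (k0 * sqfree p g)%N.
  rewrite /k0 /sqfree -big_split; apply: eq_bigr => i _ /=.
  by case Hg: (g i) => /=; rewrite ?(Hsub i Hg) ?mul1n ?muln1.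
have Hk0pos : (0 < k0)%N.
  by apply: prodn_gt0 => i; case: (~~ g i && h i) => //; apply: prime_gt0.
have Hk01 : 0 < INR k0 by apply/lt_0_INR/ltP.
have E0 : \rprod_(i : I) w i (g i) (h i) = / sqrt (INR k0) * (mweight f g * mweight f h).
  have -> : / sqrt (INR k0) = \rprod_(i : I) / sqrt (INR (if ~~ g i && h i then p i else 1%N)).
    rewrite /k0 INR_prod sqrt_rprod; last by move=> i; apply: pos_INR.
    exact: (big_morph Rinv Rinv_mult Rinv_1).
  rewrite /mweight -!big_split /=; apply: eq_bigr => i _; rewrite /w.
  case Hg: (g i) => /=; first by rewrite (Hsub i Hg) [INR 1]/1 sqrt_1 Rinv_1; ring.
  case: (h i) => /=; first by rewrite /Rdiv; ring.
  by rewrite [INR 1]/1 sqrt_1 Rinv_1; ring.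
have E1 : \rprod_(i : I) w1 i (g i) (h i) = \rprod_(i : I) w i (g i) (h i) * exp (theta * mcost f h).
  rewrite /mcost big_distrr exp_rsum -big_split /=; apply: eq_bigr => i _; rewrite /w1.
  by case: (h i); rewrite ?Rmult_0_r ?exp_0.
have E2 : \rprod_(i : I) w2 i (g i) (h i) = \rprod_(i : I) w i (g i) (h i) * exp (eta * ln (INR k0)).
  have -> : ln (INR k0) = \rsum_(i : I) (if ~~ g i && h i then ln (INR (p i)) else 0).
    apply: exp_inv; rewrite exp_ln // exp_rsum /k0 INR_prod; apply: eq_bigr => i _.
    case: (~~ _ && _); last by rewrite exp_0.
    by rewrite exp_ln //; have := Hp1 i; lra.
  rewrite big_distrr exp_rsum -big_split /=; apply: eq_bigr => i _; rewrite /w2.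
  by case: (~~ _ && _); rewrite ?Rmult_0_r ?exp_0.
rewrite {}E1 {}E2.
have P0 : 0 <= \rprod_(i : I) w i (g i) (h i).
  apply: rprod_ge0 => i; rewrite /w; have := Hf0 i.
  have : 0 < / sqrt (INR (p i)) by apply/Rinv_0_lt_compat/sqrt_lt_R0; have := Hp1 i; lra.
  by move=> ? ?; case: (g i); case: (h i); rewrite /Rdiv; nra.
have X1 : exp (- theta * W) * (\rprod_(i : I) w i (g i) (h i) * exp (theta * mcost f h)) =
   \rprod_(i : I) w i (g i) (h i) * exp (theta * (mcost f h - W)).
  by rewrite (_ : theta * (mcost f h - W) = - theta * W + theta * mcost f h) ?exp_plus; ring.
have X2 : exp (- eta * ln T) * (\rprod_(i : I) w i (g i) (h i) * exp (eta * ln (INR k0))) =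
   \rprod_(i : I) w i (g i) (h i) * exp (eta * (ln (INR k0) - ln T)).
  by rewrite (_ : eta * (ln (INR k0) - ln T) = - eta * ln T + eta * ln (INR k0)) ?exp_plus; ring.
rewrite {}X1 {}X2.
have Y1 := exp_pos (theta * (mcost f h - W)).
have Y2 := exp_pos (eta * (ln (INR k0) - ln T)).
have [HW|HW] := Rlt_le_dec W (mcost f h).
  have : 1 <= exp (theta * (mcost f h - W)).
    by rewrite -exp_0; apply: exp_le_compat; apply: Rmult_le_pos; lra.
  by nra.
have [HN0|HN0] := Rlt_le_dec T (INR k0).
  have : 1 <= exp (eta * (ln (INR k0) - ln T)).
    rewrite -exp_0; apply: exp_le_compat; apply: Rmult_le_pos => //.
    by have := ln_increasing T (INR k0) HT HN0; lra.
  by nra.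
have HkN : (k0 < N.+1)%N.
  by apply/ltP/INR_lt; lra.
have Hcost : mcost f g <= W.
  apply: Rle_trans HW; apply: rsum_le => i _.
  have Hz : 0 <= - ln (f i ^ 2).
    have [F0 F1] := Hf i.
    have : ln (f i ^ 2) <= ln 1 by apply: ln_le_compat; nra.
    by rewrite ln_1; lra.
  by case Hg: (g i); rewrite ?(Hsub i Hg); [lra | case: (h i); lra].
suff : \rprod_(i : I) w i (g i) (h i) <= \rsum_(1 <= k < N.+1 | sqfree p h == (k * sqfree p g)%N)
        (/ sqrt (INR k) * (resonator f W g * resonator f W h)) by nra.
rewrite E0.
have -> : mweight f g = resonator f W g by rewrite /resonator; case: Rle_dec.
have -> : mweight f h = resonator f W h by rewrite /resonator; case: Rle_dec.
rewrite big_mkcond (bigD1_seq k0) ?iota_uniq //=; last by rewrite mem_index_iota Hk0pos.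
rewrite {1}Hk0 eqxx.
set rest := \big[_/_]_(_ <- _ | _) _.
suff : 0 <= rest by lra.
rewrite /rest big_seq_cond; apply: rsum_ge0 => k /andP [Hk _].
case: (_ == _); last lra.
apply: Rmult_le_pos; last by apply: Rmult_le_pos; apply: resonator_ge0.
apply/Rlt_le/Rinv_0_lt_compat/sqrt_lt_R0/lt_0_INR/ltP.
by move: Hk; rewrite mem_index_iota => /andP [].
Qed.

(** * Sums over primes *)

Lemma INR_expn (m n : nat) : INR (m ^ n)%N = INR m ^ n.
Proof. by elim: n => [|n IH]; rewrite ?expn0 // expnS mult_INR IH. Qed.

Lemma ln_nat_ge0 n : 0 <= ln (INR n).
Proof.
case: n => [|n]; last by apply: ln_ge0; apply: INRS_ge1.
by rewrite /ln; case: Rlt_dec => [H|_] /=; [exfalso; move: H; rewrite /INR; lra | lra].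
Qed.

Lemma ln_factorization (k M : nat) : (0 < k)%N -> (k <= M)%N ->
  ln (INR k) = \rsum_(0 <= p < M.+1) (INR (logn p k) * ln (INR p)).
Proof.
move=> Hk HM; apply: exp_inv; rewrite exp_ln; last by apply/lt_0_INR/ltP.
rewrite (big_morph exp exp_plus exp_0) -{1}(partnT Hk) (widen_partn _ HM).
rewrite (big_morph INR mult_INR (erefl (INR 1))); apply: eq_bigr => p _.
rewrite INR_expn; case: p => [|p]; first by rewrite lognE /= Rmult_0_l exp_0.
rewrite Rmult_comm -/(Rpower _ _).
by rewrite -Rpower_pow; [rewrite /Rpower Rmult_comm | apply: INRS_gt0].
Qed.

Lemma prime_dvd_fact p m : prime p -> (p %| m`!)%N -> (p <= m)%N.
Proof.
move=> Hp; elim: m => [|m IH]; first by rewrite fact0 Euclid_dvd1.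
rewrite factS Euclid_dvdM // => /orP [/dvdn_leq -> //|/IH H].
exact: leq_trans H _.
Qed.

Lemma prime_dvd_central_bin p m : prime p -> (m < p)%N -> (p <= m + m)%N ->
  (p %| 'C(m + m, m))%N.
Proof.
move=> Hp Hmp Hpm.
have H : (p %| (m + m)`!)%N by apply: dvdn_fact; rewrite prime_gt0.
move: H; rewrite -(bin_fact (leq_addr m m)) addnK !Euclid_dvdM //.
case/or3P => // /(prime_dvd_fact _ _ Hp); by rewrite leqNgt Hmp.
Qed.

Lemma central_bin_le m : ('C(m + m, m) <= 2 ^ (m + m))%N.
Proof.
have := expnDn 1 1 (m + m); rewrite addn1 => ->.
have Hm : (m < (m + m).+1)%N by rewrite ltnS leq_addr.
by rewrite (bigD1 (Ordinal Hm)) //= !exp1n !muln1 leq_addr.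
Qed.

Definition chebyshev_theta (n : nat) := \rsum_(0 <= p < n.+1 | prime p) ln (INR p).

Lemma rsum_cat (F : nat -> R) (P : pred nat) a b c : (a <= b)%N -> (b <= c)%N ->
  \rsum_(a <= k < c | P k) F k = \rsum_(a <= k < b | P k) F k + \rsum_(b <= k < c | P k) F k.
Proof. by move=> H1 H2; rewrite (big_cat_nat H1 H2). Qed.

Lemma theta_double m : chebyshev_theta (m + m) <= chebyshev_theta m + 2 * INR m * ln 2.
Proof.
rewrite /chebyshev_theta (rsum_cat _ _ 0%N m.+1) // ?ltnS ?leq_addr //.
apply: Rplus_le_compat_l.
set c := 'C(m + m, m).
have Hc : (0 < c)%N by rewrite bin_gt0 leq_addr.
apply: (@Rle_trans _ (ln (INR c))); last first.
  have -> : 2 * INR m * ln 2 = ln (INR (2 ^ (m + m))%N).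
    rewrite INR_expn (_ : INR 2 = 2) // -Rpower_pow; last lra.
    by rewrite ln_exp plus_INR; ring.
  by apply: ln_le_compat; [apply/lt_0_INR/ltP | apply: le_INR; apply/leP/central_bin_le].
rewrite (ln_factorization c (c + (m + m))) ?leq_addr //.
have Hpos p : 0 <= INR (logn p c) * ln (INR p).
  by apply: Rmult_le_pos; [apply: pos_INR | apply: ln_nat_ge0].
rewrite (rsum_cat _ xpredT 0%N m.+1) //; last by rewrite ltnS addnA leq_addl.
rewrite (rsum_cat _ xpredT m.+1 (m + m).+1) ?ltnS ?leq_addr ?leq_addl //.
have P1 : 0 <= \rsum_(0 <= p < m.+1) (INR (logn p c) * ln (INR p)) by apply: rsum_ge0.
have P2 : 0 <= \rsum_((m + m).+1 <= p < (c + (m + m)).+1) (INR (logn p c) * ln (INR p)) by apply: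
  rsum_ge0.
suff : \rsum_(m.+1 <= p < (m + m).+1 | prime p) ln (INR p) <=
   \rsum_(m.+1 <= p < (m + m).+1) (INR (logn p c) * ln (INR p)) by lra.
rewrite big_mkcond; apply: rsum_nat_le => p Hp1 Hp2; case: ifP => Hp //.
have : 1 <= INR (logn p c).
  apply: (le_INR 1); apply/leP; rewrite -pfactor_dvdn // expn1.
  exact: prime_dvd_central_bin.
have := ln_nat_ge0 p; nra.
Qed.

Lemma theta_succ n : chebyshev_theta n.+1 <= chebyshev_theta n + ln (INR n.+1).
Proof.
rewrite /chebyshev_theta big_mkcond big_nat_recr //= -big_mkcond /=.
by have := ln_nat_ge0 n.+1; case: ifP => _; lra.
Qed.

Lemma ln2_bounds : 1 / 2 <= ln 2 <= 1.
Proof.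
split.
  have := exp_ineq1_le (- ln 2); rewrite exp_Ropp exp_ln; lra.
by have := exp_ineq1_le (ln 2); rewrite exp_ln; lra.
Qed.

Lemma theta_bound n : chebyshev_theta n <= 8 * INR n.
Proof.
elim/ltn_ind: n => n IH.
case: n IH => [|n] IH.
  by rewrite /chebyshev_theta big_mkcond big_nat1 /= /INR; lra.
have [L1 L2] := ln2_bounds.
have E := odd_double_half n.+1; rewrite -addnn in E.
set m := n.+1./2 in E.
have Hm : (m < n.+1)%N.
  by rewrite /m ltn_half_double -addnn -{1}[n.+1]addn0 ltn_add2l.
have Tm := IH m Hm; have Td := theta_double m; have Pm := pos_INR m.
rewrite -E plus_INR plus_INR; case: (odd _) => /=; rewrite ?add0n ?add1n.
  have Ts := theta_succ (m + m).
  have Hln : ln (INR (m + m).+1) <= 1 + INR m.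
    apply: (@Rle_trans _ (ln (2 * (1 + INR m)))).
      by apply: ln_le_compat; [apply: INRS_gt0 | rewrite S_INR plus_INR; lra].
    rewrite ln_mult; try lra.
    by have := exp_ineq1_le (ln (1 + INR m)); rewrite exp_ln; lra.
  rewrite (_ : INR 1 = 1) //; nra.
rewrite (_ : INR 0 = 0) //; nra.
Qed.

Definition mertens_term (n : nat) : R := if prime n then ln (INR n) / INR n else 0.
Definition mertens_sum (n : nat) := \rsum_(1 <= p < n.+1) mertens_term p.

Definition log_fact (n : nat) := \rsum_(1 <= k < n.+1) ln (INR k).

Lemma log_factS n : log_fact n.+1 = log_fact n + ln (INR n.+1).
Proof. by rewrite /log_fact big_nat_recr. Qed.

Lemma log_fact_upper n : log_fact n <= INR n * ln (INR n).
Proof.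
elim: n => [|n IH]; first by rewrite /log_fact big_geq // /INR; lra.
rewrite log_factS (S_INR n) Rmult_plus_distr_r Rmult_1_l -S_INR.
apply: Rplus_le_compat_r; apply: Rle_trans IH _.
case: n => [|n]; first by rewrite (_ : INR 0 = 0) //; lra.
apply: Rmult_le_compat_l; first exact: pos_INR.
apply: ln_le_compat; first exact: INRS_gt0.
by rewrite (S_INR n.+1); lra.
Qed.

Lemma log_fact_lower n : INR n * ln (INR n) - INR n <= log_fact n.
Proof.
elim: n => [|n IH]; first by rewrite /log_fact big_geq // /INR; lra.
rewrite log_factS (S_INR n) Rmult_plus_distr_r Rmult_1_l -S_INR.
suff : INR n * ln (INR n.+1) <= INR n * ln (INR n) + 1 by have := S_INR n; lra.
case: n {IH} => [|n]; first by rewrite (_ : INR 0 = 0) //; lra.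
have H := INRS_gt0 n; have H2 := INRS_gt0 n.+1.
have -> : INR n.+2 = INR n.+1 * (INR n.+2 / INR n.+1) by field; lra.
rewrite ln_mult //; last exact: Rdiv_lt_0_compat.
have : ln (INR n.+2 / INR n.+1) <= / INR n.+1.
  have := exp_ineq1_le (ln (INR n.+2 / INR n.+1)).
  rewrite exp_ln; last exact: Rdiv_lt_0_compat.
  have : INR n.+2 / INR n.+1 = 1 + / INR n.+1 by rewrite (S_INR n.+1); field; lra.
  lra.
move=> H3; have : INR n.+1 * ln (INR n.+2 / INR n.+1) <= INR n.+1 * / INR n.+1.
  by apply: Rmult_le_compat_l; lra.
rewrite Rinv_r; lra.
Qed.

Lemma logn_fact_sum p n : \rsum_(1 <= k < n.+1) INR (logn p k) = INR (logn p n`!).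
Proof.
elim: n => [|n IH]; first by rewrite big_geq // fact0 logn1.
by rewrite big_nat_recr //= IH factS lognM ?fact_gt0 // plus_INR Rplus_comm.
Qed.

Lemma log_fact_primes n :
  log_fact n = \rsum_(1 <= p < n.+1 | prime p) (INR (logn p n`!) * ln (INR p)).
Proof.
rewrite /log_fact.
transitivity (\rsum_(1 <= k < n.+1) \rsum_(1 <= p < n.+1) (INR (logn p k) * ln (INR p))).
  rewrite big_nat_cond [RHS]big_nat_cond; apply: eq_bigr => k; rewrite andbT ltnS => /andP [H1 H2].
  rewrite (ln_factorization k n) // big_ltn // lognE /= {1}/INR; lra.
rewrite exchange_big [RHS]big_mkcond /=; apply: eq_bigr => p _.
rewrite -big_distrl /= logn_fact_sum.
by case: ifP => // Hp; rewrite lognE Hp /= /INR; lra.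
Qed.

Lemma INR_div_bounds n d : (0 < d)%N -> INR n / INR d - 1 <= INR (n %/ d) <= INR n / INR d.
Proof.
move=> Hd; have Hd0 : 0 < INR d by apply/lt_0_INR/ltP.
have E : INR n = INR (n %/ d) * INR d + INR (n %% d).
  by rewrite -mult_INR -plus_INR; congr INR; exact: divn_eq.
have H1 : 0 <= INR (n %% d) by apply: pos_INR.
have H2 : INR (n %% d) < INR d by apply: lt_INR; apply/ltP; rewrite ltn_mod.
rewrite E; split.
  apply: (Rmult_le_reg_r (INR d)) => //.
  rewrite Rmult_minus_distr_r /Rdiv Rmult_assoc Rinv_l; lra.
by apply/Rle_div_r; lra.
Qed.

Lemma logn_fact_bounds p n : prime p ->
  INR n / INR p - 1 <= INR (logn p n`!) <= INR n / (INR p - 1).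
Proof.
move=> Hp; have Hp2 : 2 <= INR p by apply: (le_INR 2); apply/leP/prime_gt1.
have Hsum : INR (logn p n`!) = \rsum_(1 <= k < n.+1) INR (n %/ p ^ k).
  by rewrite logn_fact // (big_morph INR plus_INR (erefl (INR 0))).
split.
  case: n Hsum => [|n] Hsum.
    by have := pos_INR (logn p 0`!); rewrite (_ : INR 0 = 0) // /Rdiv; lra.
  rewrite Hsum big_ltn //= expn1.
  have := proj1 (INR_div_bounds n.+1 p (prime_gt0 Hp)).
  have : 0 <= \rsum_(2 <= k < n.+2) INR (n.+1 %/ p ^ k) by apply: rsum_ge0 => k _; apply: pos_INR.
  lra.
rewrite Hsum.
have Hi : 0 < / (INR p - 1) by apply: Rinv_0_lt_compat; lra.
pose g k := - (INR n * / (INR p - 1) * (/ INR p) ^ k.-1).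
apply: (@Rle_trans _ (\rsum_(1 <= k < n.+1) (g k.+1 - g k))).
  apply: rsum_nat_le => -[//|k] _ _; rewrite /g /=.
  apply: Rle_trans (proj2 (INR_div_bounds n (p ^ k.+1) _)) _; first by rewrite expn_gt0 prime_gt0.
  rewrite INR_expn pow_inv; apply: Req_le => /=; field.
  by repeat split; try lra; apply: pow_nonzero; lra.
rewrite rsum_telescope // /g /=.
have : 0 <= INR n * / (INR p - 1) * (/ INR p) ^ n.
  do !apply: Rmult_le_pos; [exact: pos_INR | lra | apply: pow_le; apply/Rlt_le/Rinv_0_lt_compat; lra].
lra.
Qed.

Lemma log_weight_bound k : (2 <= k)%N ->
  ln (INR k) / (INR k * (INR k - 1)) <= 4 * exp (- (1 + 1 / 2) * ln (INR k)).
Proof.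
move=> Hk; have Hk2 : 2 <= INR k by apply: (le_INR 2); apply/leP.
move: (INR k) Hk2 => x Hx.
have Hs : 0 < sqrt x by apply: sqrt_lt_R0; lra.
have Es : sqrt x * sqrt x = x by apply: sqrt_sqrt; lra.
have -> : exp (- (1 + 1 / 2) * ln x) = / (x * sqrt x).
  rewrite (_ : - (1 + 1 / 2) * ln x = - (ln x + 1 / 2 * ln x)); last ring.
  by rewrite exp_Ropp exp_plus exp_ln ?sqrt_exp_ln; lra.
have Hl : ln x <= 2 * sqrt x.
  by have := ln_le_sqrt x ltac:(lra); have := ln_le_compat x (1 + x) ltac:(lra) ltac:(lra); lra.
apply/Rle_div_l; first by apply: Rmult_lt_0_compat; lra.
have -> : 4 * / (x * sqrt x) * (x * (x - 1)) = 4 * (x - 1) / sqrt x by field; lra.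
apply/Rle_div_r => //; nra.
Qed.

Lemma mertens_first n : (0 < n)%N -> Rabs (mertens_sum n - ln (INR n)) <= 13.
Proof.
move=> Hn; have Hn0 : 0 < INR n by apply/lt_0_INR/ltP.
have EA : INR n * mertens_sum n = \rsum_(1 <= p < n.+1 | prime p) (INR n / INR p * ln (INR p)).
  rewrite /mertens_sum /mertens_term -big_mkcond big_distrr /=.
  by apply: eq_bigr => p _; rewrite /Rdiv; ring.
have Up := log_fact_upper n; have Lo := log_fact_lower n; rewrite log_fact_primes in Up Lo.
have U : INR n * mertens_sum n - chebyshev_theta n <= INR n * ln (INR n).
  apply: Rle_trans Up; rewrite EA.
  have -> : chebyshev_theta n = \rsum_(1 <= p < n.+1 | prime p) ln (INR p).
    by rewrite /chebyshev_theta big_mkcond big_ltn //= -big_mkcond /=; lra.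
  rewrite -rsum_minus; apply: rsum_le => p Hp.
  by have [H1 H2] := logn_fact_bounds p n Hp; have := ln_nat_ge0 p; nra.
have L : INR n * ln (INR n) - INR n <= INR n * mertens_sum n + INR n * 12.
  apply: Rle_trans Lo _; rewrite EA.
  apply: (@Rle_trans _ (\rsum_(1 <= p < n.+1 | prime p) (INR n / INR p * ln (INR p)) +
     \rsum_(1 <= p < n.+1 | prime p) (INR n * (4 * exp (- (1 + 1 / 2) * ln (INR p)))))).
    rewrite -big_split; apply: rsum_le => p Hp /=.
    have [H1 H2] := logn_fact_bounds p n Hp.
    have Hp2 : 2 <= INR p by apply: (le_INR 2); apply/leP/prime_gt1.
    apply: Rle_trans (Rmult_le_compat_r _ _ _ (ln_nat_ge0 p) H2) _.
    have -> : INR n / (INR p - 1) * ln (INR p) = INR n / INR p * ln (INR p)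
       + INR n * (ln (INR p) / (INR p * (INR p - 1))) by field; lra.
    apply: Rplus_le_compat_l; apply: Rmult_le_compat_l; first lra.
    by apply: log_weight_bound; apply: prime_gt1.
  apply: Rplus_le_compat_l; rewrite -big_distrr -big_distrr /=; apply: Rmult_le_compat_l; first lra.
  suff : \rsum_(1 <= p < n.+1 | prime p) exp (- (1 + 1 / 2) * ln (INR p)) <= 3 by lra.
  apply: (@Rle_trans _ (\rsum_(1 <= p < n.+1) exp (- (1 + 1 / 2) * ln (INR p)))).
    rewrite big_mkcond; apply: rsum_le => p _; case: ifP => _; first lra.
    by apply/Rlt_le/exp_pos.
  rewrite big_add1 /=; apply: Rle_trans (power_sum_bound (1 / 2) n ltac:(lra)) _; lra.
have Th := theta_bound n.
by apply: Rabs_le; split; apply: (Rmult_le_reg_l (INR n)) => //; lra.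
Qed.

Lemma abel_bound (w e : nat -> R) (C : R) (a d : nat) :
  (forall n, Rabs (e n) <= C) -> (forall n, 0 <= w n) ->
  (forall n, (a < n)%N -> (n < a + d)%N -> w n.+1 <= w n) ->
  Rabs (\rsum_(a <= n < a + d) (w n.+1 * (e n.+1 - e n))) <= 2 * C * w a.+1.
Proof.
move=> He Hw.
have HC : 0 <= C by have := He 0%N; have := Rabs_pos (e 0%N); lra.
case: d => [|d] Hm.
  by rewrite addn0 big_geq // Rabs_R0; have := Hw a.+1; nra.
suff H : Rabs (\rsum_(a <= n < a + d.+1) (w n.+1 * (e n.+1 - e n)) - w (a + d.+1)%N * e (a +
  d.+1)%N) <= C * (2 * w a.+1 - w (a + d.+1)%N).
  have := He (a + d.+1)%N; have := Hw (a + d.+1)%N; move: H.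
  move: (\rsum_(_ <= n < _) _) (w (a + d.+1)%N) (e (a + d.+1)%N) =>
    S v x /Rabs_le_between H Hv /Rabs_le_between Hx.
  have : - (C * v) <= v * x <= C * v by split; nra.
  move=> ?; apply: Rabs_le; lra.
elim: d Hm => [|d IH] Hm.
  rewrite addn1 big_nat1.
  have -> : w a.+1 * (e a.+1 - e a) - w a.+1 * e a.+1 = - (w a.+1 * e a) by ring.
  rewrite Rabs_Ropp Rabs_mult (Rabs_pos_eq _ (Hw _)).
  by have := He a; have := Hw a.+1; nra.
rewrite !addnS big_nat_recr /=; last by rewrite -addnS leq_addr.
have {}IH : Rabs (\rsum_(a <= n < a + d.+1) (w n.+1 * (e n.+1 - e n)) - w (a + d.+1)%N * e (a + d.+1)%N)
    <= C * (2 * w a.+1 - w (a + d.+1)%N).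
  by apply: IH => n H1 H2; apply: Hm => //; rewrite addnS; apply: ltnW.
have Hd : w (a + d).+2 <= w (a + d).+1.
  by apply: Hm; rewrite ?addnS ltnS ?leq_addr.
move: IH; rewrite addnS => IH.
have := He (a + d).+1; move: IH Hd.
move: (\rsum_(_ <= n < _) _) (w (a + d).+1) (e (a + d).+1) (w (a + d).+2) (e (a + d).+2) =>
  S v x v' x' /Rabs_le_between IH Hd /Rabs_le_between Hx.
have : - (C * (v - v')) <= (v - v') * x <= C * (v - v') by split; nra.
move=> ?; apply: Rabs_le; lra.
Qed.

Lemma mertens_error n : Rabs (mertens_sum n - ln (INR n)) <= 13.
Proof.
case: n => [|n]; last exact: mertens_first.
rewrite /mertens_sum big_geq // /ln; case: Rlt_dec => [H|_] /=; last by rewrite Rminus_0_r Rabs_R0; lra.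
by exfalso; move: H; rewrite (_ : INR 0 = 0) //; lra.
Qed.

Lemma prime_sum_bounds (phi Phi : R -> R) (X K : R) (a b : nat) :
  (forall x, 1 <= x -> 0 <= phi x) -> (forall x y, 1 <= x <= y -> phi y <= phi x) -> phi 1 <= 1 ->
  (forall x y, 1 <= x <= y -> phi y * (y - x) <= Phi y - Phi x <= phi x * (y - x)) ->
  0 < X -> exp 1 * X <= INR a -> INR a + 1 <= exp 2 * X -> (a <= b)%N ->
  INR b <= exp K * X < INR b + 1 ->
  Phi K - Phi 2 - 26 <=
  \rsum_(a.+1 <= n < b.+1 | prime n) (phi (ln (INR n) - ln X) * (ln (INR n) / INR n)) <=
  Phi K - Phi 1 + 26.
Proof.
move=> Hphi Hanti Hphi1 HPhi HX Ha1 Ha2 Hab [Hb1 Hb2].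
have Ha0 : 0 < INR a by have := exp_pos 1; nra.
pose l n := ln (INR n) - ln X.
have Hl n : (a <= n)%N -> 1 <= l n.
  move=> /leP/le_INR Hn; rewrite /l.
  have := ln_le_compat (exp 1 * X) (INR n) ltac:(by apply: Rmult_lt_0_compat;
    [apply: exp_pos|]) ltac:(lra).
  by rewrite ln_mult ?ln_exp //; [lra | apply: exp_pos].
have Hlm n : (a <= n)%N -> l n <= l n.+1.
  move=> /leP/le_INR Hn; rewrite /l S_INR.
  by have := ln_le_compat (INR n) (INR n + 1) ltac:(lra) ltac:(lra); lra.
have HlK : l b <= K.
  have Hb0 : 0 < INR b by move/leP/le_INR: Hab; lra.
  rewrite /l; have := ln_le_compat _ _ Hb0 Hb1.
  by rewrite ln_mult ?ln_exp //; [lra | apply: exp_pos].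
have HlK1 : K <= l b.+1.
  rewrite /l S_INR; have := ln_le_compat (exp K * X) (INR b + 1) ltac:(by apply:
    Rmult_lt_0_compat; [apply: exp_pos|]) ltac:(lra).
  by rewrite ln_mult ?ln_exp //; [lra | apply: exp_pos].
have Hla2 : l a.+1 <= 2.
  rewrite /l S_INR; have := ln_le_compat (INR a + 1) (exp 2 * X) ltac:(lra) Ha2.
  by rewrite ln_mult ?ln_exp //; [lra | apply: exp_pos].
have Hmono x y : 1 <= x <= y -> Phi x <= Phi y.
  move=> H; have [H1 _] := HPhi x y H.
  have := Hphi y ltac:(lra); nra.
pose w n := phi (Rmax 1 (l n)).
have Hw0 n : 0 <= w n by apply: Hphi; apply: Rmax_l.
have HwE n : (a <= n)%N -> w n = phi (l n) by move=> Hn; rewrite /w Rmax_right //; apply: Hl.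
have Hw1 : w a.+1 <= 1.
  by apply: Rle_trans Hphi1; apply: Hanti; split; [lra | apply: Rmax_l].
pose e n := mertens_sum n - ln (INR n).
have Habel := abel_bound w e 13 a (b - a) mertens_error Hw0.
rewrite subnKC // in Habel.
have {Habel} /Rabs_le_between Habel : Rabs (\rsum_(a <= n < b) (w n.+1 * (e n.+1 - e n))) <= 26.
  apply: Rle_trans (Habel _) _; last lra.
  move=> n Hn _; rewrite !HwE ?(leqW (ltnW Hn)) ?(ltnW Hn) //.
  by apply: Hanti; split; [apply: Hl; apply: ltnW | apply: Hlm; apply: ltnW].
set S := \rsum_(_ <= n < _ | _) _.
have -> : S = \rsum_(a <= n < b) (w n.+1 * (e n.+1 - e n)) + \rsum_(a <=
  n < b) (w n.+1 * (l n.+1 - l n)).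
  rewrite /S -big_split /= big_add1 /= big_mkcond big_nat_cond [RHS]big_nat_cond.
  apply: eq_bigr => n; rewrite andbT => /andP [Hn _].
  rewrite /e /mertens_sum big_nat_recr //= {2}/mertens_term /l HwE; last exact: leqW.
  by case: ifP => _; rewrite /l; ring.
have Hup : \rsum_(a <= n < b) (w n.+1 * (l n.+1 - l n)) <= Phi (l b) - Phi (l a).
  rewrite -(rsum_telescope (fun n => Phi (l n))) //; apply: rsum_nat_le => n Hn _.
  rewrite HwE; last exact: leqW.
  by apply: (proj1 (HPhi _ _ _)); split; [apply: Hl | apply: Hlm].
have Hlow : Phi (l b.+1) - Phi (l a.+1) <= \rsum_(a <= n < b) (w n.+1 * (l n.+1 - l n)).
  rewrite -(rsum_telescope (fun n => Phi (l n.+1))) //; apply: rsum_nat_le => n Hn _.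
  rewrite HwE; last exact: leqW.
  apply: Rle_trans (proj2 (HPhi _ _ _)) _; first by split; [apply: Hl; apply: leqW | apply: Hlm;
    apply: leqW].
  apply: Rmult_le_compat_l; first by apply: Hphi; apply: Hl; apply: leqW.
  rewrite /l; move/leP/le_INR: Hn => Hn.
  suff : ln (INR n.+2) + ln (INR n) <= ln (INR n.+1) + ln (INR n.+1) by lra.
  have H1 := INRS_gt0 n; have H2 := INRS_gt0 n.+1.
  rewrite -!ln_mult //; last lra.
  apply: ln_le_compat; first by apply: Rmult_lt_0_compat; lra.
  by rewrite !S_INR; nra.
have := Hmono (l b) K ltac:(by split; [apply: Hl|]).
have := Hmono K (l b.+1) ltac:(by split; [have := Hl b Hab; lra | lra]).
have := Hmono 1 (l a) ltac:(by split; [lra | apply: Hl]).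
have := Hmono (l a.+1) 2 ltac:(by split; [apply: Hl; apply: leqW |]).
lra.
Qed.

Lemma ln_diff_bounds x y : 1 <= x <= y -> / y * (y - x) <= ln y - ln x <= / x * (y - x).
Proof.
move=> H.
have H1 : ln (y / x) <= y / x - 1.
  have P : 0 < y / x by apply: Rdiv_lt_0_compat; lra.
  by have := exp_ineq1_le (ln (y / x)); rewrite exp_ln //; lra.
have H2 : ln (x / y) <= x / y - 1.
  have P : 0 < x / y by apply: Rdiv_lt_0_compat; lra.
  by have := exp_ineq1_le (ln (x / y)); rewrite exp_ln //; lra.
rewrite ln_div in H1; try lra; rewrite ln_div in H2; try lra.
have -> : / y * (y - x) = 1 - x / y by field; lra.
have -> : / x * (y - x) = y / x - 1 by field; lra.
lra.
Qed.

Definition primes_between (a b : nat) := [seq p <- index_iota a.+1 b.+1 | prime p].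
Definition prime_between (a b : nat) (i : 'I_(size (primes_between a b))) : nat :=
  nth 0%N (primes_between a b) i.

Lemma prime_betweenP a b i : prime (prime_between a b i) /\
  (a < prime_between a b i)%N /\ (prime_between a b i <= b)%N.
Proof.
have : prime_between a b i \in primes_between a b by apply: mem_nth.
by rewrite mem_filter mem_index_iota ltnS => /and3P [-> -> ->].
Qed.

Lemma prime_between_inj a b : injective (@prime_between a b).
Proof.
move=> i j /eqP; rewrite nth_uniq //; first by move/eqP/val_inj.
by apply: filter_uniq; apply: iota_uniq.
Qed.

Lemma sum_prime_between a b (F : nat -> R) :
  \rsum_(i : 'I_(size (primes_between a b))) F (prime_between a b i) =
  \rsum_(a.+1 <= n < b.+1 | prime n) F n.
Proof.
by rewrite -[RHS]big_filter (big_nth 0%N) big_mkord.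
Qed.

Local Arguments pow : simpl never.

(** * Optimization *)

Lemma exp_2_ge4 : 4 <= exp 2.
Proof.
rewrite (_ : 2 = 1 + 1); last ring.
by rewrite exp_plus; have := exp_ineq1_le 1; nra.
Qed.

Lemma exp_minus1_le delta x : 0 <= x -> 2 * x <= delta -> delta <= 1 ->
  exp x - 1 <= (1 + delta) * x.
Proof.
move=> H0 Hx Hd.
have H := exp_ineq1_le (- x); rewrite exp_Ropp in H.
have P := exp_pos x.
have : (1 + - x) * exp x <= 1.
  have := Rmult_le_compat_r (exp x) _ _ (Rlt_le _ _ P) H.
  by rewrite Rinv_l; lra.
have : 1 <= (1 - x) * (1 + (1 + delta) * x) by nra.
nra.
Qed.

Lemma one_plus_ge_exp x : 0 <= x -> exp (x / (1 + x)) <= 1 + x.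
Proof.
move=> Hx; have H := exp_ineq1_le (- (x / (1 + x))); rewrite exp_Ropp in H.
have E : 1 + - (x / (1 + x)) = / (1 + x) by field; lra.
rewrite E in H.
by have := Rinv_le_contravar _ _ (Rinv_0_lt_compat (1 + x) ltac:(lra)) H; rewrite !Rinv_inv.
Qed.

Lemma tilted_prod (I : finType) (c x : I -> R) : (forall i, 0 <= c i) -> (forall i, 0 <= x i) ->
  \rprod_(i : I) (1 + c i * exp (x i)) <=
  \rprod_(i : I) (1 + c i) * exp (\rsum_(i : I) (c i * (exp (x i) - 1))).
Proof.
move=> Hc Hx; rewrite exp_rsum -big_split /=; apply: rprod_le => i.
have H1 := Hc i; have H2 := exp_ineq1_le (x i); have H3 := Hx i.
split; first by have := exp_pos (x i); nra.
have := exp_ineq1_le (c i * (exp (x i) - 1)).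
have : 0 <= c i * (exp (x i) - 1) by apply: Rmult_le_pos; lra.
nra.
Qed.

Lemma exp_m2 x : x <= - 2 -> exp x <= 1 / 4.
Proof.
move=> Hx; have : exp (- 2) <= 1 / 4.
  rewrite exp_Ropp (_ : 1 / 4 = / 4); last lra.
  by apply: Rinv_le_contravar; [lra | apply: exp_2_ge4].
by have := exp_le_compat x (- 2) Hx; lra.
Qed.

Lemma resonance_conclusion (zeta : C -> C) (T Y V : R) (I : finType) (p : I -> nat) (f : I -> R)
  (delta theta eta W E0 : R) :
  is_riemann_zeta zeta -> 1 <= Y -> 2 * Y <= T -> 0 <= V ->
  (forall t, Y <= t <= T -> fst (zeta (1 / 2, t)) <= V) ->
  (forall i, prime (p i)) -> injective p -> (forall i, 0 < f i <= 1) ->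
  0 <= delta <= 1 -> 0 <= theta -> 0 <= eta ->
  (forall i, f i ^ 2 + f i / sqrt (INR (p i)) <= delta) ->
  (forall i, 2 * (theta * - ln (f i ^ 2)) <= delta) ->
  (1 + delta) * (theta * \rsum_(i : I) ((f i ^ 2 + f i / sqrt (INR (p i))) * - ln (f i ^ 2))) + 2
    <= theta * W ->
  (forall i, exp (eta * ln (INR (p i))) <= E0) ->
  E0 * \rsum_(i : I) (f i / sqrt (INR (p i))) + 2 <= eta * ln T ->
  exp ((1 - delta) * \rsum_(i : I) (f i / sqrt (INR (p i)))) <=
  384 * (V + 1) + 8 * ((8 * sqrt T * ln (1 + T) + 41 * sqrt T + 525 * Y) / T)
     * exp (W + \rsum_(i : I) (f i ^ 2)).
Proof.
move=> Hz HY HT HV Hzeta Hp Hinj Hf Hdelta Hth Heta Hab Hthz HW HE HQ.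
have [N HN] := nat_floor T ltac:(lra).
have HT0 : 0 < T by lra.
have Hf0 i : 0 < f i by case: (Hf i).
have Hsq i : 0 < / sqrt (INR (p i)).
  by apply/Rinv_0_lt_compat/sqrt_lt_R0/lt_0_INR/ltP/prime_gt0.
pose a i := f i ^ 2; pose b i := f i / sqrt (INR (p i)).
have Ha i : 0 < a i by rewrite /a; have := Hf0 i; nra.
have Hb i : 0 < b i by apply: Rmult_lt_0_compat.
have Hz0 i : 0 <= - ln (f i ^ 2).
  have [F0 F1] := Hf i.
  have : ln (f i ^ 2) <= ln 1 by apply: ln_le_compat; nra.
  by rewrite ln_1; lra.
have Low := gcd_sum_lower I p f W theta eta T N Hp Hinj Hf Hth Heta HT0 HN.
have Res := resonance_bound zeta T Y V _ N _ (sqfree p) (resonator f W) Hz HY HT HV Hzeta HN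
   (fun g => sqfree_gt0 I p g Hp) (sqfree_inj I p Hp Hinj) (fun g => resonator_ge0 I f W g Hf0)
   (resonator_l1 I f W Hf0).
have Norm := resonator_l2 I f W Hf0.
have Norm0 : 0 <= \rsum_(g : {ffun I -> bool}) (resonator f W g ^ 2).
  by apply: rsum_ge0 => g _; apply: pow2_ge_0.
set S := \rsum_(1 <= k < N.+1) _ in Low Res.
set Er := (_ + _) / T in Res *.
have HEr : 0 <= Er.
  apply: Rmult_le_pos; last by apply/Rlt_le/Rinv_0_lt_compat.
  have L1 := sqrt_pos T; have L2 := ln_ge0 (1 + T) ltac:(lra).
  have : 0 <= sqrt T * ln (1 + T) by apply: Rmult_le_pos.
  lra.
set PA := \rprod_(i : I) (1 + f i ^ 2) in Res Norm.
set PT := \rprod_(i : I) (1 + (f i ^ 2 + f i / sqrt (INR (p i)))) in Low.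
have HPA : 0 < PA by apply: rprod_gt0 => i; have := Ha i; rewrite /a; lra.
have HPT : 0 < PT by apply: rprod_gt0 => i; have := Ha i; have := Hb i; rewrite /a /b; lra.
have T1 : exp (- theta * W) * \rprod_(i : I) (1 + (f i ^ 2 + f i / sqrt (INR (p i))) * exp (theta
  * - ln (f i ^ 2))) <= PT * (1 / 4).
  have H := tilted_prod I (fun i => a i + b i) (fun i => theta * - ln (f i ^ 2))
    (fun i => ltac:(by have := Ha i; have := Hb i; lra)) (fun i => Rmult_le_pos _ _ Hth (Hz0 i)).
  rewrite -/PT in H.
  apply: Rle_trans (Rmult_le_compat_l _ _ _ (Rlt_le _ _ (exp_pos _)) H) _.
  rewrite (_ : forall x y z : R, x * (y * z) = y * (x * z)); last by move=> *; ring.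
  rewrite -exp_plus; apply: Rmult_le_compat_l; first lra.
  apply: exp_m2.
  suff : \rsum_(i : I) ((a i + b i) * (exp (theta * - ln (f i ^ 2)) - 1)) <=
     (1 + delta) * (theta * \rsum_(i : I) ((f i ^ 2 + f i / sqrt (INR (p i))) * - ln (f i ^ 2))) by lra.
  rewrite !big_distrr /=; apply: rsum_le => i _.
  have H1 := exp_minus1_le delta _ (Rmult_le_pos _ _ Hth (Hz0 i)) (Hthz i) (proj2 Hdelta).
  apply: (@Rle_trans _ ((a i + b i) * ((1 + delta) * (theta * - ln (f i ^ 2))))).
    by apply: Rmult_le_compat_l => //; have := Ha i; have := Hb i; lra.
  by apply: Req_le; rewrite /a /b; ring.
have T2 : exp (- eta * ln T) * \rprod_(i : I) (1 + (f i ^ 2 + f i / sqrt (INR (p i)) * exp (eta *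
  ln (INR (p i))))) <= PT * (1 / 4).
  have H : \rprod_(i : I) (1 + (f i ^ 2 + f i / sqrt (INR (p i)) * exp (eta * ln (INR (p i))))) <=
      PT * exp (\rsum_(i : I) (b i * E0)).
    rewrite exp_rsum -big_split /=; apply: rprod_le => i.
    have P1 := Ha i; have P2 := Hb i; have P3 := exp_pos (eta * ln (INR (p i))); have P4 := HE i.
    rewrite -/(a i) -/(b i); split; first by nra.
    have P5 := exp_ineq1_le (b i * E0).
    have : b i * exp (eta * ln (INR (p i))) <= b i * E0 by apply: Rmult_le_compat_l; lra.
    have : 0 <= b i * E0 by apply: Rmult_le_pos; lra.
    nra.
  apply: Rle_trans (Rmult_le_compat_l _ _ _ (Rlt_le _ _ (exp_pos _)) H) _.
  rewrite (_ : forall x y z : R, x * (y * z) = y * (x * z)); last by move=> *; ring.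
  rewrite -exp_plus; apply: Rmult_le_compat_l; first lra.
  by apply: exp_m2; rewrite -big_distrl /= /b; lra.
have PTA : PA * exp ((1 - delta) * \rsum_(i : I) b i) <= PT.
  rewrite big_distrr exp_rsum /PA /PT -big_split /=; apply: rprod_le => i.
  have P1 := Ha i; have P2 := Hb i; have P3 := Hab i; rewrite -/(a i) -/(b i) in P3 *.
  split; first by apply: Rmult_le_pos; [lra | apply/Rlt_le/exp_pos].
  have P4 : 0 <= b i / (1 + a i).
    by apply: Rmult_le_pos; [lra | apply/Rlt_le/Rinv_0_lt_compat; lra].
  have P5 := one_plus_ge_exp _ P4.
  have P6 : (1 - delta) * b i <= b i / (1 + a i) / (1 + b i / (1 + a i)).
    have -> : b i / (1 + a i) / (1 + b i / (1 + a i)) = b i / (1 + a i + b i) by field; lra.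
    apply: (proj1 (Rle_div_r _ _ _ _)); first lra.
    have Q0 := Rmult_le_compat_l (1 - delta) (1 + a i + b i) (1 + delta) ltac:(lra) ltac:(lra).
    have Q1 : (1 - delta) * (1 + a i + b i) <= 1 by have := pow2_ge_0 delta; lra.
    by have := Rmult_le_compat_l (b i) _ _ (Rlt_le _ _ P2) Q1; lra.
  have P7 := Rle_trans _ _ _ (exp_le_compat _ _ P6) P5.
  have : (1 + a i) * exp ((1 - delta) * b i) <= (1 + a i) * (1 + b i / (1 + a i)).
    by apply: Rmult_le_compat_l; lra.
  have -> : (1 + a i) * (1 + b i / (1 + a i)) = 1 + (a i + b i) by field; lra.
  by [].
have HPA2 : PA <= exp (\rsum_(i : I) (f i ^ 2)).
  rewrite exp_rsum; apply: rprod_le => i.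
  by split; [have := Ha i; rewrite /a; lra | apply: exp_ineq1_le].
have U : S <= 4 * (48 * (V + 1) + Er * (exp W * PA)) * PA.
  apply: Rle_trans Res _; apply: Rmult_le_compat_l => //.
  have : 0 <= Er * (exp W * PA).
    by apply: Rmult_le_pos => //; apply: Rmult_le_pos; [apply/Rlt_le/exp_pos | lra].
  lra.
have U2 : PA * exp ((1 - delta) * \rsum_(i : I) b i) <=
  PA * (8 * (48 * (V + 1) + Er * (exp W * PA))) by lra.
have U3 := Rmult_le_reg_l _ _ _ HPA U2.
rewrite exp_plus.
have : Er * (exp W * PA) <= Er * (exp W * exp (\rsum_(i : I) (f i ^ 2))).
  by apply: Rmult_le_compat_l => //; apply: Rmult_le_compat_l => //; apply/Rlt_le/exp_pos.
rewrite /b in U3; lra.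
Qed.

Lemma ln_le_linear (eps x : R) : 0 < eps -> 0 < x -> ln x <= eps * x - ln eps.
Proof.
move=> He Hx; have H := exp_ineq1_le (ln (eps * x)).
have P : 0 < eps * x by apply: Rmult_lt_0_compat.
by rewrite exp_ln // ln_mult // in H; lra.
Qed.

Lemma mul_ge_self x c : 0 <= x -> 1 <= c -> x <= x * c.
Proof. by move=> Hx Hc; nra. Qed.

Lemma exp_1_bounds : 2 <= exp 1 <= 4.
Proof.
split; first by have := exp_ineq1_le 1; lra.
have H := exp_ineq1_le (- (1 / 2)); rewrite exp_Ropp in H.
have P := exp_pos (1 / 2).
have : exp (1 / 2) <= 2.
  have := Rmult_le_compat_r (exp (1 / 2)) _ _ (Rlt_le _ _ P) H.
  by rewrite Rinv_l; lra.
by rewrite (_ : exp 1 = exp (1 / 2) * exp (1 / 2)); [nra | rewrite -exp_plus; congr exp; field].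
Qed.

Lemma prime_family (X K : R) : 2 <= X -> 2 <= K ->
  exists (n : nat) (p : 'I_n -> nat),
  [/\ forall i, prime (p i), injective p,
    forall i, 1 <= ln (INR (p i)) - ln X <= K &
    [/\ ln K - ln 2 - 26 <= \rsum_(i : 'I_n) (/ (ln (INR (p i)) - ln X) * (ln (INR (p i)) / INR
      (p i))) <= ln K + 26,
        \rsum_(i : 'I_n) (/ (ln (INR (p i)) - ln X) ^ 2 * (ln (INR (p i)) / INR (p i))) <= 27 &
        \rsum_(i : 'I_n) (ln (INR (p i)) / INR (p i)) <= K + 26]].
Proof.
move=> HX HK.
have [e1 e2] := exp_1_bounds.
have E2 : exp 2 = exp 1 * exp 1 by rewrite -exp_plus; congr exp; ring.
have X0 : 0 < X by lra.
have [a0 Ha0] := nat_floor (exp 1 * X) ltac:(nra).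
pose a := a0.+1.
have [Ha1 Ha2] : exp 1 * X <= INR a /\ INR a + 1 <= exp 2 * X.
  have := S_INR a0; rewrite S_INR in Ha0; rewrite -/a => Ea; split; first lra.
  have Q : 2 <= exp 1 * exp 1 - exp 1 by nra.
  by rewrite E2; have := Rmult_le_compat_r X _ _ (Rlt_le _ _ X0) Q; lra.
have HeK : exp 2 <= exp K by apply: exp_le_compat.
have [b Hb] := nat_floor (exp K * X) ltac:(have := exp_pos K; nra).
rewrite S_INR in Hb.
have Hab : (a <= b)%N.
  apply/leP; apply: INR_le; have : exp 2 * X <= exp K * X by apply: Rmult_le_compat_r; lra.
  move=> H; apply: Rnot_lt_le => H2.
  have : (b < a)%N by apply/ltP/INR_lt.
  by move/leP/le_INR; rewrite S_INR; lra.
have HL i : 1 <= ln (INR (@prime_between a b i)) - ln X <= K.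
  have [_ [/leP/le_INR H1 /leP/le_INR H2]] := prime_betweenP a b i.
  rewrite S_INR in H1; set P := INR (prime_between a b i) in H1 H2 *.
  have Q1 : 0 < exp 1 * X by apply: Rmult_lt_0_compat; lra.
  have := ln_le_compat (exp 1 * X) P Q1 ltac:(lra).
  have := ln_le_compat P (exp K * X) ltac:(lra) ltac:(lra).
  rewrite !ln_mult ?ln_exp; try exact: exp_pos; lra.
exists (size (primes_between a b)), (@prime_between a b); split=> //.
- by move=> i; have [] := prime_betweenP a b i.
- exact: prime_between_inj.
split.
- rewrite (sum_prime_between a b (fun n => / (ln (INR n) - ln X) * (ln (INR n) / INR n))).
  have := prime_sum_bounds Rinv ln X K a b; rewrite ln_1 Rminus_0_r; apply=> //.
  + by move=> x Hx; apply/Rlt_le/Rinv_0_lt_compat; lra.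
  + by move=> x y Hx; apply: Rinv_le_contravar; lra.
  + by rewrite Rinv_1; lra.
  + by move=> x y Hx; apply: ln_diff_bounds.
- rewrite (sum_prime_between a b (fun n => / (ln (INR n) - ln X) ^ 2 * (ln (INR n) / INR n))).
  have [] // := prime_sum_bounds (fun x => / x ^ 2) (fun x => - / x) X K a b.
  + by move=> x Hx; apply/Rlt_le/Rinv_0_lt_compat; nra.
  + by move=> x y Hx; apply: Rinv_le_contravar; nra.
  + by rewrite pow1 Rinv_1; lra.
  + move=> x y Hx.
    have -> : - / y - - / x = (y - x) / (x * y) by field; lra.
    have Hy : / y <= / x by apply: Rinv_le_contravar; lra.
    have Py : 0 < / y by apply: Rinv_0_lt_compat; lra.
    rewrite (_ : / y ^ 2 = / y * / y); last by field; lra.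
    rewrite (_ : / x ^ 2 = / x * / x); last by field; lra.
    rewrite (_ : (y - x) / (x * y) = / x * / y * (y - x)); last by field; lra.
    split; apply: Rmult_le_compat_r; nra.
  + have : 0 < / K by apply: Rinv_0_lt_compat; lra.
    rewrite Rinv_1; lra.
- rewrite (eq_bigr (fun i => 1 * (ln (INR (@prime_between a b i)) / INR (@prime_between a b
  i)))); last by move=> i _; rewrite Rmult_1_l.
  rewrite (sum_prime_between a b (fun n => 1 * (ln (INR n) / INR n))).
  have [] // := prime_sum_bounds (fun x => 1) id X K a b; try by move=> *; lra.
Qed.

(* Here [l = log T], [y = loglog T], [z = logloglog T]. Replacing [1/p] by
   [(log p / p) / log p] with [y <= log p <= (1 + 2 delta) y] reduces all sums to
   Mertens' theorem. *)
Lemma prime_weights (delta kappa l y z : R) :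
  0 < delta <= 1 / 2 -> 0 < kappa <= 1 -> exp y = l -> exp z = y ->
  52 <= delta * z -> 28 - ln delta <= delta * z ->
  2 * ln (2 / delta) + ln z - ln kappa <= delta * z / 27 ->
  z <= delta * y -> 52 + 2 * z ^ 2 <= y -> 36 * y <= delta ^ 2 * kappa ^ 2 * l ->
  exists (n : nat) (p : 'I_n -> nat) (f : 'I_n -> R),
  [/\ [/\ forall i, prime (p i), injective p & forall i, 0 < f i <= 1],
    forall i, f i ^ 2 + f i / sqrt (INR (p i)) <= delta,
    forall i, - ln (f i ^ 2) <= 3 * y,
    forall i, ln (INR (p i)) <= 3 * y &
    [/\ sqrt kappa * sqrt (l * z / y) * (1 - delta) / (1 + 2 * delta) <=
      \rsum_(i : 'I_n) (f i / sqrt (INR (p i))),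
     \rsum_(i : 'I_n) (f i / sqrt (INR (p i))) <= 2 * sqrt (l * z / y),
     \rsum_(i : 'I_n) (f i ^ 2) <= delta * l &
     \rsum_(i : 'I_n) ((f i ^ 2 + f i / sqrt (INR (p i))) * - ln (f i ^ 2)) <=
       kappa * l * (1 + 4 * delta)]].
Proof.
move=> Hd Hk Ey Ez H52 Hld HD Hzy Hyz Hyl.
have Hz : 104 <= z by nra.
have Hy0 : 0 < y by rewrite -Ez; apply: exp_pos.
have Hl0 : 0 < l by rewrite -Ey; apply: exp_pos.
have Lz : ln y = z by rewrite -Ez ln_exp.
have Ly : ln l = y by rewrite -Ey ln_exp.
have Hy1 : 104 <= y by nra.
have Hd2 : 0 < delta ^ 2 * kappa ^ 2 <= 1.
  have [dk1 dk2] : 0 < delta * kappa <= 1 by split; nra.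
  by rewrite (_ : delta ^ 2 * kappa ^ 2 = (delta * kappa) ^ 2); [split; nra | ring].
have Hly : 36 * y <= l.
  apply: Rle_trans Hyl _; rewrite -{2}(Rmult_1_l l).
  by apply: Rmult_le_compat_r; lra.
have Hkl : 1 <= kappa * l.
  have : delta ^ 2 * kappa ^ 2 * l <= kappa * l.
    apply: Rmult_le_compat_r; first lra.
    by have : delta ^ 2 <= 1; [nra | have : kappa ^ 2 <= kappa; nra].
  lra.
pose X := l * y; pose K := delta * y; pose B := kappa * l * y / z.
have HX : 2 <= X by rewrite /X; nra.
have HK : 2 <= K by rewrite /K; lra.
have LX : ln X = y + z by rewrite /X ln_mult // Ly Lz.
have HB : 1 <= B.
  apply: (proj1 (Rle_div_r _ _ _ _)); first lra.
  have : z <= y by nra.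
  nra.
have HBX : B = kappa * X / z by rewrite /B /X /Rdiv; ring.
have LB : ln B = ln kappa + y + z - ln z.
  rewrite HBX /Rdiv ln_mult; try nra; last by apply: Rinv_0_lt_compat; lra.
  rewrite ln_mult; try nra; rewrite ln_Rinv ?LX; lra.
have EB : B = kappa * l * y / z by [].
clearbody B.
have [n [p [Hp Hinj HL [S1 S2 S0]]]] := prime_family X K HX HK.
have Pp i : 0 < INR (p i) by apply/lt_0_INR/ltP/prime_gt0.
pose L i := ln (INR (p i)) - ln X.
have HL1 i : 1 <= L i <= K := HL i.
have Llnp i : ln (INR (p i)) = y + z + L i by rewrite /L LX; ring.
have HpX i : 2 * X <= INR (p i).
  have [e1 e2] := exp_1_bounds.
  have : exp 1 * X <= INR (p i).
    rewrite -(exp_ln (INR (p i))) // Llnp -(exp_ln X) -?exp_plus ?LX; last nra.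
    by apply: exp_le_compat; have := HL1 i; lra.
  nra.
pose f i := sqrt (B / INR (p i)) / L i.
have Hsp i : 0 < sqrt (INR (p i)) by apply: sqrt_lt_R0.
have HsB : 0 < sqrt B by apply: sqrt_lt_R0; lra.
have Ef i : f i = sqrt B / (sqrt (INR (p i)) * L i).
  rewrite /f sqrt_div; try lra; last exact: Pp.
  by field; split; [have := HL1 i; lra | have := Hsp i; lra].
have Hf0 i : 0 < f i.
  rewrite Ef; apply: Rdiv_lt_0_compat => //; apply: Rmult_lt_0_compat => //; have := HL1 i; lra.
have Esq i : sqrt (INR (p i)) * sqrt (INR (p i)) = INR (p i) by apply: sqrt_sqrt; have := Pp i; lra.
have EsB : sqrt B * sqrt B = B by apply: sqrt_sqrt; lra.
have Ea i : f i ^ 2 = B / (INR (p i) * L i ^ 2).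
  rewrite Ef -[X in _ = X / _]EsB -[X in _ = _ / (X * _)](Esq i); field; split; [have := HL1 i;
    lra | have := Hsp i; lra].
have Eb i : f i / sqrt (INR (p i)) = sqrt B / (INR (p i) * L i).
  rewrite Ef -[X in _ = _ / (X * _)](Esq i); field; split; [have := HL1 i; lra | have := Hsp i; lra].
have HBz : B / (2 * X) <= 1 / (2 * z).
  rewrite HBX; have -> : kappa * X / z / (2 * X) = kappa * (1 / (2 * z)) by field; nra.
  have : 0 < 1 / (2 * z) by apply: Rdiv_lt_0_compat; lra.
  nra.
have Hz1 : 1 / (2 * z) <= delta / 2.
  by apply: (proj2 (Rle_div_l _ _ _ _)); lra.
have HBp i : B / INR (p i) <= delta / 2.
  apply: Rle_trans Hz1; apply: Rle_trans HBz; apply: Rmult_le_compat_l; first lra.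
  by apply: Rinv_le_contravar; [nra | exact: HpX].
have HsB1 : sqrt B <= B.
  rewrite -{2}EsB; apply: mul_ge_self; first lra.
  by rewrite -sqrt_1; apply: sqrt_le_1; lra.
have HaB i : f i ^ 2 <= B / INR (p i).
  rewrite Ea; apply: Rmult_le_compat_l; first lra.
  apply: Rinv_le_contravar; first exact: Pp.
  by apply: mul_ge_self; [apply/Rlt_le/Pp | apply: pow_R1_Rle; have := HL1 i; lra].
have HbB i : f i / sqrt (INR (p i)) <= B / INR (p i).
  rewrite Eb; apply: (@Rle_trans _ (B / (INR (p i) * L i))).
    apply: Rmult_le_compat_r; last lra.
    by apply/Rlt_le/Rinv_0_lt_compat/Rmult_lt_0_compat => //; have := HL1 i; lra.
  apply: Rmult_le_compat_l; first lra.
  apply: Rinv_le_contravar; first exact: Pp.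
  by apply: mul_ge_self; [apply/Rlt_le/Pp | have := HL1 i; lra].
pose D := 2 * ln (2 / delta) + ln z - ln kappa.
have HD0 : 0 <= D.
  have L1 : 0 <= ln (2 / delta).
    by apply: ln_ge0; apply: (proj1 (Rle_div_r _ _ _ _)); lra.
  have L2 : 0 <= ln z by apply: ln_ge0; lra.
  have L3 : ln kappa <= ln 1 by apply: ln_le_compat; lra.
  by rewrite ln_1 in L3; rewrite /D; lra.
have Ez' i : - ln (f i ^ 2) = L i + 2 * ln (L i) + ln z - ln kappa.
  have L0 : 0 < L i by have := HL1 i; lra.
  have -> : f i ^ 2 = B / (INR (p i) * (L i * L i)) by rewrite Ea; congr (_ / (_ * _)); ring.
  rewrite ln_div ?ln_mult //; try lra; try (by repeat apply: Rmult_lt_0_compat).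
  by rewrite LB Llnp; ring.
have Hzi i : - ln (f i ^ 2) <= (1 + delta) * L i + D.
  rewrite Ez'; have := ln_le_linear (delta / 2) (L i) ltac:(lra) ltac:(have := HL1 i; lra).
  have : ln (delta / 2) = - ln (2 / delta).
    by rewrite !ln_div; lra.
  by rewrite /D; lra.
have HaT i : 0 < ln (INR (p i)) / INR (p i).
  by apply: Rdiv_lt_0_compat => //; rewrite Llnp; have := HL1 i; lra.
have HDz : D <= delta * z / 27 by [].
pose m i := ln (INR (p i)) / INR (p i).
have {S1} [S1l S1u] : ln K - ln 2 - 26 <= \rsum_(i : 'I_n) (/ L i * m i) <= ln K + 26 := S1.
have {}S2 : \rsum_(i : 'I_n) (/ L i ^ 2 * m i) <= 27 := S2.
have {}S0 : \rsum_(i : 'I_n) m i <= K + 26 := S0.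
have HLi i : 0 < / L i by apply: Rinv_0_lt_compat; have := HL1 i; lra.
have Hup i : y <= ln (INR (p i)) <= (1 + 2 * delta) * y.
  by rewrite Llnp; have := HL1 i; rewrite /K; lra.
have Hbu i : f i / sqrt (INR (p i)) <= sqrt B / y * (/ L i * m i).
  have -> : f i / sqrt (INR (p i)) = sqrt B / ln (INR (p i)) * (/ L i * m i).
    by rewrite Eb /m; field; have := HL1 i; have := Pp i; have := Hup i; repeat split; lra.
  apply: Rmult_le_compat_r; first by apply: Rmult_le_pos; [apply/Rlt_le | apply/Rlt_le/HaT].
  apply: Rmult_le_compat_l; first lra.
  by apply: Rinv_le_contravar => //; have := Hup i; lra.
have Hbl i : sqrt B / ((1 + 2 * delta) * y) * (/ L i * m i) <= f i / sqrt (INR (p i)).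
  have -> : f i / sqrt (INR (p i)) = sqrt B / ln (INR (p i)) * (/ L i * m i).
    by rewrite Eb /m; field; have := HL1 i; have := Pp i; have := Hup i; repeat split; lra.
  apply: Rmult_le_compat_r; first by apply: Rmult_le_pos; [apply/Rlt_le | apply/Rlt_le/HaT].
  apply: Rmult_le_compat_l; first lra.
  by apply: Rinv_le_contravar; have := Hup i; lra.
have Hau i : f i ^ 2 <= B / y * (/ L i ^ 2 * m i).
  have -> : f i ^ 2 = B / ln (INR (p i)) * (/ L i ^ 2 * m i).
    by rewrite Ea /m; field; have := HL1 i; have := Pp i; have := Hup i; repeat split; lra.
  apply: Rmult_le_compat_r; first by apply: Rmult_le_pos; [apply/Rlt_le/Rinv_0_lt_compat;
    have := HL1 i; nra | apply/Rlt_le/HaT].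
  apply: Rmult_le_compat_l; first lra.
  by apply: Rinv_le_contravar => //; have := Hup i; lra.
have LK : ln K = ln delta + z by rewrite /K ln_mult ?Lz; lra.
have Hldel : ln delta <= 0 by rewrite -ln_1; apply: ln_le_compat; lra.
have [l21 l22] := ln2_bounds.
pose Q := sqrt (l * z / y).
have HQ : sqrt B * z / y = sqrt kappa * Q.
  have Hq0 : 0 <= l * z / y by apply: Rmult_le_pos; [nra | apply/Rlt_le/Rinv_0_lt_compat].
  rewrite /Q -sqrt_mult; try lra.
  rewrite -(sqrt_pow2 (sqrt B * z / y)); last first.
    by apply: Rmult_le_pos; [nra | apply/Rlt_le/Rinv_0_lt_compat].
  congr sqrt.
  have -> : (sqrt B * z / y) ^ 2 = (sqrt B * sqrt B) * z ^ 2 / y ^ 2 by field; lra.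
  by rewrite EsB EB; field; lra.
have HQ0 : 0 <= Q by apply: sqrt_pos.
have Hsk : 0 <= sqrt kappa <= 1.
  by split; [apply: sqrt_pos | rewrite -sqrt_1; apply: sqrt_le_1; lra].
have HBy : 0 < B / y by apply: Rdiv_lt_0_compat; lra.
have HsBy : 0 < sqrt B / y by apply: Rdiv_lt_0_compat; lra.
have EBy : B / y = kappa * l / z by rewrite EB; field; lra.
exists n, p, f; split.
- split=> // i; split=> //.
  have := HaB i; have := HBp i; have := Hf0 i => *; nra.
- by move=> i; have := HaB i; have := HbB i; have := HBp i; lra.
- move=> i; have := Hzi i; have := HL1 i; rewrite /K => H1 H2.
  have : (1 + delta) * L i <= (1 + delta) * (delta * y) by apply: Rmult_le_compat_l; lra.
  have : (1 + delta) * (delta * y) <= y by nra.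
  have : delta * z / 27 <= y by nra.
  lra.
- by move=> i; have := Hup i; nra.
split.
- apply: (@Rle_trans _ (\rsum_(i : 'I_n) (sqrt B / ((1 + 2 * delta) * y) * (/ L i * m i))));
  last exact: rsum_le.
  rewrite rsum_scal.
  have E : sqrt kappa * sqrt (l * z / y) * (1 - delta) / (1 + 2 * delta) =
     sqrt B / ((1 + 2 * delta) * y) * ((1 - delta) * z).
    by rewrite -/Q -HQ; field; lra.
  rewrite E; apply: Rmult_le_compat_l.
    by apply/Rlt_le/Rdiv_lt_0_compat => //; nra.
  by apply: Rle_trans S1l; lra.
- apply: (@Rle_trans _ (\rsum_(i : 'I_n) (sqrt B / y * (/ L i * m i)))); first exact: rsum_le.
  rewrite rsum_scal.
  apply: (@Rle_trans _ (sqrt B / y * (2 * z))).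
    by apply: Rmult_le_compat_l; [lra | apply: Rle_trans S1u _; lra].
  have -> : sqrt B / y * (2 * z) = 2 * (sqrt kappa * Q) by rewrite -HQ; field; lra.
  by rewrite -/Q; nra.
- apply: (@Rle_trans _ (\rsum_(i : 'I_n) (B / y * (/ L i ^ 2 * m i)))); first exact: rsum_le.
  rewrite rsum_scal.
  apply: (@Rle_trans _ (B / y * 27)).
    by apply: Rmult_le_compat_l; [lra | exact: S2].
  rewrite EBy; have -> : kappa * l / z * 27 = l * (kappa * 27 / z) by field; lra.
  rewrite [delta * l]Rmult_comm; apply: Rmult_le_compat_l; first lra.
  by apply/Rle_div_l; nra.
have Hbound : \rsum_(i : 'I_n) ((f i ^ 2 + f i / sqrt (INR (p i))) * - ln (f i ^ 2)) <=
   B / y * ((1 + delta) * \rsum_(i : 'I_n) (/ L i * m i) + D * \rsum_(i : 'I_n) (/ L i ^ 2 * m i)) +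
   sqrt B / y * ((1 + delta) * \rsum_(i : 'I_n) m i + D * \rsum_(i : 'I_n) (/ L i * m i)).
  rewrite !big_distrr -!big_split /= !big_distrr -big_split /=; apply: rsum_le => i _.
  have Hb0 : 0 < f i / sqrt (INR (p i)) by apply: Rdiv_lt_0_compat.
  have Ha0 : 0 < f i ^ 2 by have := Hf0 i; nra.
  have HR : 0 <= (1 + delta) * L i + D by have := HL1 i; nra.
  apply: (@Rle_trans _ ((f i ^ 2 + f i / sqrt (INR (p i))) * ((1 + delta) * L i + D))).
    by apply: Rmult_le_compat_l => //; lra.
  apply: (@Rle_trans _ ((B / y * (/ L i ^ 2 * m i) + sqrt B / y * (/ L i * m i)) * ((1 + delta) *
    L i + D))).
    by apply: Rmult_le_compat_r => //; have := Hau i; have := Hbu i; lra.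
  by apply: Req_le; field; have := HL1 i; lra.
apply: Rle_trans Hbound _.
have A1 : (1 + delta) * \rsum_(i : 'I_n) (/ L i * m i) + D * \rsum_(i : 'I_n) (/ L i ^ 2 * m i)
  <= z * (1 + 3 * delta).
  apply: (@Rle_trans _ ((1 + delta) * (z + 26) + D * 27)).
    apply: Rplus_le_compat; apply: Rmult_le_compat_l => //; first lra.
    by apply: Rle_trans S1u _; lra.
  nra.
have A2 : (1 + delta) * \rsum_(i : 'I_n) m i + D * \rsum_(i : 'I_n) (/ L i * m i) <= y + y.
  apply: (@Rle_trans _ ((1 + delta) * (delta * y + 26) + D * (2 * z))).
    apply: Rplus_le_compat; apply: Rmult_le_compat_l => //; first lra.
    by apply: Rle_trans S1u _; lra.
  have : D * (2 * z) <= z * (2 * z) by apply: Rmult_le_compat_r; nra.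
  nra.
have A3 : sqrt B <= delta * kappa * l / 2.
  have -> : delta * kappa * l / 2 = sqrt ((delta * kappa * l / 2) ^ 2).
    by rewrite sqrt_pow2 //; apply: Rmult_le_pos; [apply: Rmult_le_pos; nra | lra].
  apply: sqrt_le_1_alt.
  apply: (@Rle_trans _ (l * y)).
    rewrite HBX; apply/Rle_div_l; first lra.
    by rewrite -/X; nra.
  have -> : (delta * kappa * l / 2) ^ 2 = l * (delta ^ 2 * kappa ^ 2 * l / 4) by field.
  by apply: Rmult_le_compat_l; lra.
apply: (@Rle_trans _ (B / y * (z * (1 + 3 * delta)) + sqrt B / y * (y + y))).
  by apply: Rplus_le_compat; apply: Rmult_le_compat_l; lra.
have -> : B / y * (z * (1 + 3 * delta)) = kappa * l * (1 + 3 * delta) by rewrite EBy; field; lra.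
have -> : sqrt B / y * (y + y) = 2 * sqrt B by field; lra.
lra.
Qed.

Lemma exp_ge_cube x : 0 <= x -> x ^ 3 / 27 <= exp x.
Proof.
move=> Hx; have H := exp_ineq1_le (x / 3).
have -> : exp x = exp (x / 3) ^ 3.
  rewrite (_ : exp (x / 3) ^ 3 = exp (x / 3) * exp (x / 3) * exp (x / 3)); last ring.
  by rewrite -!exp_plus; congr exp; field.
have -> : x ^ 3 / 27 = (x / 3) ^ 3 by field.
by apply: pow_incr; lra.
Qed.

Lemma error_factor_bound (T l beta kappa0 : R) :
  exp l = T -> 1 <= l -> kappa0 <= 1 / 2 -> kappa0 <= 1 - beta ->
  (8 * sqrt T * ln (1 + T) + 41 * sqrt T + 525 * exp (beta * l)) / T <= (582 * l) * exp (- kappa0 * l).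
Proof.
move=> ET Hl K1 K2.
have HT : 1 <= T by rewrite -ET -exp_0; apply: exp_le_compat; lra.
have EsT : sqrt T = exp (l / 2).
  rewrite -ET -(sqrt_pow2 (exp (l / 2))); last by apply/Rlt_le/exp_pos.
  congr sqrt; rewrite (_ : exp (l / 2) ^ 2 = exp (l / 2) * exp (l / 2)); last ring.
  by rewrite -exp_plus; congr exp; field.
have Hln : ln (1 + T) <= 1 + l.
  apply: (@Rle_trans _ (ln (2 * T))); first by apply: ln_le_compat; lra.
  have LT : ln T = l by rewrite -ET ln_exp.
  by rewrite ln_mult ?LT; have := ln2_bounds; lra.
have E1 : exp (l / 2) / T = exp (- (l / 2)).
  by rewrite -ET /Rdiv -exp_Ropp -exp_plus; congr exp; field.
have E2 : exp (beta * l) / T = exp (- (1 - beta) * l).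
  by rewrite -ET /Rdiv -exp_Ropp -exp_plus; congr exp; ring.
have -> : (8 * sqrt T * ln (1 + T) + 41 * sqrt T + 525 * exp (beta * l)) / T =
  (8 * ln (1 + T) + 41) * exp (- (l / 2)) + 525 * exp (- (1 - beta) * l).
  by rewrite EsT -E1 -E2; field; lra.
have X1 : exp (- (l / 2)) <= exp (- kappa0 * l) by apply: exp_le_compat; nra.
have X2 : exp (- (1 - beta) * l) <= exp (- kappa0 * l) by apply: exp_le_compat; nra.
have X0 := exp_pos (- (l / 2)).
have : (8 * ln (1 + T) + 41) * exp (- (l / 2)) <= (8 * (1 + l) + 41) * exp (- kappa0 * l).
  by apply: Rmult_le_compat; [have := ln_ge0 (1 + T) ltac:(lra); lra | lra | lra | lra].
have : (574 + 8 * l) * exp (- kappa0 * l) <= 582 * l * exp (- kappa0 * l).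
  by apply: Rmult_le_compat_r; [apply/Rlt_le/exp_pos | lra].
lra.
Qed.

Lemma fst_le_Cmod (z : C) : fst z <= Cmod z.
Proof.
apply: Rle_trans (Rle_abs _) _.
by apply: Rle_trans (Rmax_l _ _) (Rmax_Cmod z).
Qed.

Lemma parameter_choice (beta c : R) : 0 < beta < 1 -> 0 < c < sqrt (Rmin (1 / 2) (1 - beta)) ->
  exists kappa0 kappa delta g, [/\ kappa0 <= 1 / 2, kappa0 <= 1 - beta, 0 < kappa <=
    1, 0 < delta <= 1 / 2 &
    [/\ kappa + 12 * delta <= kappa0, 0 < g &
        c + g <= sqrt kappa * ((1 - delta) * (1 - delta) / (1 + 2 * delta))]].
Proof.
move=> Hb Hc; pose kappa0 := Rmin (1 / 2) (1 - beta).
have K1 : kappa0 <= 1 / 2 by apply: Rmin_l.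
have K2 : kappa0 <= 1 - beta by apply: Rmin_r.
have K0 : 0 < kappa0 by rewrite /kappa0; apply Rmin_pos; lra.
have Hc2 : c ^ 2 < kappa0.
  rewrite -(sqrt_sqrt kappa0); last lra.
  by rewrite (_ : c ^ 2 = c * c); [apply: Rmult_le_0_lt_compat; rewrite -/kappa0 in Hc; lra | ring].
pose kappa := (c ^ 2 + kappa0) / 2.
have Hc20 : 0 < c ^ 2 by apply: pow_lt; lra.
have Hk : 0 < kappa <= 1 by rewrite /kappa; lra.
have Hsk1 : sqrt kappa <= 1 by rewrite -sqrt_1; apply: sqrt_le_1; lra.
have Hck : c < sqrt kappa.
  by rewrite -(sqrt_pow2 c); [apply: sqrt_lt_1; rewrite /kappa; lra | lra].
pose delta := Rmin (1 / 2) (Rmin ((kappa0 - kappa) / 12) ((sqrt kappa - c) / 8)).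
have D1 : delta <= 1 / 2 by apply: Rmin_l.
have D2 : delta <= (kappa0 - kappa) / 12 by apply: Rle_trans (Rmin_r _ _) (Rmin_l _ _).
have D3 : delta <= (sqrt kappa - c) / 8 by apply: Rle_trans (Rmin_r _ _) (Rmin_r _ _).
have D0 : 0 < delta by rewrite /delta; do !apply Rmin_pos; rewrite /kappa in Hck *; lra.
exists kappa0, kappa, delta, ((sqrt kappa - c) / 2); split=> //; split; [lra | lra |].
have Q : 1 - 4 * delta <= (1 - delta) * (1 - delta) / (1 + 2 * delta).
  by apply: (proj1 (Rle_div_r _ _ _ _)); [lra | have := pow2_ge_0 delta; lra].
have := Rmult_le_compat_l _ _ _ (sqrt_pos kappa) Q; have := sqrt_pos kappa; nra.
Qed.

Theorem theorem1 (zeta : C -> C) (Hzeta : is_riemann_zeta zeta)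
    (beta c : R) (Hbeta : 0 < beta < 1)
    (Hc : 0 < c < sqrt (Rmin (1 / 2) (1 - beta))) :
  exists T0 : R, forall T : R, T0 <= T ->
    exists t : R, Rpower T beta <= t <= T /\
      Cmod (zeta (1 / 2, t)) >= exp (c * sqrt (ln T * ln (ln (ln T)) / ln (ln T))).
Proof.
have [kappa0 [kappa [delta [g [K1 K2 Hk Hd [Hkd Hg Hcg]]]]]] := parameter_choice beta c Hbeta Hc.
have Hdk : 0 < delta ^ 2 * kappa ^ 2 by apply: Rmult_lt_0_compat; apply: pow_lt; lra.
have Hd3 : 0 < delta ^ 3 by apply: pow_lt; lra.
have Lneg x : 0 < x <= 1 -> ln x <= 0.
  by move=> Hx; rewrite -ln_1; apply: ln_le_compat; lra.
have L1 := Lneg delta ltac:(lra); have L2 := Lneg kappa Hk; have L3 := Lneg (delta / 54) ltac:(lra).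
have L4 : 0 <= ln (2 / delta).
  by apply: ln_ge0; apply: (proj1 (Rle_div_r _ _ _ _)); lra.
pose Z1 := 52 / delta; pose Z2 := (28 - ln delta) / delta.
pose Z3 := 54 * (2 * ln (2 / delta) - ln (delta / 54) - ln kappa) / delta.
pose Z4 := 27 / delta; pose Z5 := 972 / (delta ^ 2 * kappa ^ 2).
pose Z6 := 582 / delta ^ 3; pose Z7 := 776 / g; pose Z8 := / (1 - beta).
have P1 : 0 <= Z1 by apply/Rlt_le/Rdiv_lt_0_compat; lra.
have P2 : 0 <= Z2 by apply/Rlt_le/Rdiv_lt_0_compat; lra.
have P3 : 0 <= Z3 by apply: Rmult_le_pos; [lra | apply/Rlt_le/Rinv_0_lt_compat; lra].
have P4 : 0 <= Z4 by apply/Rlt_le/Rdiv_lt_0_compat; lra.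
have P5 : 0 <= Z5 by apply/Rlt_le/Rdiv_lt_0_compat; lra.
have P6 : 0 <= Z6 by apply/Rlt_le/Rdiv_lt_0_compat; lra.
have P7 : 0 <= Z7 by apply/Rlt_le/Rdiv_lt_0_compat; lra.
have P8 : 0 <= Z8 by apply/Rlt_le/Rinv_0_lt_compat; lra.
pose Z0 := 456300 + Z1 + Z2 + Z3 + Z4 + Z5 + Z6 + Z7 + Z8.
exists (exp (exp (exp Z0))) => T HT.
pose l := ln T; pose y := ln l; pose z := ln y.
have Hl : exp (exp Z0) <= l.
  by rewrite /l -[X in X <= _]ln_exp; apply: ln_le_compat => //; apply: exp_pos.
have Hy : exp Z0 <= y.
  by rewrite /y -[X in X <= _]ln_exp; apply: ln_le_compat => //; apply: exp_pos.
have Hz : Z0 <= z.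
  by rewrite /z -[X in X <= _]ln_exp; apply: ln_le_compat => //; apply: exp_pos.
have ET : exp l = T by rewrite /l exp_ln //; have := exp_pos (exp (exp Z0)); lra.
have El : exp y = l by rewrite /y exp_ln //; have := exp_pos (exp Z0); lra.
have Ey : exp z = y by rewrite /z exp_ln //; have := exp_pos Z0; lra.
rewrite -/l -/y -/z.
clearbody l z y; clear HT Hl Hy.
have HZ0 : 456300 <= z by rewrite /Z0 in Hz; lra.
have H1 : 52 <= delta * z.
  have : Z1 <= z by rewrite /Z0 in Hz; lra.
  by move/(proj1 (Rle_div_l _ _ _ (proj1 Hd))); lra.
have H2 : 28 - ln delta <= delta * z.
  have : Z2 <= z by rewrite /Z0 in Hz; lra.
  by move/(proj1 (Rle_div_l _ _ _ (proj1 Hd))); lra.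
have H3 : 2 * ln (2 / delta) + ln z - ln kappa <= delta * z / 27.
  have : Z3 <= z by rewrite /Z0 in Hz; lra.
  move/(proj1 (Rle_div_l _ _ _ (proj1 Hd))).
  by have := ln_le_linear (delta / 54) z ltac:(lra) ltac:(lra); lra.
have Hzy : z <= y by rewrite -Ey; have := exp_ineq1_le z; lra.
have Hyl : y <= l by rewrite -El; have := exp_ineq1_le y; lra.
have Cz := exp_ge_cube z ltac:(lra); rewrite Ey in Cz.
have Cy := exp_ge_cube y ltac:(lra); rewrite El in Cy.
have C3 x : x ^ 3 = x * x ^ 2 by ring.
have H4 : z <= delta * y.
  have : Z4 <= z by rewrite /Z0 in Hz; lra.
  move/(proj1 (Rle_div_l _ _ _ (proj1 Hd))) => H.
  have : delta * (z ^ 3 / 27) <= delta * y by apply: Rmult_le_compat_l; lra.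
  have : z * 27 <= z * (z * delta * z).
    apply: Rmult_le_compat_l; first lra.
    by apply: (@Rle_trans _ (z * delta)); [lra | apply: mul_ge_self; lra].
  by rewrite C3; lra.
have H5 : 52 + 2 * z ^ 2 <= y.
  have : z ^ 2 * 81 <= z ^ 2 * z by apply: Rmult_le_compat_l; [apply: pow2_ge_0 | lra].
  have : 1 <= z ^ 2 by apply: pow_R1_Rle; lra.
  have : 52 <= z ^ 2 by rewrite (_ : z ^ 2 = z * z); [nra | ring].
  by rewrite C3 in Cz; lra.
have H6 : 36 * y <= delta ^ 2 * kappa ^ 2 * l.
  have : Z5 <= y by rewrite /Z0 in Hz; lra.
  move/(proj1 (Rle_div_l _ _ _ Hdk)) => H.
  have : delta ^ 2 * kappa ^ 2 * (y ^ 3 / 27) <=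
    delta ^ 2 * kappa ^ 2 * l by apply: Rmult_le_compat_l; lra.
  have : y * 972 <= y * (y * (delta ^ 2 * kappa ^ 2) * y).
    apply: Rmult_le_compat_l; first lra.
    by apply: (@Rle_trans _ (y * (delta ^ 2 * kappa ^ 2))); [lra | apply: mul_ge_self; lra].
  by rewrite C3; lra.
have H7 : 582 * l * exp (- (3 * delta) * l) <= 1.
  have : Z6 <= l by rewrite /Z0 in Hz; lra.
  move/(proj1 (Rle_div_l _ _ _ Hd3)) => H.
  have Cl := exp_ge_cube (3 * delta * l) ltac:(nra).
  have H' : 582 * l <= exp (3 * delta * l).
    apply: Rle_trans Cl; have -> : (3 * delta * l) ^ 3 / 27 = (l * delta ^ 3 * l) * l by field.
    apply: Rmult_le_compat_r; first lra.
    by apply: (@Rle_trans _ (l * delta ^ 3)); [lra | apply: mul_ge_self; lra].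
  rewrite (_ : - (3 * delta) * l = - (3 * delta * l)); last ring.
  rewrite exp_Ropp; have := exp_pos (3 * delta * l) => Hp.
  by apply/Rle_div_l => //; lra.
pose Q := sqrt (l * z / y).
have HQ2 : Q * Q = l * z / y.
  by apply: sqrt_sqrt; apply: Rmult_le_pos; [nra | apply/Rlt_le/Rinv_0_lt_compat; lra].
have Hly2 : 16900 * y ^ 2 <= l.
  apply: Rle_trans Cy; rewrite C3.
  have : 456300 * y ^ 2 <= y * y ^ 2 by apply: Rmult_le_compat_r; [apply: pow2_ge_0 | lra].
  lra.
have HQz : z <= Q.
  rewrite -(sqrt_pow2 z); last lra.
  apply: sqrt_le_1_alt; apply: (proj1 (Rle_div_r _ _ _ _)); first lra.
  rewrite (_ : z ^ 2 * y = z * y * z); last ring.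
  apply: Rmult_le_compat_r; first lra.
  have : z * y <= y * y by apply: Rmult_le_compat_r; lra.
  have : y ^ 2 = y * y by ring.
  have := pow2_ge_0 y; lra.
have HQl : 130 * Q <= l / y.
  rewrite -(sqrt_pow2 (l / y)); last by apply/Rlt_le/Rdiv_lt_0_compat; lra.
  rewrite -(sqrt_pow2 130) -?sqrt_mult; try lra; last first.
    by apply: Rmult_le_pos; [nra | apply/Rlt_le/Rinv_0_lt_compat; lra].
  apply: sqrt_le_1_alt.
  have -> : (l / y) ^ 2 = l * / (y * y) * l by field; lra.
  have -> : 130 ^ 2 * (l * z / y) = l * / (y * y) * (16900 * (z * y)) by field; lra.
  apply: Rmult_le_compat_l.
    by apply: Rmult_le_pos; [lra | apply/Rlt_le/Rinv_0_lt_compat; nra].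
  have : z * y <= y * y by apply: Rmult_le_compat_r; lra.
  have : y ^ 2 = y * y by ring.
  lra.
have H8 : 1 <= (1 - beta) * l.
  have : Z8 <= l by rewrite /Z0 in Hz; lra.
  by move/(Rmult_le_compat_l (1 - beta) _ _ ltac:(lra)); rewrite /Z8 Rinv_r; lra.
have EY : Rpower T beta = exp (beta * l) by rewrite /Rpower -ET ln_exp.
have HY : 1 <= Rpower T beta by rewrite EY -exp_0; apply: exp_le_compat; nra.
have HYT : 2 * Rpower T beta <= T.
  rewrite EY (_ : T = exp ((1 - beta) * l) * exp (beta * l)); last first.
    by rewrite -exp_plus -ET; congr exp; ring.
  apply: Rmult_le_compat_r; first by apply/Rlt_le/exp_pos.
  by have := exp_ineq1_le ((1 - beta) * l); lra.
apply: NNPP => Hno.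
pose V := exp (c * Q).
have HV1 : 1 <= V by rewrite /V -exp_0; apply: exp_le_compat; nra.
have HV t : Rpower T beta <= t <= T -> fst (zeta (1 / 2, t)) <= V.
  move=> Ht; apply: Rnot_lt_le => H; apply: Hno; exists t; split=> //.
  by apply: Rle_ge; have := fst_le_Cmod (zeta (1 / 2, t)); rewrite /V /Q in H *; lra.
have [n [p [f [[Hp Hinj Hf] Hab Hcost Hlnp [B1 B2 B3 B4]]]]] :=
  prime_weights delta kappa l y z Hd Hk El Ey H1 H2 H3 H4 H5 H6.
rewrite -/Q in B1 B2.
have Hy0 : 0 < y by lra.
pose theta := delta / (6 * y).
have Hth : 0 <= theta by apply/Rlt_le/Rdiv_lt_0_compat; lra.
pose W := (1 + delta) * (kappa * l * (1 + 4 * delta)) + delta * l.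
have HthW : 2 <= theta * (delta * l).
  rewrite (_ : theta * (delta * l) = delta ^ 2 * l / (6 * y)); last by rewrite /theta; field; lra.
  apply: (proj1 (Rle_div_r _ _ _ _)); first lra.
  have Hk2 : kappa ^ 2 <= 1 by rewrite (_ : kappa ^ 2 = kappa * kappa); [nra | ring].
  have : delta ^ 2 * kappa ^ 2 <= delta ^ 2 * 1 by apply: Rmult_le_compat_l => //; apply: pow2_ge_0.
  rewrite Rmult_1_r => Hdd.
  by have := Rmult_le_compat_r l _ _ ltac:(lra) Hdd; lra.
have Fin := resonance_conclusion zeta T (Rpower T beta) V _ p f delta theta (/ y) W 64
  Hzeta HY HYT ltac:(lra) HV Hp Hinj Hf ltac:(lra) Hth (Rlt_le _ _ (Rinv_0_lt_compat _ Hy0)) Hab.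
have {Fin} Fin : exp ((1 - delta) * \rsum_(i : 'I_n) (f i / sqrt (INR (p i)))) <=
  384 * (V + 1) + 8 * ((8 * sqrt T * ln (1 + T) + 41 * sqrt T + 525 * Rpower T beta) / T)
     * exp (W + \rsum_(i : 'I_n) (f i ^ 2)).
  apply: Fin.
  - move=> i; have := Rmult_le_compat_l theta _ _ Hth (Hcost i).
    rewrite (_ : theta * (3 * y) = delta / 2); [lra | rewrite /theta; field; lra].
  - have := Rmult_le_compat_l theta _ _ Hth B4 => B5.
    have := Rmult_le_compat_l (1 + delta) _ _ ltac:(lra) B5 => B6.
    have EW : theta * W = (1 + delta) * (theta * (kappa * l * (1 + 4 * delta))) + theta * (delta * l).
      by rewrite /W; ring.
    by rewrite EW; apply: Rplus_le_compat.
  - move=> i; apply: (@Rle_trans _ (exp 3)).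
      apply: exp_le_compat; have := Rmult_le_compat_l (/ y) _ _ (Rlt_le _ _ (Rinv_0_lt_compat _
        Hy0)) (Hlnp i).
      by rewrite (_ : / y * (3 * y) = 3) //; field; lra.
    rewrite (_ : exp 3 = exp 1 * exp 1 * exp 1); last by rewrite -!exp_plus; congr exp; ring.
    have [e1 e2] := exp_1_bounds.
    have : exp 1 * exp 1 <= 16 by nra.
    nra.
  - rewrite -ET ln_exp (_ : / y * l = l / y); last by field; lra.
    apply: (@Rle_trans _ (64 * (2 * Q) + 2)); last lra.
    by apply: Rplus_le_compat_r; apply: Rmult_le_compat_l; [lra | exact: B2].
have Herr : (8 * sqrt T * ln (1 + T) + 41 * sqrt T + 525 * Rpower T beta) / T * exp (W + \rsum_(i
  : 'I_n) (f i ^ 2)) <= 1.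
  rewrite EY.
  have Er := error_factor_bound T l beta kappa0 ET ltac:(lra) K1 K2.
  have HW : W + \rsum_(i : 'I_n) (f i ^ 2) <= (kappa0 - 3 * delta) * l.
    apply: (@Rle_trans _ (W + delta * l)); first lra.
    rewrite (_ : W + delta * l = ((1 + delta) * (kappa * (1 + 4 * delta)) + 2 * delta) * l);
      last by rewrite /W; ring.
    apply: Rmult_le_compat_r; first lra.
    have D7 : (1 + delta) * (1 + 4 * delta) <= 1 + 7 * delta by nra.
    have D8 := Rmult_le_compat_l kappa _ _ ltac:(lra) D7.
    have D9 : kappa * delta <= 1 * delta by apply: Rmult_le_compat_r; lra.
    lra.
  apply: Rle_trans H7.
  rewrite (_ : - (3 * delta) * l = - kappa0 * l + (kappa0 - 3 * delta) * l); last ring.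
  rewrite [X in _ <= _ * X]exp_plus -[X in _ <= X]Rmult_assoc; apply: Rmult_le_compat => //.
  - apply: Rmult_le_pos; last by rewrite -ET; apply/Rlt_le/Rinv_0_lt_compat/exp_pos.
    have S0 := sqrt_pos T; have S1 := ln_ge0 (1 + T) ltac:(have := exp_pos l; lra).
    have := exp_pos (beta * l); have : 0 <= sqrt T * ln (1 + T) by apply: Rmult_le_pos.
    lra.
  - by apply/Rlt_le/exp_pos.
  - exact: exp_le_compat.
have Hexp : (c + g) * Q <= (1 - delta) * \rsum_(i : 'I_n) (f i / sqrt (INR (p i))).
  apply: (@Rle_trans _ ((1 - delta) * (sqrt kappa * Q * (1 - delta) / (1 + 2 * delta)))); last first.
    by apply: Rmult_le_compat_l; [lra | exact: B1].
  have -> : (1 - delta) * (sqrt kappa * Q * (1 - delta) / (1 + 2 * delta)) =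
     sqrt kappa * ((1 - delta) * (1 - delta) / (1 + 2 * delta)) * Q by field; lra.
  by apply: Rmult_le_compat_r; lra.
have := exp_le_compat _ _ Hexp.
rewrite Rmult_plus_distr_r exp_plus -/V => Hfin.
have Hgq : 777 <= exp (g * Q).
  have : Z7 <= Q by rewrite /Z0 in Hz; lra.
  move/(proj1 (Rle_div_l _ _ _ Hg)).
  by have := exp_ineq1_le (g * Q); lra.
have : V * 777 <= V * exp (g * Q) by apply: Rmult_le_compat_l; lra.
lra.
Qed.
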